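(* Let $k$ be a field and let $I$ be a $\Delta$-cellular binomial ideal in $k[x]=k[x_1,\dots,x_n]$. Let $\operatorname{Hull}(I)$ denote the intersection of the minimal primary components of $I$. Then $$\operatorname{Hull}(I)=I+M_{\rm emb}(I),$$ and in particular $\operatorname{Hull}(I)$ is a binomial ideal. Assume now that $k$ is algebraically closed. If $(L_\rho,\rho)$ is the partial character on $\mathbb Z^\Delta$ such that $I\cap k[\mathbb N^\Delta]=I(\rho)$, and $g$ and $\rho_1,\dots,\rho_g$ are the number and the partial characters attached to $\rho$ as in the context, so that $I(\rho)=\bigcap_{\ell=1}^g I(\rho_\ell)$ is a minimal primary decomposition, then $$\operatorname{Hull}(I)=I+M_{\rm emb}(I)=\bigcap_{\ell=1}^g\Big[\Big((I+I(\rho_\ell)):\big(\textstyle\prod_{i\in\Delta}x_i\big)^\infty\Big)+M_{\rm emb}(I)\Big]$$ is a minimal primary decomposition of $\operatorname{Hull}(I)$.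
   Context: Conventions: $0\in\mathbb N$; $k^*$ is the multiplicative group of $k$. A binomial is a polynomial with at most two terms; a binomial ideal is an ideal generated by binomials. For $\Delta\subseteq\{1,\dots,n\}$, $\Delta^c$ is its complement, $\mathbb N^\Delta=\{u\in\mathbb N^n: u_i=0 \text{ for } i\notin\Delta\}$, $\mathbb Z^\Delta$ is defined analogously, and $k[\mathbb N^\Delta]=k[x_i: i\in\Delta]$. A partial character on $\mathbb Z^\Delta$ is a pair $(L_\rho,\rho)$ with $L_\rho$ a subgroup of $\mathbb Z^\Delta$ and $\rho:L_\rho\to k^*$ a group homomorphism. Its lattice ideal is $I(\rho)=\langle x^u-\rho(u-v)x^v: u,v\in\mathbb N^\Delta,\ u-v\in L_\rho\rangle\subseteq k[\mathbb N^\Delta]$; its extension to $k[x]$ is also denoted $I(\rho)$. The saturation of a lattice $L\subseteq\mathbb Z^\Delta$ is $\operatorname{Sat}(L)=(\mathbb Q\otimes_{\mathbb Z}L)\cap\mathbb Z^\Delta$. A proper ideal $I\subset k[x]$ is $\Delta$-cellular if $x_i$ is a nonzerodivisor modulo $I$ for $i\in\Delta$ and nilpotent modulo $I$ for $i\in\Delta^c$. If $I$ is a $\Delta$-cellular binomial ideal, there is a (unique) partial character $(L_\rho,\rho)$ on $\mathbb Z^\Delta$ with $I\cap k[\mathbb N^\Delta]=I(\rho)$. A lattice $L\subseteq\mathbb Z^\Delta$ is associated to a $\Delta$-cellular binomial ideal $I$ if there is a monomial $m\in k[\mathbb N^{\Delta^c}]$ (a witness monomial of $L$) such that $(I:m)\cap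 k[\mathbb N^\Delta]=I(\tau)$ for some partial character $\tau:L\to k^*$. With $I\cap k[\mathbb N^\Delta]=I(\rho)$, an associated lattice $L$ is embedded if $\operatorname{rank}(L)>\operatorname{rank}(L_\rho)$. $M_{\rm emb}(I)\subseteq k[x]$ is the monomial ideal generated by the witness monomials of embedded associated lattices to $I$ (it is $0$ if there are none). Decomposition of lattice ideals (known): suppose $k$ is algebraically closed of characteristic $p\ge 0$, and $(L_\rho,\rho)$ is a partial character on $\mathbb Z^\Delta$. If $p>0$, let $\operatorname{Sat}'_p(L_\rho)$ be the largest sublattice of $\operatorname{Sat}(L_\rho)$ containing $L_\rho$ such that $|\operatorname{Sat}'_p(L_\rho)/L_\rho|$ is coprime to $p$; let $\operatorname{Sat}'_0(L_\rho)=\operatorname{Sat}(L_\rho)$. Put $g=|\operatorname{Sat}'_p(L_\rho)/L_\rho|$. There are exactly $g$ distinct partial characters $\rho_1,\dots,\rho_g$ extending $\rho$ to $\operatorname{Sat}'_p(L_\rho)$, and each $\rho_\ell$ extends uniquely to a partial character $\chi_\ell$ on $\operatorname{Sat}(L_\rho)$. The associated primes of $I(\rho)$ are $I(\chi_1),\dots,I(\chi_g)$, all minimal, $I(\rho_\ell)$ is $I(\chi_\ell)$-primary, and $I(\rho)=\bigcap_{\ell=1}^g I(\rho_\ell)$ is the minimal primary decomposition. *)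

(* Defs.v *)
From HB Require Import structures.
From mathcomp Require Import all_boot all_order all_algebra.
From mathcomp Require Import boolp classical_sets.
From mathcomp Require Import mpoly.

Set Implicit Arguments.
Unset Strict Implicit.
Unset Printing Implicit Defensive.

Import GRing.Theory.
Local Open Scope ring_scope.
Local Open Scope classical_set_scope.

Section Ideals.
Variable R : comNzRingType.
Implicit Types (A I J P Q H S : set R).

(* I is an ideal of the subring A of R. *)
Definition ideal_of A I : Prop :=
  [/\ I `<=` A, I 0, (forall f g, I f -> I g -> I (f + g))
    & forall a f, A a -> I f -> I (a * f)].

(* Generators are assumed to lie in A. *)
Definition ideal_gen_of A S : set R := smallest (ideal_of A) S.

Definition is_ideal I : Prop := ideal_of setT I.
Definition ideal_gen S : set R := ideal_gen_of setT S.

Definition idealD I J : set R :=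
  [set f | exists a b, [/\ I a, J b & f = a + b]].

Definition colon I (m : R) : set R := [set f | I (f * m)].

(* I : m^oo *)
Definition saturation I (m : R) : set R :=
  [set f | exists e : nat, I (f * m ^+ e)].

Definition radical I : set R := [set f | exists e : nat, I (f ^+ e)].

Definition is_primary Q : Prop :=
  [/\ is_ideal Q, ~ Q 1
    & forall f g, Q (f * g) -> Q f \/ exists e : nat, Q (g ^+ e)].

(* Primary components with pairwise distinct radicals, none of them redundant. *)
Definition minimal_primary_decomposition I (r : nat) (Q : 'I_r -> set R) : Prop :=
  [/\ forall i, is_primary (Q i),
      I = \bigcap_i Q i,
      forall i j, i != j -> radical (Q i) <> radical (Q j)
    & forall i, ~ (\bigcap_(j in [set j | j != i]) Q j `<=` Q i)].

(* A component whose radical is minimal among the associated primes. *)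
Definition minimal_primary_component I Q : Prop :=
  exists (r : nat) (D : 'I_r -> set R) (i : 'I_r),
    [/\ minimal_primary_decomposition I D,
        forall j, radical (D j) `<=` radical (D i) ->
                  radical (D j) = radical (D i)
      & Q = D i].

Definition Hull I : set R :=
  \bigcap_(Q in [set Q | minimal_primary_component I Q]) Q.

End Ideals.

(* Subsets of Z^n are sets of row vectors over int. *)
Section Lattices.
Variable n : nat.
Implicit Types (D : {set 'I_n}) (L M : set 'rV[int]_n) (u v : 'X_{1..n}).

Definition NN D : set 'X_{1..n} := [set u | forall i, i \notin D -> u i = 0%N].
Definition ZZ D : set 'rV[int]_n := [set w | forall i, i \notin D -> w 0 i = 0].

Definition mnm_diff u v : 'rV[int]_n := \row_i ((u i)%:Z - (v i)%:Z).

Definition lattice D L : Prop :=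
  [/\ L `<=` ZZ D, L 0 & forall w z, L w -> L z -> L (w - z)].

Definition ratmx (m : nat) (A : 'M[int]_(m, n)) : 'M[rat]_(m, n) :=
  map_mx intr A.

(* The largest number of linearly independent elements of L. *)
Definition lattice_rank L : nat :=
  \max_(r < n.+1 | `[< exists A : 'M[int]_(r, n),
                         (forall i, L (row i A)) /\ row_free (ratmx A) >]) r.

(* (Q (x) L) :&: Z^D : members of Z^D in the rational span of elements of L. *)
Definition Sat D L : set 'rV[int]_n :=
  [set w | ZZ D w /\ exists (r : nat) (A : 'M[int]_(r, n)),
             (forall i, L (row i A)) /\ (ratmx w <= ratmx A)%MS].

(* M / L is finite of order g; t is a system of representatives. *)
Definition lattice_index M L (g : nat) : Prop :=
  exists t : 'I_g -> 'rV[int]_n,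
    (forall i, M (t i)) /\
    (forall w, M w -> exists! i, L (w - t i)).

(* M is a lattice between L and Sat L with #|M / L| coprime to p. *)
Definition coprime_extension D (p : nat) L M : Prop :=
  [/\ lattice D M, L `<=` M, M `<=` Sat D L
    & exists2 g : nat, lattice_index M L g & coprime g p].

(* M = Sat'_p L. *)
Definition is_Satp D (p : nat) L M : Prop :=
  if p == 0%N then M = Sat D L
  else coprime_extension D p L M /\
       (forall M', coprime_extension D p L M' -> M' `<=` M).

End Lattices.

Section Cellular.
Variables (k : fieldType) (n : nat).
Implicit Types (D : {set 'I_n}) (L M : set 'rV[int]_n).
Implicit Types (rho tau : 'rV[int]_n -> k) (I : set {mpoly k[n]}).

(* k[N^D] *)
Definition kN D : set {mpoly k[n]} :=
  [set f | forall u, u \in msupp f -> NN D u].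

Definition binomial (f : {mpoly k[n]}) : bool := (size (msupp f) <= 2)%N.

Definition binomial_ideal I : Prop :=
  exists S : set {mpoly k[n]}, (forall f, S f -> binomial f) /\ I = ideal_gen S.

(* Only the restriction of rho to L is meaningful: values outside L are
   arbitrary, and two characters on L are compared on L only. *)
Definition partial_character D L rho : Prop :=
  [/\ lattice D L, (forall w, L w -> rho w != 0)
    & forall w z, L w -> L z -> rho (w + z) = rho w * rho z].

(* I(rho), as an ideal of k[N^D]. *)
Definition lattice_ideal D L rho : set {mpoly k[n]} :=
  ideal_gen_of (kN D)
    [set f | exists u v, [/\ NN D u, NN D v, L (mnm_diff u v)
               & f = 'X_[u] - rho (mnm_diff u v) *: 'X_[v]]].

(* I(rho), extended to k[x]. *)
Definition lattice_ideal_ext D L rho : set {mpoly k[n]} :=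
  ideal_gen (lattice_ideal D L rho).

Definition cellular D I : Prop :=
  [/\ is_ideal I, ~ I 1,
      forall i, i \in D -> forall f, I (f * 'X_i) -> I f
    & forall i, i \notin D -> exists e : nat, I ('X_i ^+ e)].

Definition cellular_character D I L rho : Prop :=
  partial_character D L rho /\ I `&` kN D = lattice_ideal D L rho.

Definition witness D I L (m : 'X_{1..n}) : Prop :=
  NN (~: D)%SET m /\
  exists tau, partial_character D L tau /\
              colon I 'X_[m] `&` kN D = lattice_ideal D L tau.

Definition associated_lattice D I L : Prop := exists m, witness D I L m.

Definition embedded_lattice D I L : Prop :=
  associated_lattice D I L /\
  exists Lrho rho, cellular_character D I Lrho rho /\
                   (lattice_rank Lrho < lattice_rank L)%N.

Definition M_emb D I : set {mpoly k[n]} :=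
  ideal_gen [set f | exists L m,
    [/\ embedded_lattice D I L, witness D I L m & f = 'X_[m]]].

(* rho_ 0, ..., rho_ (g - 1) are the distinct extensions of (L, rho) to M. *)
Definition character_extensions D L rho M (g : nat)
    (rho_ : 'I_g -> 'rV[int]_n -> k) : Prop :=
  [/\ forall l, partial_character D M (rho_ l) /\
                (forall w, L w -> rho_ l w = rho w),
      forall l l', l != l' -> exists2 w, M w & rho_ l w != rho_ l' w
    & forall sigma, partial_character D M sigma ->
        (forall w, L w -> sigma w = rho w) ->
        exists l, forall w, M w -> sigma w = rho_ l w].

Definition has_characteristic (p : nat) : Prop :=
  if p == 0%N then [pchar k] =i pred0 else p \in [pchar k].

End Cellular.

(* Main.v *)
(* Let [L] be the lattice of [I], and let [E] be maximal among the subsets of [D]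
   with [L] meeting [ZZ E] only in [0].  Put [B = k[N^E]], a domain meeting [I]
   only in [0], over which [k[x]/I] has finite rank.  A monomial [m] in the
   variables outside [D] is killed modulo [I] by a nonzero element of [B] exactly
   when [m] is in [I] or the lattice of [I : m] has larger rank than [L].  Grading
   the quotient by classes of monomials, [I + M_emb I] is therefore the [B]-torsion
   closure of [I], that is, the contraction of its extension to [B^-1 k[x]].  By
   finiteness, primes containing [I] and meeting [B] only in [0] are minimal over
   [I], and this identifies the torsion closure with [Hull I].

   When [k] is algebraically closed, the [l]-th component is the [B]-torsion
   closure of [I + I(rho_ l)].  Its radical is the kernel of the map to the group
   ring of [Z^D / Sat L] given by an extension of [rho_ l] to [Z^D].  The ideals
   [I(rho_ l)] become pairwise comaximal after inverting [B], and they intersect in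
   [I(rho)] because characters separate [Satp / L]; hence the components intersect
   in the torsion closure of [I]. *)

Require Import Defs.
From HB Require Import structures.
From mathcomp Require Import all_boot all_order all_algebra.
From mathcomp Require Import boolp classical_sets.
From mathcomp Require Import mpoly.
From mathcomp Require Import ring zify.

Set Implicit Arguments.
Unset Strict Implicit.
Unset Printing Implicit Defensive.

Import Order.TTheory GRing.Theory Num.Theory.
Local Open Scope ring_scope.
Local Open Scope classical_set_scope.

(** * Ideals and primary decomposition *)

(** [Hull] refers to every minimal primary decomposition of [I], and over an arbitrary field the
    associated primes need not come from characters over [k], so the proof avoids computing them:
    the torsion closure mentions no prime. The set [E] works because, over the rationals, Z^D is the
    direct sum of the span of [L] and Z^E. A lattice in Z^D containing [L] therefore has larger rank
    exactly when it meets Z^E outside 0, and a nonzero vector z there, split into positive and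
    negative parts, gives a nonzero binomial of k[N^E].

    Monomials in the variables of [D] divide nonzero elements of k[N^E] modulo [I]. This explains
    both the saturation in the components and the comaximality: two binomials with the same
    exponents and different character values differ by a nonzero multiple of one such monomial.

    In characteristic p the ideal of [rho_ l] on [Satp] is smaller than its prime, which lives on
    the saturation. A p-power multiple carries each vector of the saturation into [Satp], and
    Frobenius turns this into the equality of radicals. *)

Section IdealTheory.
Variable R : comNzRingType.
Implicit Types (I J P Q : set R) (f g h : R).

Section Closure.
Variable I : set R.
Hypothesis idI : is_ideal I.

Lemma ideal0 : I 0. Proof. by case: idI. Qed.

Lemma ideal_add f g : I f -> I g -> I (f + g).
Proof. by case: idI => _ _ add _; apply: add. Qed.

Lemma ideal_mull f g : I g -> I (f * g).
Proof. by case: idI => _ _ _ mul; apply: mul. Qed.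

Lemma ideal_mulr f g : I f -> I (f * g).
Proof. by rewrite mulrC; apply: ideal_mull. Qed.

Lemma ideal_opp f : I f -> I (- f).
Proof. by rewrite -mulN1r; apply: ideal_mull. Qed.

Lemma ideal_sub f g : I f -> I g -> I (f - g).
Proof. by move=> If Ig; apply: ideal_add => //; apply: ideal_opp. Qed.

Lemma ideal_subC f g : I (f - g) -> I (g - f).
Proof. by move/ideal_opp; rewrite opprB. Qed.

Lemma ideal_trans g f h : I (f - g) -> I (g - h) -> I (f - h).
Proof. by move=> Ifg Igh; have := ideal_add Ifg Igh; rewrite addrA subrK. Qed.

Lemma ideal_sum (T : eqType) (s : seq T) (p : pred T) (F : T -> R) :
  (forall t, t \in s -> p t -> I (F t)) -> I (\sum_(t <- s | p t) F t).
Proof.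
move=> IF; rewrite big_seq_cond; apply: big_ind.
- exact: ideal0.
- exact: ideal_add.
- by move=> t /andP[]; apply: IF.
Qed.

Lemma ideal_equiv f g : I (f - g) -> I f <-> I g.
Proof.
move=> Ifg; split=> [If|Ig].
  by have := ideal_sub If Ifg; rewrite opprB addrC subrK.
by have := ideal_add Ifg Ig; rewrite subrK.
Qed.

End Closure.

Lemma ideal_gen_ideal (S : set R) : is_ideal (ideal_gen S).
Proof.
split=> // [J [[_ J0 _ _] _] //| f g If Ig J JS| a f _ If J JS].
  by case: (JS) => idJ _; apply: (ideal_add idJ); [apply: If|apply: Ig].
by case: (JS) => idJ _; apply: (ideal_mull idJ); apply: If.
Qed.

Lemma ideal_gen_sub (S I : set R) : is_ideal I -> S `<=` I -> ideal_gen S `<=` I.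
Proof. exact: smallest_sub. Qed.

Lemma idealD_ideal I J : is_ideal I -> is_ideal J -> is_ideal (idealD I J).
Proof.
move=> idI idJ; split=> // [|f g|a f _].
- by exists 0, 0; rewrite addr0; split=> //; apply: ideal0.
- move=> [a [b [Ia Jb ->]]] [c [d [Ic Jd ->]]].
  by exists (a + c), (b + d); rewrite addrACA; split=> //; apply: ideal_add.
- move=> [c [d [Ic Jd ->]]].
  by exists (a * c), (a * d); rewrite mulrDr; split=> //; apply: ideal_mull.
Qed.

Lemma idealDl I J : is_ideal J -> I `<=` idealD I J.
Proof. by move=> idJ f If; exists f, 0; rewrite addr0; split=> //; apply: ideal0. Qed.

Lemma idealDr I J : is_ideal I -> J `<=` idealD I J.
Proof. by move=> idI f Jf; exists 0, f; rewrite add0r; split=> //; apply: ideal0. Qed.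

Lemma idealD_sub I J Q : is_ideal Q -> I `<=` Q -> J `<=` Q -> idealD I J `<=` Q.
Proof.
by move=> idQ IQ JQ _ [a [b [Ia Jb ->]]]; apply: ideal_add => //; auto.
Qed.

Lemma colon_ideal I m : is_ideal I -> is_ideal (colon I m).
Proof.
move=> idI; split=> // [|f g|a f _]; rewrite /colon /= ?mul0r ?mulrDl -?mulrA.
- exact: ideal0.
- exact: ideal_add.
- exact: ideal_mull.
Qed.

Lemma radical_sub I : I `<=` radical I.
Proof. by move=> f If; exists 1%N; rewrite expr1. Qed.

Lemma ideal_expr I f e e' : is_ideal I -> (e <= e')%N -> I (f ^+ e) -> I (f ^+ e').
Proof. by move=> idI /subnK<- If; rewrite exprD; apply: ideal_mull. Qed.

Lemma radical_ideal I : is_ideal I -> is_ideal (radical I).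
Proof.
move=> idI; split=> // [|f g [e If] [e' Ig]|a f _ [e If]].
- by exists 1%N; rewrite expr1; apply: ideal0.
- exists (e + e')%N; rewrite exprDn; apply: ideal_sum => // i _ _.
  rewrite -mulr_natr; apply: ideal_mulr => //.
  case: (leqP e' i) => lei.
    by apply: ideal_mull => //; apply: ideal_expr Ig.
  by apply: ideal_mulr => //; apply: ideal_expr If => //; lia.
- by exists e; rewrite exprMn; apply: ideal_mull.
Qed.

Definition prime_ideal P : Prop :=
  [/\ is_ideal P, ~ P 1 & forall f g, P (f * g) -> P f \/ P g].

Lemma prime_expr P f e : prime_ideal P -> P (f ^+ e) -> P f.
Proof.
case=> _ P1 prP; elim: e => [|e IHe]; first by rewrite expr0.
by rewrite exprS => /prP[].
Qed.

Lemma prime_radical P I : prime_ideal P -> I `<=` P -> radical I `<=` P.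
Proof. by move=> prP IP f [e If]; apply: prime_expr prP _; apply: IP If. Qed.

Lemma primary_radical Q : is_primary Q -> prime_ideal (radical Q).
Proof.
move=> [idQ Q1 prQ]; split=> [|[e]|f g [e]].
- exact: radical_ideal.
- by rewrite expr1n.
- rewrite exprMn => /prQ[|[e' Qg]]; first by left; exists e.
  by right; exists (e * e')%N; rewrite exprM.
Qed.

Lemma primary_cancel Q f g : is_primary Q -> ~ radical Q g -> Q (f * g) -> Q f.
Proof. by move=> [_ _ prQ] nQg /prQ[]. Qed.

Lemma prime_avoid_product (r : nat) (D : 'I_r -> set R) (p : pred 'I_r) P :
    prime_ideal P -> (forall j, is_ideal (D j)) ->
    (forall j, p j -> exists2 s, D j s & ~ P s) ->
  exists2 s, (forall j, p j -> D j s) & ~ P s.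
Proof.
move=> [idP P1 prP] idD avoid.
have /choice[s sP] : forall j, exists s, p j -> D j s /\ ~ P s.
  move=> j; case: (boolP (p j)) => [/avoid[s Ds Ps]|_]; last by exists 0.
  by exists s.
exists (\prod_(j | p j) s j).
  move=> j pj; rewrite (bigD1 j) //=; apply: ideal_mulr => //.
  by case: (sP j pj).
apply: (big_ind (fun x => ~ P x)) => // [x y Px Py /prP[]//|j pj].
by case: (sP j pj).
Qed.

(** Asking for a single stationary step suffices: a counterexample to noetherian induction produces
    a chain that is strict at every step. *)
Definition ascending_chain_condition : Prop :=
  forall F : nat -> set R, (forall i, is_ideal (F i)) ->
    (forall i, F i `<=` F i.+1) -> exists i, F i.+1 `<=` F i.

Lemma noetherian_ind (T : set R -> Prop) :
    ascending_chain_condition ->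
    (forall I, is_ideal I ->
      (forall J, is_ideal J -> I `<=` J -> ~ J `<=` I -> T J) -> T I) ->
  forall I, is_ideal I -> T I.
Proof.
move=> acc step I idI; apply: contrapT => nTI.
(* Every ideal violating [T] lies strictly inside another one; iterating a choice of the larger one
   contradicts [acc]. *)
pose X := {J : set R | is_ideal J /\ ~ T J}.
have /choice[next nextP] : forall x : X, exists y : X,
    sval x `<=` sval y /\ ~ sval y `<=` sval x.
  move=> [J [idJ nTJ]]; apply: contrapT => noy; apply: (nTJ); apply: step => //.
  move=> K idK JK nKJ; apply: contrapT => nTK; apply: noy.
  by exists (exist _ K (conj idK nTK)).
pose F i := sval (iter i next (exist _ I (conj idI nTI) : X)).
have [i|i|i /=] := acc F.
- by rewrite /F; case: (iter _ _ _) => J [].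
- by case: (nextP (iter i next (exist _ I (conj idI nTI)))).
- by case: (nextP (iter i next (exist _ I (conj idI nTI)))).
Qed.

(** Indexing by [nat] rather than by ['I_r] lets families be concatenated, shortened and modified
    without casts between ordinal types. *)
Definition primary_intersection I (r : nat) (D : nat -> set R) : Prop :=
  (forall i, (i < r)%N -> is_primary (D i)) /\
  (forall f, I f <-> forall i, (i < r)%N -> D i f).

(* If [f * g] is in [I] but neither [f] nor any power of [g] is, then, once the
   chain [I : g^N] is stationary, [I] is the intersection of the strictly larger
   ideals [I : g^N] and [I + (g^N)]. *)
Lemma primary_intersection_exists I :
  ascending_chain_condition -> is_ideal I ->
  exists r D, primary_intersection I r D.
Proof.
move=> acc; move: I; apply: noetherian_ind => // I idI IHI.
case: (pselect (I 1)) => [I1|nI1].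
  exists 0%N, (fun=> I); split=> // f; split=> // _.
  by rewrite -[f]mulr1; apply: ideal_mull.
case: (pselect (is_primary I)) => [prI|nprI].
  exists 1%N, (fun=> I); split=> // f; split=> [//|/(_ 0%N)]; exact.
have [f [g [Ifg nIf nIg]]] :
    exists f g, [/\ I (f * g), ~ I f & forall e, ~ I (g ^+ e)].
  apply: contrapT => no; apply: nprI; split=> // f g Ifg.
  case: (pselect (I f)) => [|nIf]; first by left.
  case: (pselect (exists e, I (g ^+ e))) => [|nIg]; first by right.
  by case: no; exists f, g; split=> // e Ig; apply: nIg; exists e.
(* The chain starts at exponent 1, so that N is positive and [f] lies in I : g^N, which makes that
   ideal strictly larger than [I]. *)
have [e stab] : exists e, colon I (g ^+ e.+2) `<=` colon I (g ^+ e.+1).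
  apply: (acc (fun e => colon I (g ^+ e.+1))) => e; first exact: colon_ideal.
  by move=> h; rewrite /colon /= [g ^+ e.+2]exprSr mulrA; apply: ideal_mulr.
set N := e.+1 in stab.
have stabN d h : I (h * g ^+ (N + d)) -> I (h * g ^+ N).
  elim: d h => [|d IHd] h; first by rewrite addn0.
  rewrite addnS exprS mulrA => /IHd.
  by rewrite -mulrA -exprS; apply: stab.
pose J1 := colon I (g ^+ N); pose J2 := idealD I [set h | exists r, h = r * g ^+ N].
have idgN : is_ideal [set h | exists r, h = r * g ^+ N].
  split=> // [|x y [a ->] [b ->]|a x _ [b ->]].
  - by exists 0; rewrite mul0r.
  - by exists (a + b); rewrite mulrDl.
  - by exists (a * b); rewrite mulrA.
have IJ2 : I `<=` J2 by apply: idealDl.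
have [r1 [D1 [prD1 ID1]]] : exists r D, primary_intersection J1 r D.
  apply: IHI; first exact: colon_ideal.
    by move=> h Ih; apply: ideal_mulr.
  move=> J1I; apply: nIf; apply: J1I.
  by rewrite /J1 /colon /= /N exprS mulrA; apply: ideal_mulr.
have [r2 [D2 [prD2 ID2]]] : exists r D, primary_intersection J2 r D.
  apply: IHI => //; first exact: idealD_ideal.
  move=> J2I; apply: (nIg N); apply: J2I; apply: idealDr => //.
  by exists 1; rewrite mul1r.
exists (r1 + r2)%N, (fun i => if (i < r1)%N then D1 i else D2 (i - r1)%N).
split=> [i lti|h].
  by case: ltnP => lei; [apply: prD1|apply: prD2; lia].
split=> [Ih i lti|Dh].
  case: ltnP => lei; first by apply: (ID1 h).1 => //; apply: ideal_mulr.
  by apply: (ID2 h).1 => //; [apply: IJ2|lia].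
have J1h : J1 h.
  by apply/ID1 => i lti; have := Dh i; rewrite lti; apply; lia.
have [a [_ [Ia [b ->] hE]]] : J2 h.
  apply/ID2 => i lti; have := Dh (r1 + i)%N.
  by rewrite ifF; [rewrite addKn; apply; lia|lia].
(* With h = a + b g^N and h g^N in [I], stability lowers the exponent 2N to N, so that b g^N, and
   hence h, is in [I]. *)
have : I (b * g ^+ (N + N)).
  have -> : b * g ^+ (N + N) = h * g ^+ N - a * g ^+ N.
    by rewrite hE mulrDl addrAC subrr add0r exprD mulrA.
  by apply: ideal_sub => //; apply: ideal_mulr.
by move/stabN=> Ib; rewrite hE; apply: ideal_add.
Qed.

Lemma primary_intersection_drop I r D i0 :
    primary_intersection I r.+1 D -> (i0 < r.+1)%N ->
    (forall f, (forall i, (i < r.+1)%N -> i != i0 -> D i f) -> D i0 f) ->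
  primary_intersection I r (fun i => D (bump i0 i)).
Proof.
move=> [prD ID] lti0 red; split=> [i lti|f].
  by apply: prD; rewrite /bump; case: leqP; lia.
split=> [/ID Df i lti|Df]; first by apply: Df; rewrite /bump; case: leqP; lia.
have Df' i : (i < r.+1)%N -> i != i0 -> D i f.
  move=> lti nei; have := Df (unbump i0 i).
  rewrite unbumpK ?inE //; apply; rewrite /unbump; case: ltnP; lia.
by apply/ID => i lti; case: (eqVneq i i0) => [->|]; [apply: red|apply: Df'].
Qed.

Lemma primary_cap Q1 Q2 :
  is_primary Q1 -> is_primary Q2 -> radical Q1 = radical Q2 ->
  is_primary (Q1 `&` Q2) /\ radical (Q1 `&` Q2) = radical Q1.
Proof.
move=> pr1 pr2 eqr; have [[id1 n1 c1] [id2 n2 c2]] := (pr1, pr2).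
have radE : radical (Q1 `&` Q2) = radical Q1.
  apply/seteqP; split=> [f [e [Qf _]]|f Qf]; first by exists e.
  have [e1 Qf1] := Qf; move: Qf; rewrite eqr => -[e2 Qf2].
  exists (e1 + e2)%N; split.
    by apply: ideal_expr Qf1 => //; lia.
  by apply: ideal_expr Qf2 => //; lia.
split=> //; split=> [|[]//|f g [Q1f Q2f]].
  split=> // [|f g [? ?] [? ?]|a f _ [? ?]]; split.
  - exact: ideal0.
  - exact: ideal0.
  - exact: ideal_add.
  - exact: ideal_add.
  - exact: ideal_mull.
  - exact: ideal_mull.
case: (pselect (radical (Q1 `&` Q2) g)) => [|ng]; [by right|left; split].
  by apply: primary_cancel pr1 _ Q1f; rewrite -radE.
by apply: primary_cancel pr2 _ Q2f; rewrite -eqr -radE.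
Qed.

(* A decomposition with the fewest components is minimal: redundant components
   can be dropped, and components with the same radical merged. *)
Lemma minimal_primary_decomposition_exists I :
  ascending_chain_condition -> is_ideal I ->
  exists r (D : 'I_r -> set R), minimal_primary_decomposition I D.
Proof.
move=> acc idI.
pose good r := `[< exists D, primary_intersection I r D >].
have exr : exists r, good r.
  have [r [D ID]] := primary_intersection_exists acc idI.
  by exists r; apply/asboolP; exists D.
case: (ex_minnP exr) => r /asboolP[D ID] minr {exr}.
have irred D' : primary_intersection I r D' -> forall i0, (i0 < r)%N ->
    ~ (forall f, (forall i, (i < r)%N -> i != i0 -> D' i f) -> D' i0 f).
  move=> ID' i0 lti0 red.
  case: r ID minr lti0 ID' red => [//|r] _ minr lti0 ID' red.
  suff /minr : good r by rewrite ltnn.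
  by apply/asboolP; eexists; apply: primary_intersection_drop ID' lti0 red.
exists r, (fun i => D i); have [prD eD] := ID; split.
- by move=> i; apply: prD.
- apply/seteqP; split=> [f /eD If i _|f If]; first exact: If.
  by apply/eD => i lti; exact: (If (Ordinal lti)).
- move=> i j neij eqr.
  have [prC rC] := primary_cap (prD i (ltn_ord i)) (prD j (ltn_ord j)) eqr.
  (* Slot [i] receives the merged component, so slot [j] becomes redundant while the number of
     components is unchanged; this contradicts [irred]. *)
  pose D' (m : nat) := if m == i :> nat then D i `&` D j else D m.
  apply: (irred D' _ j (ltn_ord j)).
    split=> [m ltm|f].
      by rewrite /D'; case: eqP => // _; apply: prD.
    split=> [/eD Df m ltm|Df].
      by rewrite /D'; case: eqP => // _; [split; apply: Df|apply: Df].
    apply/eD => m ltm; have := Df m ltm; rewrite /D'.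
    by case: eqP => // -> [].
  move=> f Df; have := Df i (ltn_ord i) neij; rewrite /D' eqxx.
  by case: eqP => // _ [].
- move=> i sub; apply: (irred D ID i (ltn_ord i)) => f Df.
  by apply: sub => j /eqP neji; apply: Df => //; apply/eqP => /ord_inj.
Qed.

(* By minimality, the prime [radical (D i)] contains no other component. *)
Lemma minimal_component_cofactor I r (D : 'I_r -> set R) i :
    minimal_primary_decomposition I D ->
    (forall j, radical (D j) `<=` radical (D i) -> radical (D j) = radical (D i)) ->
  exists2 s, (forall j, j != i -> D j s) & ~ radical (D i) s.
Proof.
move=> [prD _ distinct _] mini.
apply: (prime_avoid_product (primary_radical (prD i))) => [j|j neji].
  by case: (prD j).
have nsub : ~ radical (D j) `<=` radical (D i).
  by move=> /mini; apply: distinct.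
apply: contrapT => no; apply: nsub => f [e Df].
apply: (prime_expr (primary_radical (prD i)) (e := e)).
by apply: contrapT => nf; apply: no; exists (f ^+ e).
Qed.

End IdealTheory.

(** * Polynomial rings are noetherian *)

Section Noetherian.
Variables (k : fieldType) (n : nat).

(** After each index, jump to a later one where [v] attains its minimum over the remaining tail. *)
Lemma nondecreasing_subsequence (v : nat -> nat) :
  exists2 phi : nat -> nat, (forall i j, (i < j)%N -> (phi i < phi j)%N) &
    (forall i j, (i <= j)%N -> (v (phi i) <= v (phi j))%N).
Proof.
have /choice[f fP] : forall N, exists m, (N < m)%N /\ forall j, (N < j)%N -> (v m <= v j)%N.
  move=> N.
  have exm : exists x, `[< exists2 m, (N < m)%N & v m = x >].
    by exists (v N.+1); apply/asboolP; exists N.+1.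
  case: (ex_minnP exm) => x /asboolP[m ltNm <-] minx.
  by exists m; split=> // j ltNj; apply: minx; apply/asboolP; exists j.
pose phi i := iter i.+1 f 0%N.
have phiS i : (phi i < phi i.+1)%N by rewrite /phi [iter i.+2 _ _]iterS; case: (fP (phi i)).
have incr : {homo phi : i j / (i < j)%N} by apply: homo_ltn => // ? ? ?; apply: ltn_trans.
exists phi => //; apply: (@homo_leq _ (v \o phi) leq leqnn leq_trans) => i.
have [_ minf] := fP (iter i f 0%N); apply: minf; rewrite -/(phi i.+1).
by apply: ltn_trans (phiS i); rewrite /phi iterS; case: (fP (iter i f 0%N)).
Qed.

(** Pass to a nondecreasing subsequence for one coordinate after another; any two terms of the last
    subsequence are comparable. *)
Lemma dickson (u : nat -> 'X_{1..n}) :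
  exists i j, (i < j)%N /\ (u i <= u j)%MM.
Proof.
have mono (s : seq 'I_n) : exists2 phi : nat -> nat,
    (forall i j, (i < j)%N -> (phi i < phi j)%N) &
    (forall c, c \in s -> forall i j, (i <= j)%N -> (u (phi i) c <= u (phi j) c)%N).
  elim: s => [|c s [phi incr mono]]; first by exists id.
  have [psi incr' mono'] := nondecreasing_subsequence (fun i => u (phi i) c).
  exists (phi \o psi) => [i j ltij|d]; first by apply: incr; apply: incr'.
  rewrite inE => /predU1P[-> i j|ds i j leij] /=; first exact: mono'.
  by apply: mono => //; move: leij; rewrite leq_eqVlt => /predU1P[->//|/incr'/ltnW].
have [phi incr monophi] := mono (enum 'I_n).
exists (phi 0%N), (phi 1%N); split; first exact: incr.
by apply/mnm_lepP => c; apply: monophi; rewrite ?mem_enum.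
Qed.

Lemma exists_min_mlead (P : {mpoly k[n]} -> Prop) f :
  P f -> exists2 g, P g & forall h, P h -> ~ (mlead h < mlead g)%O.
Proof.
move: {2}(mlead f) (erefl (mlead f)) => m; move: f.
elim/(well_founded_ind (@ltom_wf n)): m => m IHm f fm Pf.
case: (pselect (exists2 h, P h & (mlead h < mlead f)%O)) => [[h Ph lth]|no].
  by apply: (IHm (mlead h) _ h) => //; rewrite -fm.
by exists f => // h Ph lth; apply: no; exists h.
Qed.

(* Reduce the second of two comparable leading monomials by the first. *)
Lemma mpoly_acc : ascending_chain_condition {mpoly k[n]}.
Proof.
move=> F idF incF; apply: contrapT => nostab.
have mono i j : (i <= j)%N -> F i `<=` F j.
  elim: j => [|j IHj]; first by rewrite leqn0 => /eqP->.
  rewrite leq_eqVlt => /predU1P[->//|/IHj sub f /sub]; exact: incF.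
(* Each [f i] has the least leading monomial among the elements new at step i; the reduction below
   will contradict this minimality. *)
have /choice[f fP] : forall i, exists f, (F i.+1 f /\ ~ F i f) /\
    forall h, F i.+1 h /\ ~ F i h -> ~ (mlead h < mlead f)%O.
  move=> i; have [f Pf] : exists f, F i.+1 f /\ ~ F i f.
    apply: contrapT => no; apply: nostab; exists i => f Ff.
    by apply: contrapT => nf; apply: no; exists f.
  by have [g Pg ming] := exists_min_mlead (P := fun f => F i.+1 f /\ ~ F i f) Pf; exists g.
have [i [j [ltij lead_le]]] := dickson (fun i => mlead (f i)).
have [[Fi _] _] := fP i; have [[Fj nFj] minj] := fP j.
have fi0 : f i != 0.
  by apply/eqP=> f0; case: (fP i) => -[_]; rewrite f0 => nF0; case: nF0; apply: ideal0.
pose c := mleadc (f j) / mleadc (f i).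
pose g := f j - c *: 'X_[mlead (f j) - mlead (f i)] * f i.
have Fji : F j (c *: 'X_[mlead (f j) - mlead (f i)] * f i).
  by apply: ideal_mull => //; apply: mono ltij _ Fi.
have Fjg : F j.+1 g by apply: ideal_sub => //; apply: incF.
have nFg : ~ F j g.
  by move=> Fg; apply: nFj; have := ideal_add (idF j) Fg Fji; rewrite subrK.
have fj0 : f j != 0 by apply/eqP=> f0; apply: nFj; rewrite f0; apply: ideal0.
have g0 : g != 0 by apply/eqP=> g0; apply: nFg; rewrite g0; apply: ideal0.
have c0 : c != 0 by rewrite mulf_neq0 ?invr_eq0 ?mleadc_eq0.
pose q := c *: 'X_[mlead (f j) - mlead (f i)] * f i.
have leadX : mlead q = mlead (f j).
  rewrite /q -scalerAl mleadZ // mulrC mleadM //; last first.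
    by rewrite -msupp_eq0 msuppX.
  by rewrite mleadXm addmC submK.
have coefq : q@_(mlead (f j)) = mleadc (f j).
  rewrite /q -scalerAl mcoeffZ -[X in _@_X](submK lead_le).
  by rewrite ['X_[_] * _]mulrC mcoeffMX /c divfK ?mleadc_eq0.
apply: (minj g) => //.
have := mleadB_le (f j) q; rewrite leadX joinxx -/g => leg.
rewrite lt_neqAle leg andbT; apply/eqP => eqlead.
by move: g0; rewrite -mleadc_eq0 eqlead mcoeffB coefq subrr eqxx.
Qed.

End Noetherian.

(** * Linear maps defined on monomials; binomial ideals *)

Section LinearExtension.
Variables (k : fieldType) (n : nat).
Implicit Types (f g : {mpoly k[n]}) (u v m : 'X_{1..n}) (C : set 'X_{1..n}).

Definition mlin (V : lmodType k) (c : 'X_{1..n} -> V) f : V :=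
  \sum_(m <- msupp f) f@_m *: c m.

Lemma mlin_supp (V : lmodType k) (c : 'X_{1..n} -> V) f s :
  uniq s -> {subset msupp f <= s} -> mlin c f = \sum_(m <- s) f@_m *: c m.
Proof.
move=> us sub; rewrite /mlin [RHS](bigID (mem (msupp f))) /=.
rewrite [X in _ = _ + X]big1 => [|m /memN_msupp_eq0->]; last by rewrite scale0r.
rewrite addr0 -[RHS]big_filter; apply: perm_big; apply: uniq_perm => //.
- exact: filter_uniq.
- by move=> m; rewrite mem_filter; case: (boolP (m \in msupp f)) => // /sub->.
Qed.

Fact mlin_is_linear (V : lmodType k) (c : 'X_{1..n} -> V) : linear (mlin c).
Proof.
move=> a f g; pose s := undup (msupp f ++ msupp g).
have us : uniq s by apply: undup_uniq.
rewrite (@mlin_supp _ c _ s) //; last first.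
  move=> m /msuppD_le; rewrite mem_undup !mem_cat => /orP[/msuppZ_le->//|->].
  by rewrite orbT.
rewrite (@mlin_supp _ c f s) //; last by move=> m; rewrite mem_undup mem_cat => ->.
rewrite (@mlin_supp _ c g s) //; last first.
  by move=> m; rewrite mem_undup mem_cat => ->; rewrite orbT.
rewrite scaler_sumr -big_split; apply: eq_bigr => m _ /=.
by rewrite mcoeffD mcoeffZ scalerDl scalerA.
Qed.

HB.instance Definition _ (V : lmodType k) (c : 'X_{1..n} -> V) :=
  GRing.isLinear.Build k {mpoly k[n]} V _ (mlin c) (mlin_is_linear c).

Lemma mlinX (V : lmodType k) (c : 'X_{1..n} -> V) m : mlin c 'X_[m] = c m.
Proof. by rewrite /mlin msuppX big_seq1 mcoeffX eqxx scale1r. Qed.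

Lemma eq_mlin (V : lmodType k) (c d : 'X_{1..n} -> V) f :
  (forall m, m \in msupp f -> c m = d m) -> mlin c f = mlin d f.
Proof. by move=> eqcd; apply: eq_big_seq => m /eqcd->. Qed.

Lemma mlinMX (V : lmodType k) (c : 'X_{1..n} -> V) u f :
  mlin c ('X_[u] * f) = mlin (fun m => c (u + m)%MM) f.
Proof.
rewrite {1}[f]mpolyE mulr_sumr linear_sum; apply: eq_bigr => m _.
by rewrite -scalerAr linearZ /= -mpolyXD mlinX.
Qed.

Lemma mlinM (V : lmodType k) (c : 'X_{1..n} -> V) g f :
  mlin c (g * f) = mlin (fun u => mlin (fun m => c (u + m)%MM) f) g.
Proof.
rewrite {1}[g]mpolyE mulr_suml linear_sum; apply: eq_bigr => m _.
by rewrite -scalerAl linearZ /= mlinMX.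
Qed.

Definition mproj C f : {mpoly k[n]} :=
  mlin (fun m => if `[< C m >] then 'X_[m] else 0) f.

HB.instance Definition _ C :=
  GRing.isLinear.Build k {mpoly k[n]} {mpoly k[n]} _ (mproj C)
    (mlin_is_linear _).

Lemma mprojX C m : C m -> mproj C 'X_[m] = 'X_[m].
Proof. by move=> Cm; rewrite /mproj mlinX asboolT. Qed.

Lemma mprojX0 C m : ~ C m -> mproj C 'X_[m] = 0.
Proof. by move=> Cm; rewrite /mproj mlinX asboolF. Qed.

Lemma mcoeff_mproj C f m : (mproj C f)@_m = if `[< C m >] then f@_m else 0.
Proof.
rewrite /mproj /mlin raddf_sum /=.
transitivity (\sum_(i <- msupp f | i == m) (if `[< C m >] then f@_m else 0)).
  rewrite [RHS]big_mkcond; apply: eq_bigr => i _; rewrite mcoeffZ.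
  case: eqP => [->|neim]; case: asboolP => _.
  - by rewrite mcoeffX eqxx mulr1.
  - by rewrite mcoeff0 mulr0.
  - by rewrite mcoeffX; case: eqP => // _; rewrite mulr0.
  - by rewrite mcoeff0 mulr0.
rewrite big_const_seq; have := mcoeff_msupp f m; have := msupp_uniq f.
rewrite -/(count_mem m (msupp f)) => /count_uniq_mem->; case: (m \in msupp f).
  by rewrite /= addr0.
by move/esym/negbFE/eqP->; rewrite if_same.
Qed.

Lemma mproj_msupp C f m : m \in msupp (mproj C f) <-> m \in msupp f /\ C m.
Proof.
rewrite !mcoeff_msupp mcoeff_mproj; case: asboolP => Cm; first by split=> // -[].
by rewrite eqxx; split=> // -[].
Qed.

Lemma mprojC C f : f = mproj C f + mproj (~` C) f.
Proof.
apply/mpolyP => m; rewrite mcoeffD !mcoeff_mproj.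
by case: asboolP => Cm; case: asboolP => // nC; rewrite ?addr0 ?add0r // (contrapT nC).
Qed.

Lemma mproj_setC C f : mproj (~` C) f = f - mproj C f.
Proof. by rewrite {2}[f](mprojC C) addrC addKr. Qed.

Lemma mprojM C g f : (forall u v, u \in msupp g -> C (u + v)%MM <-> C v) ->
  mproj C (g * f) = g * mproj C f.
Proof.
move=> stable; rewrite [RHS]mulrC /mproj mlinM [in RHS]mulrC {2}[g]mpolyE mulr_suml.
apply: eq_big_seq => u ug; rewrite -scalerAl; congr (_ *: _).
rewrite /mlin mulr_sumr; apply: eq_bigr => m _; rewrite -scalerAr; congr (_ *: _).
rewrite (asbool_equiv_eq (stable u m ug)).
by case: asboolP => // _; rewrite ?mpolyXD ?mulr0.
Qed.

Lemma msupp_ltn f g u : {subset msupp g <= msupp f} -> u \in msupp f ->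
  u \notin msupp g -> (size (msupp g) < size (msupp f))%N.
Proof.
move=> sub uf ug; have : (size (u :: msupp g) <= size (msupp f))%N.
  apply: uniq_leq_size; first by rewrite /= ug msupp_uniq.
  by move=> v; rewrite inE => /predU1P[->|/sub].
by [].
Qed.

(** The term at [u] cancels and only the coefficient at [v], already in the support, can change.
    This drives the inductions on the number of terms. *)
Lemma msupp_reduce f u v c : u \in msupp f -> v \in msupp f -> u != v ->
  (size (msupp (f - f@_u *: ('X_[u] - c *: 'X_[v]))%R) < size (msupp f))%N.
Proof.
move=> uf vf neuv; apply: (msupp_ltn _ uf).
  move=> m; rewrite !mcoeff_msupp; apply: contraNneq => fm.
  rewrite mcoeffB fm mcoeffZ mcoeffB mcoeffZ !mcoeffX.
  case: (eqVneq u m) => [um|_]; first by move: uf; rewrite um mcoeff_msupp fm eqxx.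
  case: (eqVneq v m) => [vm|_]; first by move: vf; rewrite vm mcoeff_msupp fm eqxx.
  by rewrite mulr0 subr0 mulr0 subr0.
rewrite mcoeff_msupp negbK mcoeffB mcoeffZ mcoeffB mcoeffZ !mcoeffX eqxx.
by rewrite (eq_sym v) (negbTE neuv) mulr0 subr0 mulr1 subrr.
Qed.

End LinearExtension.

Section BinomialIdeals.
Variables (k : fieldType) (n : nat).
Implicit Types (I : set {mpoly k[n]}) (C : set 'X_{1..n}).

Lemma ideal_scale I (c : k) f : is_ideal I -> I f -> I (c *: f).
Proof. by move=> idI If; rewrite -mul_mpolyC; apply: ideal_mull. Qed.

Lemma ideal_scaleK I (c : k) f : is_ideal I -> c != 0 -> I (c *: f) -> I f.
Proof.
by move=> idI c0 /(ideal_scale c^-1 idI); rewrite scalerA mulVf // scale1r.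
Qed.

Lemma ideal_supp I f :
  is_ideal I -> (forall m, m \in msupp f -> I 'X_[m]) -> I f.
Proof.
move=> idI If; rewrite [f]mpolyE; apply: ideal_sum => // m mf _.
by apply: ideal_scale => //; apply: If.
Qed.

(** Monomials of [I] are exempted: any two of them are related modulo [I] with every scalar, and
    without the guard [C] would have to contain all of them or none. *)
Definition saturated_class I C : Prop :=
  forall u v c, I ('X_[u] - c *: 'X_[v]) -> c != 0 -> ~ I 'X_[u] -> C u <-> C v.

(** Either both terms lie in [I] separately, or they are related by a nonzero scalar and [C] keeps
    or drops them together. *)
Lemma mproj_binomial I C f : is_ideal I -> saturated_class I C ->
  Defs.binomial f -> I f -> I (mproj C f).
Proof.
move=> idI satC; rewrite /Defs.binomial => szf If.
have [fE us] := (mpolyE f, msupp_uniq f).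
move: szf fE us; case: (msupp f) => [|u [|v [|//]]] _ fE us.
- by rewrite fE big_nil linear0; apply: ideal0.
- rewrite big_seq1 in fE; case: (pselect (C u)) => Cu; rewrite fE linearZ /=.
    by rewrite mprojX // -fE.
  by rewrite mprojX0 // scaler0; apply: ideal0.
rewrite big_cons big_seq1 in fE.
move: (f@_u) (f@_v) fE If {us} => a b -> Iab {f}.
have proj_term (c : k) m : I (c *: 'X_[m]) -> I (mproj C (c *: 'X_[m])).
  move=> Icm; rewrite linearZ /=; case: (pselect (C m)) => Cm.
    by rewrite mprojX.
  by rewrite mprojX0 // scaler0; apply: ideal0.
case: (eqVneq a 0) Iab => [->|a0]; first by rewrite scale0r add0r; apply: proj_term.
case: (eqVneq b 0) => [->|b0] Iab.
  by move: Iab; rewrite scale0r addr0; apply: proj_term.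
case: (pselect (I 'X_[u])) => [Iu|nIu].
  rewrite linearD; apply: ideal_add => //; apply: proj_term.
    exact: ideal_scale.
  by rewrite -[_ *: _](addKr (a *: 'X_[u])) addrC; apply: ideal_sub => //; apply: ideal_scale.
have Iuv : I ('X_[u] - (- (b / a)) *: 'X_[v]).
  apply: (ideal_scaleK idI a0); rewrite scaleNr opprK scalerDr scalerA.
  by rewrite mulrCA divff // mulr1.
have c0 : - (b / a) != 0 by rewrite oppr_eq0 mulf_neq0 ?invr_eq0.
have Cuv := satC u v _ Iuv c0 nIu.
rewrite linearD !linearZ /=; case: (pselect (C u)) => Cu.
  by rewrite !mprojX //; apply/Cuv.
by rewrite !mprojX0 ?scaler0 ?addr0; [apply: ideal0|move/Cuv|].
Qed.

(* The quotient by a binomial ideal is graded by the classes of monomials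
   identified up to a nonzero scalar. *)
Lemma mproj_ideal I C f : binomial_ideal I -> saturated_class I C ->
  I f -> I (mproj C f).
Proof.
move=> [S [binS IE]] satC If.
have idI : is_ideal I by rewrite IE; apply: ideal_gen_ideal.
(* The projection does not commute with multiplication, so closure under monomial multiples is built
   in to make [T] an ideal. *)
pose T : set {mpoly k[n]} := [set g | forall a, I (mproj C ('X_[a] * g))].
suff: T f by move/(_ 0%MM); rewrite mpolyX0 mul1r.
move: If; rewrite {1}IE; apply: ideal_gen_sub => [|b Sb a].
  split=> // [a|g h Tg Th a|g h _ Th a].
  - by rewrite mulr0 linear0; apply: ideal0.
  - by rewrite mulrDr linearD; apply: ideal_add => //; [apply: Tg|apply: Th].
  - rewrite {1}[g]mpolyE mulr_suml mulr_sumr linear_sum; apply: ideal_sum => // u _ _.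
    rewrite -scalerAl -scalerAr linearZ mulrA -mpolyXD.
    by apply: ideal_scale => //; apply: Th.
have Ib : I b by rewrite IE => J [_]; apply.
apply: mproj_binomial => //; last exact: ideal_mull.
rewrite /Defs.binomial mulrC (perm_size (msuppMX _ _)) size_map.
exact: binS.
Qed.

End BinomialIdeals.

(** * Lattices and lattice ideals *)

Section ExponentVectors.
Variable n : nat.
Implicit Types (D E : {set 'I_n}) (u v : 'X_{1..n}) (w z : 'rV[int]_n).

Definition mvec u : 'rV[int]_n := \row_i (u i)%:Z.

Lemma mvecE u i : mvec u 0 i = u i. Proof. by rewrite mxE. Qed.

Lemma mnm_diffE u v : mnm_diff u v = mvec u - mvec v.
Proof. by apply/rowP => i; rewrite !mxE. Qed.

Lemma mvecD u v : mvec (u + v)%MM = mvec u + mvec v.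
Proof. by apply/rowP => i; rewrite !mxE mnmDE PoszD. Qed.

Lemma mvecMn u d : mvec (u *+ d)%MM = mvec u *+ d.
Proof. by apply/rowP => i; rewrite mxE mulmnE mulmxnE mxE PoszM pmulrn -mulrzz. Qed.

Lemma mvec_inj : injective mvec.
Proof. by move=> u v /rowP uv; apply/mnmP => i; have := uv i; rewrite !mxE => -[]. Qed.

Definition posm w : 'X_{1..n} := [multinom if w 0%R i is Posz a then a else 0%N | i < n].
(** [Negz a] stands for -(a+1), whence the successor. *)
Definition negm w : 'X_{1..n} := [multinom if w 0%R i is Negz a then a.+1 else 0%N | i < n].

Lemma posm_negm w : mvec (posm w) - mvec (negm w) = w.
Proof.
apply/rowP => i; rewrite !mxE !mnmE; case: (w 0 i) => a; first by rewrite subr0.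
by rewrite sub0r NegzE.
Qed.

Lemma NN0 D : NN D 0%MM. Proof. by move=> i _; rewrite mnm0E. Qed.

Lemma NN_add D u v : NN D (u + v)%MM <-> NN D u /\ NN D v.
Proof.
split=> [Duv|[Du Dv] i Di]; last by rewrite mnmDE Du ?Dv.
by split=> i Di; have := Duv i Di; rewrite mnmDE => /eqP; rewrite addn_eq0 => /andP[/eqP ? /eqP].
Qed.

Lemma NN_muln D u d : NN D u -> NN D (u *+ d)%MM.
Proof. by move=> Du i Di; rewrite mulmnE Du. Qed.

Lemma NN_sub D E u : D \subset E -> NN D u -> NN E u.
Proof. by move=> /fintype.subsetP DE Du i Ei; apply: Du; apply: contra Ei; apply: DE. Qed.

Lemma NN_mvec D u : NN D u <-> ZZ D (mvec u).
Proof. by split=> Du i /Du; rewrite mvecE; [move=> ->|case]. Qed.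

Lemma NN_posm D w : ZZ D w -> NN D (posm w).
Proof. by move=> Dw i /Dw wi; rewrite mnmE wi. Qed.

Lemma NN_negm D w : ZZ D w -> NN D (negm w).
Proof. by move=> Dw i /Dw wi; rewrite mnmE wi. Qed.

Lemma NN_U D i : i \in D -> NN D U_(i)%MM.
Proof. by move=> Di j Dj; rewrite mnm1E; case: eqP => // ij; rewrite -ij Di in Dj. Qed.

Definition part D u : 'X_{1..n} := [multinom if i \in D then u i else 0%N | i < n].

Lemma NN_part D u : NN D (part D u).
Proof. by move=> i; rewrite mnmE => /negbTE->. Qed.

Lemma partC D u : (part D u + part (~: D)%SET u)%MM = u.
Proof.
by apply/mnmP => i; rewrite mnmDE !mnmE finset.in_setC; case: ifP; rewrite ?addn0.
Qed.

Lemma muln_eq0_rV (w : 'rV[int]_n) N : (0 < N)%N -> w *+ N = 0 -> w = 0.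
Proof.
move=> N0 /rowP wN; apply/rowP => j; have := wN j.
rewrite mulmxnE !mxE => /eqP; rewrite mulrn_eq0 => /orP[|/eqP//].
by rewrite -leqn0 leqNgt N0.
Qed.

Lemma lattice_ZZ D : lattice D (ZZ D).
Proof.
split=> [//|i _|w z Dw Dz i Di]; first by rewrite mxE.
by rewrite !mxE Dw ?Dz ?subr0.
Qed.

Section LatticeClosure.
Variables (D : {set 'I_n}) (L : set 'rV[int]_n).
Hypothesis latL : lattice D L.

Lemma lattice_sub_ZZ : L `<=` ZZ D. Proof. by case: latL. Qed.

Lemma lattice0 : L 0. Proof. by case: latL. Qed.

Lemma lattice_sub w z : L w -> L z -> L (w - z).
Proof. by case: latL => _ _ sub; apply: sub. Qed.

Lemma lattice_opp w : L w -> L (- w).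
Proof. by rewrite -sub0r; apply: lattice_sub; apply: lattice0. Qed.

Lemma lattice_add w z : L w -> L z -> L (w + z).
Proof. by move=> Lw Lz; rewrite -[z]opprK; apply: lattice_sub => //; apply: lattice_opp. Qed.

Lemma lattice_muln w d : L w -> L (w *+ d).
Proof.
move=> Lw; elim: d => [|d IHd]; first by rewrite mulr0n; apply: lattice0.
by rewrite mulrS; apply: lattice_add.
Qed.

Lemma lattice_mulz w (d : int) : L w -> L (w *~ d).
Proof.
move=> Lw; case: d => d; first exact: lattice_muln.
by rewrite NegzE mulrNz; apply: lattice_opp; apply: lattice_muln.
Qed.

Lemma lattice_sum (T : Type) (s : seq T) (F : T -> 'rV[int]_n) :
  (forall t, L (F t)) -> L (\sum_(t <- s) F t).
Proof. by move=> LF; apply: big_ind => //; [apply: lattice0|apply: lattice_add]. Qed.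

Lemma lattice_subC w z : L (w - z) -> L (z - w).
Proof. by move/lattice_opp; rewrite opprB. Qed.

Lemma lattice_equiv w z : L (w - z) -> L w <-> L z.
Proof.
move=> Lwz; split=> [Lw|Lz]; last by rewrite -(subrK z w); apply: lattice_add.
by rewrite -(subKr w z); apply: lattice_sub.
Qed.

End LatticeClosure.

Lemma ZZ_sub D E : D \subset E -> @ZZ n D `<=` ZZ E.
Proof. by move=> /fintype.subsetP DE w Dw i Ei; apply: Dw; apply: contra Ei; apply: DE. Qed.

End ExponentVectors.

Section PartialCharacters.
Variables (k : fieldType) (n : nat) (D : {set 'I_n}).
Variables (L : set 'rV[int]_n) (rho : 'rV[int]_n -> k).
Hypothesis chi : partial_character D L rho.

Lemma character_lattice : lattice D L. Proof. by case: chi. Qed.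

Lemma character_neq0 w : L w -> rho w != 0. Proof. by case: chi => _ n0 _; apply: n0. Qed.

Lemma characterD w z : L w -> L z -> rho (w + z) = rho w * rho z.
Proof. by case: chi => _ _ add; apply: add. Qed.

Lemma character0 : rho 0 = 1.
Proof.
have L0 := lattice0 character_lattice.
apply: (mulfI (character_neq0 L0)); rewrite mulr1 -characterD //.
by rewrite addr0.
Qed.

Lemma characterN w : L w -> rho (- w) = (rho w)^-1.
Proof.
move=> Lw; apply: (mulfI (character_neq0 Lw)); rewrite divff ?character_neq0 //.
rewrite -characterD //; first by rewrite subrr character0.
exact: lattice_opp character_lattice _ Lw.
Qed.

Lemma characterMn w d : L w -> rho (w *+ d) = rho w ^+ d.
Proof.
move=> Lw; elim: d => [|d IHd]; first by rewrite mulr0n expr0 character0.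
rewrite mulrS exprS characterD ?IHd //.
exact: lattice_muln character_lattice _ _ Lw.
Qed.

Lemma characterMz w (d : int) : L w -> rho (w *~ d) = rho w ^ d.
Proof.
move=> Lw; case: d => d; first exact: characterMn.
rewrite NegzE mulrNz characterN ?characterMn //.
exact: lattice_muln character_lattice _ _ Lw.
Qed.

End PartialCharacters.

Section LatticeIdeals.
Variables (k : fieldType) (n : nat).
Implicit Types (D E : {set 'I_n}) (f g : {mpoly k[n]}).

Lemma kNX D u : NN D u -> @kN k n D 'X_[u].
Proof. by move=> Du v; rewrite msuppX inE => /eqP->. Qed.

Lemma kN0 D : @kN k n D 0.
Proof. by move=> u; rewrite msupp0. Qed.

Lemma kN1 D : @kN k n D 1.
Proof. by rewrite -mpolyX0; apply: kNX; apply: NN0. Qed.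

Lemma kND D f g : kN D f -> kN D g -> kN D (f + g).
Proof. by move=> Df Dg u /msuppD_le; rewrite mem_cat => /orP[/Df|/Dg]. Qed.

Lemma kNZ D c f : kN D f -> kN D (c *: f).
Proof. by move=> Df u /msuppZ_le/Df. Qed.

Lemma kNB D f g : kN D f -> kN D g -> kN D (f - g).
Proof. by move=> Df Dg; rewrite -scaleN1r; apply: kND => //; apply: kNZ. Qed.

Lemma kNM D f g : kN D f -> kN D g -> kN D (f * g).
Proof.
move=> Df Dg u /msuppM_le/allpairsP[[a b] [af bg ->]] /=.
by apply/NN_add; split; [apply: Df|apply: Dg].
Qed.

Lemma kN_prod D (T : Type) (s : seq T) (p : pred T) (F : T -> {mpoly k[n]}) :
  (forall t, kN D (F t)) -> kN D (\prod_(t <- s | p t) F t).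
Proof. by move=> DF; apply: big_ind => //; [apply: kN1|apply: kNM]. Qed.

Lemma kNXn D f e : kN D f -> kN D (f ^+ e).
Proof.
move=> Df; elim: e => [|e IHe]; first by rewrite expr0; apply: kN1.
by rewrite exprS; apply: kNM.
Qed.

Lemma kN_sub D E : D \subset E -> @kN k n D `<=` kN E.
Proof. by move=> DE f Df u /Df; apply: NN_sub. Qed.

Lemma kN_mproj D f : kN D (mproj (NN D) f).
Proof. by move=> u /mproj_msupp[]. Qed.

Lemma kN_ideal D : ideal_of (kN D) (@kN k n D).
Proof. by split=> //; [apply: kN0|apply: kND|move=> a f; apply: kNM]. Qed.

Section OneLattice.
Variables (D : {set 'I_n}) (L : set 'rV[int]_n) (rho : 'rV[int]_n -> k).

Lemma lattice_ideal_ind (J : set {mpoly k[n]}) : ideal_of (kN D) J ->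
  (forall u v, NN D u -> NN D v -> L (mvec u - mvec v) ->
     J ('X_[u] - rho (mvec u - mvec v) *: 'X_[v])) ->
  lattice_ideal D L rho `<=` J.
Proof.
move=> idJ genJ; apply: smallest_sub => // f [u [v [Du Dv]]].
by rewrite mnm_diffE => Luv ->; apply: genJ.
Qed.

Lemma lattice_ideal_kN : lattice_ideal D L rho `<=` kN D.
Proof.
apply: lattice_ideal_ind; first exact: kN_ideal.
by move=> u v Du Dv _; apply: kNB; [apply: kNX|apply: kNZ; apply: kNX].
Qed.

Lemma lattice_ideal_of : ideal_of (kN D) (lattice_ideal D L rho).
Proof.
split=> [|J [[_ J0 _ _] _]//|f g If Ig J JS|a f Da If J JS].
- exact: lattice_ideal_kN.
- by case: (JS) => -[_ _ addJ _] _; apply: addJ; [apply: If|apply: Ig].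
- by case: (JS) => -[_ _ _ mulJ] _; apply: mulJ => //; apply: If.
Qed.

Lemma lattice_ideal_gen u v : NN D u -> NN D v -> L (mvec u - mvec v) ->
  lattice_ideal D L rho ('X_[u] - rho (mvec u - mvec v) *: 'X_[v]).
Proof.
move=> Du Dv Luv J [_]; apply; exists u, v.
by rewrite mnm_diffE.
Qed.

Lemma lattice_ideal0 : lattice_ideal D L rho 0.
Proof. by case: lattice_ideal_of. Qed.

Lemma lattice_idealD f g : lattice_ideal D L rho f -> lattice_ideal D L rho g ->
  lattice_ideal D L rho (f + g).
Proof. by case: lattice_ideal_of => _ _ add _; apply: add. Qed.

Lemma lattice_idealM a f : kN D a -> lattice_ideal D L rho f ->
  lattice_ideal D L rho (a * f).
Proof. by case: lattice_ideal_of => _ _ _; apply. Qed.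

Lemma lattice_idealZ c f : lattice_ideal D L rho f -> lattice_ideal D L rho (c *: f).
Proof.
rewrite -mul_mpolyC; apply: lattice_idealM.
by rewrite -[c%:MP]mulr1 mul_mpolyC; apply: kNZ; apply: kN1.
Qed.

Hypothesis chi : partial_character D L rho.
Let latL := character_lattice chi.

(** In the Laurent ring modulo all x^l - rho(l), a monomial x^u with u in w + L equals rho(u - w)
    x^w. This is the resulting coefficient of x^w in the image of [f]. *)
Definition coset_sum (w : 'rV[int]_n) f : k :=
  mlin (fun u => (if `[< L (mvec u - w) >] then rho (mvec u - w) else 0) : k^o) f.

HB.instance Definition _ w :=
  GRing.isLinear.Build k {mpoly k[n]} k^o _ (coset_sum w) (mlin_is_linear _).

Lemma coset_sumB w f g : coset_sum w (f - g) = coset_sum w f - coset_sum w g.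
Proof. exact: linearB. Qed.

Lemma coset_sumZ w c f : coset_sum w (c *: f) = c * coset_sum w f.
Proof. exact: linearZ. Qed.

Lemma coset_sumX w u : L (mvec u - w) -> coset_sum w 'X_[u] = rho (mvec u - w).
Proof. by move=> Luw; rewrite /coset_sum mlinX asboolT. Qed.

Lemma coset_sumX0 w u : ~ L (mvec u - w) -> coset_sum w 'X_[u] = 0.
Proof. by move=> Luw; rewrite /coset_sum mlinX asboolF. Qed.

Lemma coset_sumMX w a f : coset_sum w ('X_[a] * f) = coset_sum (w - mvec a) f.
Proof.
rewrite /coset_sum mlinMX; apply: (@eq_mlin _ _ k^o) => u _.
by rewrite mvecD opprB addrCA addrA.
Qed.

Lemma coset_sumM0 a f : (forall w, coset_sum w f = 0) ->
  forall w, coset_sum w (a * f) = 0.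
Proof.
move=> f0 w; rewrite {1}[a]mpolyE mulr_suml linear_sum big1 // => u _.
by rewrite -scalerAl linearZ /= coset_sumMX f0 scaler0.
Qed.

Lemma coset_sum_free f u : u \in msupp f ->
    (forall v, v \in msupp f -> L (mvec u - mvec v) -> u = v) ->
  coset_sum (mvec u) f = f@_u.
Proof.
move=> uf free; rewrite /coset_sum /mlin (bigD1_seq u) ?msupp_uniq //=.
rewrite subrr asboolT ?(character0 chi) ?lattice0 //; last exact: lattice0 latL.
rewrite big_seq_cond big1 ?addr0; first by rewrite /GRing.scale /= mulr1.
move=> v /andP[vf neuv]; rewrite asboolF ?scaler0 // => Lvu.
by case/eqP: neuv; apply/esym/free => //; apply: lattice_subC latL _ _ Lvu.
Qed.

Lemma lattice_ideal_coset_sum f w : lattice_ideal D L rho f -> coset_sum w f = 0.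
Proof.
move=> If; suff /(_ f If)[_ ->] : lattice_ideal D L rho `<=`
  [set f | kN D f /\ forall w, coset_sum w f = 0] by [].
apply: lattice_ideal_ind => [|u v Du Dv Luv].
  split=> [g []//||g h [Dg g0] [Dh h0]|a g Da [Dg g0]].
  - by split=> [|z]; [apply: kN0|rewrite linear0].
  - by split=> [|z]; [apply: kND|rewrite linearD /= g0 h0 addr0].
  - by split; [apply: kNM|apply: coset_sumM0].
split=> [|z]; first by apply: kNB; [apply: kNX|apply: kNZ; apply: kNX].
have Luz : L (mvec u - z) <-> L (mvec v - z).
  by apply: (lattice_equiv latL); rewrite opprB addrA subrK.
rewrite coset_sumB coset_sumZ; case: (pselect (L (mvec u - z))) => Lu.
  have Lv : L (mvec v - z) by apply/Luz.
  rewrite !coset_sumX // -(characterD chi) //.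
  by rewrite addrA subrK subrr.
by rewrite !coset_sumX0 ?mulr0 ?subrr // => /Luz.
Qed.

(** For the converse, if the leading monomial were alone in its coset, the coset sum there would be
    its nonzero coefficient. So another term of [f] lies in the coset, and subtracting a generator
    shortens [f]. *)
Lemma lattice_idealP f :
  lattice_ideal D L rho f <-> kN D f /\ forall w, coset_sum w f = 0.
Proof.
split=> [If|[]].
  by split=> [|w]; [apply: lattice_ideal_kN If|apply: lattice_ideal_coset_sum].
have [m] := ubnP (size (msupp f)); elim: m f => // m IHm f szf Df f0.
case: (eqVneq f 0) => [->|fn0]; first exact: lattice_ideal0.
have uf := mlead_supp fn0; set u := mlead f in uf.
case: (pselect (exists v, [/\ v \in msupp f, u != v & L (mvec u - mvec v)])); last first.
  move=> nov; have := f0 (mvec u); rewrite coset_sum_free // => [/eqP|v vf Luv].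
    by rewrite mleadc_eq0 (negbTE fn0).
  by apply/eqP; apply: contrapT => neuv; apply: nov; exists v; split=> //; apply/negP.
move=> [v [vf neuv Luv]].
pose b := 'X_[u] - rho (mvec u - mvec v) *: 'X_[v] : {mpoly k[n]}.
have Ib : lattice_ideal D L rho b.
  by apply: lattice_ideal_gen => //; apply: Df.
rewrite -(subrK (f@_u *: b) f); apply: lattice_idealD; last exact: lattice_idealZ.
apply: IHm.
- by apply: leq_trans (msupp_reduce _ uf vf neuv) _; rewrite -ltnS.
- by apply: kNB => //; apply: kNZ; apply: lattice_ideal_kN Ib.
- by move=> w; rewrite coset_sumB coset_sumZ f0 lattice_ideal_coset_sum // mulr0 subrr.
Qed.

End OneLattice.
End LatticeIdeals.

(** * Colon ideals of cellular binomial ideals *)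

Section LatticeIdealProperties.
Variables (k : fieldType) (n : nat) (D : {set 'I_n}).
Variables (L : set 'rV[int]_n) (rho : 'rV[int]_n -> k).
Hypothesis chi : partial_character D L rho.
Let latL := character_lattice chi.

Lemma lattice_ideal_free f :
    (forall u v, u \in msupp f -> v \in msupp f -> L (mvec u - mvec v) -> u = v) ->
  lattice_ideal D L rho f -> f = 0.
Proof.
move=> free /(lattice_idealP chi)[_ f0]; apply/eqP; apply: contrapT => /negP fn0.
have uf := mlead_supp fn0.
have := f0 (mvec (mlead f)); rewrite (coset_sum_free chi) // => [/eqP|v vf].
  by rewrite mleadc_eq0 (negbTE fn0).
exact: free.
Qed.

(** Test on the binomial of [w] with the coset sum based at [negm w]: it equals rho(w) - rho'(w) if
    [w] is in [L], and otherwise -rho'(w), which is nonzero. *)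
Lemma lattice_ideal_sub L' rho' : partial_character D L' rho' ->
  lattice_ideal D L' rho' `<=` lattice_ideal D L rho <->
  forall w, L' w -> L w /\ rho' w = rho w.
Proof.
move=> chi'; split=> [sub w L'w|sub].
  have Dw := lattice_sub_ZZ (character_lattice chi') L'w.
  have Luv : L' (mvec (posm w) - mvec (negm w)) by rewrite posm_negm.
  have := lattice_ideal_gen (rho := rho') (NN_posm Dw) (NN_negm Dw) Luv.
  move/sub/(lattice_idealP chi) => [_ /(_ (mvec (negm w)))].
  rewrite posm_negm coset_sumB coset_sumZ (@coset_sumX _ _ _ _ _ (negm w)) subrr; last first.
    exact: lattice0 latL.
  rewrite (character0 chi) mulr1.
  case: (pselect (L w)) => Lw; first by rewrite coset_sumX posm_negm // => /subr0_eq.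
  rewrite coset_sumX0 ?posm_negm // sub0r => /eqP.
  by rewrite oppr_eq0 (negbTE (character_neq0 chi' L'w)).
apply: lattice_ideal_ind => [|u v Du Dv /sub[Luv ->]].
  have [_ I0 addI mulI] := lattice_ideal_of D L rho.
  by split=> //; apply: lattice_ideal_kN.
exact: lattice_ideal_gen.
Qed.

End LatticeIdealProperties.

Section Similar.
Variables (k : fieldType) (n : nat) (I : set {mpoly k[n]}).
Hypothesis idI : is_ideal I.
Implicit Types (u v : 'X_{1..n}).

Definition similar u v : Prop := exists2 c, c != 0 & I ('X_[u] - c *: 'X_[v]).

Lemma similar_sym u v : similar u v -> similar v u.
Proof.
move=> [c c0 Iuv]; exists c^-1; rewrite ?invr_eq0 //.
have -> : 'X_[v] - c^-1 *: 'X_[u] = - c^-1 *: ('X_[u] - c *: 'X_[v]) :> {mpoly k[n]}.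
  by rewrite scalerBr scalerA mulNr mulVf // !scaleNr scale1r opprK addrC.
exact: ideal_scale.
Qed.

Lemma similar_trans v u w : similar u v -> similar v w -> similar u w.
Proof.
move=> [c c0 Iuv] [d d0 Ivw]; exists (c * d); rewrite ?mulf_neq0 //.
apply: (ideal_trans idI Iuv); rewrite -scalerA -scalerBr.
exact: ideal_scale.
Qed.

Lemma similar_refl u : similar u u.
Proof. by exists 1; rewrite ?oner_eq0 // scale1r subrr; apply: ideal0. Qed.

Lemma similarMX a u v : similar u v -> similar (a + u)%MM (a + v)%MM.
Proof.
move=> [c c0 Iuv]; exists c => //.
by rewrite !mpolyXD scalerAr -mulrBr; apply: ideal_mull.
Qed.

Lemma similar_ideal u v : similar u v -> I 'X_[u] <-> I 'X_[v].
Proof.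
have half x y : similar x y -> I 'X_[y] -> I 'X_[x].
  by move=> [c _ Ixy] Iy; apply/(ideal_equiv idI Ixy); apply: ideal_scale.
by move=> uv; split; apply: half => //; apply: similar_sym.
Qed.

Lemma similar_class u : saturated_class I [set v | similar u v].
Proof.
move=> v w c Ivw c0 _; have vw : similar v w by exists c.
by split=> /= [uv|uw]; [apply: similar_trans vw|apply: similar_trans (similar_sym vw)].
Qed.

Lemma saturated_classP (C : set 'X_{1..n}) :
  (forall u v, similar u v -> ~ I 'X_[u] -> C u -> C v) -> saturated_class I C.
Proof.
move=> simC u v c Iuv c0 nIu; have uv : similar u v by exists c.
split; first exact: simC.
by apply: simC; [apply: similar_sym|move/(similar_ideal uv)].
Qed.

End Similar.

Section CellularColon.
Variables (k : fieldType) (n : nat) (D : {set 'I_n}) (I : set {mpoly k[n]}).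
Hypotheses (cellI : cellular D I) (binI : binomial_ideal I).
Implicit Types (f : {mpoly k[n]}) (u v : 'X_{1..n}).

Let idI : is_ideal I. Proof. by case: cellI. Qed.

Lemma cancel_mnm (J : set {mpoly k[n]}) u f :
  (forall i, i \in D -> forall g, J (g * 'X_i) -> J g) ->
  NN D u -> J (f * 'X_[u]) -> J f.
Proof.
move=> cancelJ Du; rewrite mpolyXE_id; move: f.
apply: (big_ind (fun x => forall f, J (f * x) -> J f)) => [f|x y Jx Jy f|i _].
- by rewrite mulr1.
- by rewrite mulrA => /Jy/Jx.
case: (boolP (i \in D)) => [Di|/Du->]; last by move=> f; rewrite expr0 mulr1.
elim: (u i) => [|e IHe] f; first by rewrite expr0 mulr1.
by rewrite exprSr mulrA => /(cancelJ i Di)/IHe.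
Qed.

Lemma cellular_cancel u f : NN D u -> I (f * 'X_[u]) -> I f.
Proof. by apply: cancel_mnm; case: cellI. Qed.

Lemma cellular_nilpotent u : NN (~: D)%SET u -> u != 0%MM -> radical I 'X_[u].
Proof.
move=> Du /eqP u0.
have [i ui] : exists i, u i != 0%N.
  apply: contrapT => no; apply: u0; apply/mnmP => i; rewrite mnm0E.
  by apply/eqP; apply: contrapT => ui; apply: no; exists i; apply/negP.
have Di : i \notin D.
  by apply/negP => Di; move: ui; rewrite Du ?eqxx // finset.in_setC negbK.
have [_ _ _ /(_ i Di)[e Ie]] := cellI.
have radXi : radical I 'X_i by exists e.
have -> : 'X_[u] = 'X_[u - U_(i)] * 'X_i :> {mpoly k[n]}.
  by rewrite -mpolyXD submK // lep1mP.
exact: ideal_mull (radical_ideal idI) _ _ radXi.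
Qed.

Lemma cellular_mnm_proper u : NN D u -> ~ I 'X_[u].
Proof.
case: cellI => _ I1 _ _ Du; rewrite -['X_[u]]mul1r => /(cellular_cancel Du).
exact: I1.
Qed.

Section Colon.
Variable m : 'X_{1..n}.
Hypothesis nIm : ~ I 'X_[m].

Let E u v c := I ('X_[m] * ('X_[u] - c *: 'X_[v])).

(** The relation depends only on the vector u - v, because monomials in the variables of [D] cancel
    modulo [I]. Hence a scalar chosen for one representation serves all. *)
Let E_transfer u v u' v' c : NN D v -> (u + v' = u' + v)%MM -> E u v c -> E u' v' c.
Proof.
move=> Dv eqs; rewrite /E => Iuv; apply: (cellular_cancel (u := v)) => //.
have -> : 'X_[m] * ('X_[u'] - c *: 'X_[v']) * 'X_[v]
        = 'X_[v'] * ('X_[m] * ('X_[u] - c *: 'X_[v])) :> {mpoly k[n]}.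
  have XE : 'X_[u] * 'X_[v'] = 'X_[u'] * 'X_[v] :> {mpoly k[n]}.
    by rewrite -!mpolyXD eqs.
  transitivity ('X_[m] * ('X_[u'] * 'X_[v] - c%:MP * 'X_[v'] * 'X_[v]) : {mpoly k[n]}).
    by rewrite -mul_mpolyC; ring.
  by rewrite -XE -mul_mpolyC; ring.
exact: ideal_mull.
Qed.

Let E_unique u v c c' : NN D v -> E u v c -> E u v c' -> c = c'.
Proof.
move=> Dv Ec Ec'; apply/eqP; rewrite -subr_eq0; apply/negP => /negP cc'.
apply: nIm; apply: (cellular_cancel Dv); apply: (ideal_scaleK idI cc').
have -> : (c - c') *: ('X_[m] * 'X_[v])
   = 'X_[m] * ('X_[u] - c' *: 'X_[v]) - 'X_[m] * ('X_[u] - c *: 'X_[v]) :> {mpoly k[n]}.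
  by rewrite -!mul_mpolyC mpolyCB; ring.
exact: ideal_sub.
Qed.

Let Lm : set 'rV[int]_n := [set w | exists u v c,
  [/\ NN D u, NN D v, c != 0, E u v c & w = mvec u - mvec v]].

Let mvec_eq u v (u' v' : 'X_{1..n}) :
  mvec u - mvec v = mvec u' - mvec v' -> (u + v' = u' + v)%MM.
Proof.
move=> eqs; apply: mvec_inj; rewrite !mvecD; apply/eqP.
by rewrite -subr_eq addrAC eqs subrK.
Qed.

Let E_mul u v c u' v' c' : E u v c -> E u' v' c' -> E (u + u')%MM (v + v')%MM (c * c').
Proof.
rewrite /E !mpolyXD => Ec Ec'.
have -> : 'X_[m] * ('X_[u] * 'X_[u'] - (c * c') *: ('X_[v] * 'X_[v']))
  = 'X_[u'] * ('X_[m] * ('X_[u] - c *: 'X_[v]))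
    + c%:MP * 'X_[v] * ('X_[m] * ('X_[u'] - c' *: 'X_[v'])) :> {mpoly k[n]}.
  by rewrite -!mul_mpolyC mpolyCM; ring.
by apply: ideal_add => //; apply: ideal_mull.
Qed.

Let E_inv u v c : c != 0 -> E u v c -> E v u c^-1.
Proof.
rewrite /E => c0 Ec.
have -> : 'X_[m] * ('X_[v] - c^-1 *: 'X_[u])
  = - c^-1 *: ('X_[m] * ('X_[u] - c *: 'X_[v])) :> {mpoly k[n]}.
  rewrite [RHS]scalerAr; congr (_ * _).
  by rewrite scalerBr scalerA mulNr mulVf // !scaleNr scale1r opprK addrC.
exact: ideal_scale.
Qed.

(** The binomials killing [X^m] modulo [I] define the lattice and its character. They generate the
    colon ideal in k[N^D] because the quotient by [I] is graded by classes of similar monomials. *)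
Lemma colon_lattice_ideal : exists L tau,
  partial_character D L tau /\ colon I 'X_[m] `&` kN D = lattice_ideal D L tau.
Proof.
have /choice[tau tauP] : forall w, exists c, Lm w -> c != 0 /\
    exists u v, [/\ NN D u, NN D v, E u v c & w = mvec u - mvec v].
  move=> w; case: (pselect (Lm w)) => [|nL]; last by exists 0.
  by move=> [u [v [c [Du Dv c0 Ec ->]]]]; exists c => _; split=> //; exists u, v.
have tauE u v : NN D u -> NN D v -> Lm (mvec u - mvec v) ->
    E u v (tau (mvec u - mvec v)).
  move=> Du Dv /tauP[_ [u' [v' [Du' Dv' Ec eqs]]]].
  by apply: E_transfer Ec => //; apply: mvec_eq.
have chi : partial_character D Lm tau.
  split.
  - split=> [w [u [v [c [Du Dv _ _ ->]]]] i Di||].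
    + by rewrite !mxE Du ?Dv ?subrr.
    + exists 0%MM, 0%MM, 1; split; rewrite ?oner_eq0 ?subrr //; try exact: NN0.
      by rewrite /E scale1r subrr mulr0; apply: ideal0.
    + move=> _ _ [u [v [c [Du Dv c0 Ec ->]]]] [u' [v' [c' [Du' Dv' c0' Ec' ->]]]].
      exists (u + v')%MM, (v + u')%MM, (c / c'); split.
      * exact/NN_add.
      * exact/NN_add.
      * by rewrite mulf_neq0 ?invr_eq0.
      * by apply: E_mul => //; apply: E_inv.
      * by rewrite !mvecD opprB opprD addrACA.
  - by move=> w /tauP[].
  - move=> w z Lw Lz.
    have [_ [u [v [Du Dv Ew wE]]]] := tauP _ Lw.
    have [_ [u' [v' [Du' Dv' Ez zE]]]] := tauP _ Lz.
    have wzE : w + z = mvec (u + u')%MM - mvec (v + v')%MM.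
      by rewrite wE zE !mvecD opprD addrACA.
    have Lwz : Lm (w + z).
      exists (u + u')%MM, (v + v')%MM, (tau w * tau z); split=> //.
      * exact/NN_add.
      * exact/NN_add.
      * by rewrite mulf_neq0 //; [case: (tauP _ Lw)|case: (tauP _ Lz)].
      * exact: E_mul.
    apply: (E_unique (u := (u + u')%MM) (v := (v + v')%MM)); first exact/NN_add.
      by rewrite wzE; apply: tauE; rewrite -?wzE //; apply/NN_add.
    exact: E_mul.
exists Lm, tau; split=> //; apply/seteqP; split=> [f [If Df]|]; last first.
  apply: lattice_ideal_ind => [|u v Du Dv /(tauE u v Du Dv) Euv].
    split=> [f []//||f g [If Df] [Ig Dg]|a f Da [If Df]].
    - by split; [apply: ideal0 (colon_ideal _ idI)|apply: kN0].
    - by split; [apply: ideal_add (colon_ideal _ idI) _ _ _ _|apply: kND].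
    - by split; [apply: ideal_mull (colon_ideal _ idI) _ _ _|apply: kNM].
  split; first by rewrite /colon /= mulrC.
  by apply: kNB; [apply: kNX|apply: kNZ; apply: kNX].
have [d] := ubnP (size (msupp f)); elim: d f If Df => // d IHd f If Df szf.
case: (eqVneq f 0) => [->|fn0]; first exact: lattice_ideal0.
have uf := mlead_supp fn0; set u := mlead f in uf; have Du := Df u uf.
have nIu : ~ I 'X_[u + m].
  by rewrite mpolyXD mulrC => /(cellular_cancel Du).
case: (pselect (exists v, [/\ v \in msupp f, u != v
    & similar I (u + m) (v + m)%MM])); last first.
  (* If no other exponent becomes similar to [u] after multiplication by [X^m], projecting [f * X^m]
     onto that class leaves a single term, which would be in [I]. *)
  move=> nov; case: nIu; apply: (ideal_scaleK idI (c := f@_u)).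
    by rewrite mleadc_eq0.
  have := mproj_ideal binI (similar_class idI (u + m)%MM) If.
  rewrite {1}[f]mpolyE mulr_suml linear_sum (bigD1_seq u) ?msupp_uniq //=.
  rewrite -scalerAl linearZ /= -mpolyXD mprojX; last exact: similar_refl.
  rewrite big_seq_cond big1 ?addr0 // => v /andP[vf neuv].
  rewrite -scalerAl linearZ /= -mpolyXD mprojX0 ?scaler0 // => simv.
  by apply: nov; exists v; rewrite eq_sym.
move=> [v [vf neuv [c c0 Iuv]]]; have Dv := Df v vf.
have Ec : E u v c.
  by rewrite /E mulrBr -scalerAr -!mpolyXD addmC [(m + v)%MM]addmC.
have Luv : Lm (mvec u - mvec v) by exists u, v, c.
have Ib := lattice_ideal_gen (rho := tau) Du Dv Luv.
rewrite -(subrK (f@_u *: ('X_[u] - tau (mvec u - mvec v) *: 'X_[v])) f).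
apply: lattice_idealD; last exact: lattice_idealZ.
have Eb := tauE u v Du Dv Luv.
apply: IHd.
- rewrite /colon /= mulrBl; apply: ideal_sub => //.
  by rewrite -scalerAl; apply: ideal_scale => //; rewrite mulrC.
- by apply: kNB => //; apply: kNZ; apply: lattice_ideal_kN Ib.
- by apply: leq_trans (msupp_reduce _ uf vf neuv) _; rewrite -ltnS.
Qed.

End Colon.

Lemma cellular_character_exists : exists L rho, cellular_character D I L rho.
Proof.
have nI0 : ~ I 'X_[0] by apply: cellular_mnm_proper; apply: NN0.
have [L [rho [chi colonE]]] := colon_lattice_ideal nI0.
by exists L, rho; split=> //; rewrite -colonE mpolyX0 /colon; apply/seteqP;
  split=> f []; rewrite /= ?mulr1.
Qed.

End CellularColon.

(** * Ranks of lattices *)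

Section Rank.
Variables (n : nat) (D : {set 'I_n}).
Implicit Types (L M : set 'rV[int]_n) (w z : 'rV[int]_n).

Lemma scale_int (m : nat) (w : 'rV[int]_m) (d : int) : d *: w = w *~ d.
Proof. by rewrite -scaler_int intz. Qed.

Lemma clear_denominators (r : nat) (c : 'rV[rat]_r) :
  exists2 N : nat, (0 < N)%N & exists d : 'rV[int]_r, N%:R *: c = map_mx intr d.
Proof.
have posP (p : pred 'I_r) : 0 < \prod_(j | p j) denq (c 0 j) :> int.
  by rewrite prodr_gt0 // => j _; apply: denq_gt0.
exists `|(\prod_j denq (c 0 j) : int)|%N; first by rewrite absz_gt0 gt_eqF.
exists (\row_i (numq (c 0 i) * \prod_(j | j != i) denq (c 0 j))).
apply/rowP => i; rewrite !mxE pmulrn gez0_abs ?ltW //.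
rewrite (bigD1 i) //= !intrM mulrAC; congr (_ * _).
by rewrite -{2}[c 0 i]divq_num_den mulrCA divff ?mulr1 // intr_eq0 denq_eq0.
Qed.

Lemma ratmx_inj (m : nat) : injective (@ratmx n m).
Proof.
move=> A B /matrixP AB; apply/matrixP => i j.
by have := AB i j; rewrite !mxE => /intr_inj.
Qed.

Lemma span_multiple L r (A : 'M[int]_(r, n)) w :
    lattice D L -> (forall i, L (row i A)) -> (ratmx w <= ratmx A)%MS ->
  exists2 N, (0 < N)%N & L (w *+ N).
Proof.
move=> latL LA /submxP[c wE].
have [N N0 [d dE]] := clear_denominators c; exists N => //.
have -> : w *+ N = \sum_i row i A *~ d 0 i.
  apply: ratmx_inj; rewrite /ratmx raddfMn /= -/(ratmx w) wE -scaler_nat scalemxAl dE.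
  rewrite -map_mxM; congr (map_mx _ _); rewrite mulmx_sum_row.
  by apply: eq_bigr => i _; rewrite scale_int.
by apply: (lattice_sum latL) => i; apply: (lattice_mulz latL).
Qed.

Lemma SatP L w : lattice D L ->
  Sat D L w <-> ZZ D w /\ exists2 N, (0 < N)%N & L (w *+ N).
Proof.
move=> latL; split=> [[Dw [r [A [LA sub]]]]|[Dw [N N0 LwN]]]; split=> //.
  exact: span_multiple sub.
exists 1%N, (w *+ N); split=> [i|].
  by rewrite (_ : row i _ = w *+ N) //; apply/rowP => j; rewrite !mxE !ord1.
rewrite /ratmx raddfMn /= -scaler_nat.
by rewrite eqmx_scale ?submx_refl // pnatr_eq0 -lt0n.
Qed.

Let independent L r := exists A : 'M[int]_(r, n),
  (forall i, L (row i A)) /\ row_free (ratmx A).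

Lemma leq_lattice_rank L r : independent L r -> (r <= lattice_rank L)%N.
Proof.
move=> indr; have ltr : (r < n.+1)%N.
  by case: indr => A [_ /eqP <-]; rewrite ltnS rank_leq_col.
by apply: (@leq_bigmax_cond _ _ (fun r : 'I_n.+1 => r : nat) (Ordinal ltr)); apply/asboolP.
Qed.

Lemma lattice_rank_independent L : independent L (lattice_rank L).
Proof.
pose p := [pred r : 'I_n.+1 | `[< independent L r >]].
have p0 : (0 < #|p|)%N.
  apply/card_gt0P; exists ord0; apply/asboolP; exists 0; split=> [[]//|].
  by rewrite /row_free -leqn0 rank_leq_row.
have [r pr rankE] := eq_bigmax_cond (fun r : 'I_n.+1 => r : nat) p0.
by rewrite /lattice_rank [\max_(_ < _ | _) _]rankE; apply/asboolP.
Qed.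

(** If every element of [M] had a multiple in [L], a common multiple would move an independent
    family of [M] into [L]. Conversely [w] can be appended to an independent family of [L], since a
    dependence would put a multiple of [w] in [L]. *)
Lemma lattice_rank_ltP L M : lattice D L -> lattice D M -> L `<=` M ->
  (lattice_rank L < lattice_rank M)%N <->
  exists2 w, M w & forall N, (0 < N)%N -> ~ L (w *+ N).
Proof.
move=> latL latM LM; split=> [ltrank|[w Mw noL]].
  apply: contrapT => no; move: ltrank; rewrite ltnNge => /negP; apply.
  apply: leq_lattice_rank; have [A [MA freeA]] := lattice_rank_independent M.
  have /choice[N NP] : forall i, exists N, (0 < N)%N /\ L (row i A *+ N).
    move=> i; apply: contrapT => noN; apply: no; exists (row i A) => // N N0 LN.
    by apply: noN; exists N.
  pose d := (\prod_i N i)%N.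
  exists (A *+ d); split=> [i|].
    rewrite raddfMn /= /d (bigD1 i) //= mulrnA.
    by apply: (lattice_muln latL); case: (NP i).
  rewrite /ratmx raddfMn /= -scaler_nat /row_free mxrank_scale_nz //.
  by rewrite pnatr_eq0 -lt0n prodn_gt0 // => i; case: (NP i).
have [A [LA freeA]] := lattice_rank_independent L.
rewrite -addn1; apply: leq_lattice_rank; exists (col_mx A w); split=> [i|].
  case: (split_ordP i) => j ->; first by rewrite rowKu; apply: LM.
  by rewrite rowKd (_ : row j w = w) //; apply/rowP => c; rewrite mxE ord1.
rewrite /ratmx map_col_mx -/(ratmx A) -/(ratmx w) /row_free eqn_leq rank_leq_row /=.
have ltr : (\rank (ratmx A) < \rank (col_mx (ratmx A) (ratmx w)))%N.
  rewrite -addsmxE; apply: rank_ltmx; rewrite ltmxE addsmxSl /=.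
  apply/negP => /(submx_trans (addsmxSr _ _)) sub.
  by have [N N0 LN] := span_multiple latL LA sub; apply: noL LN.
by rewrite (eqP freeA) in ltr; apply: leq_trans ltr; rewrite addn1.
Qed.

(* [E] indexes a transcendence basis of [k[N^D]] modulo [I(rho)]. *)
Definition transverse L (E : {set 'I_n}) : Prop :=
  [/\ E \subset D, forall w, L w -> ZZ E w -> w = 0
    & exists2 d, (0 < d)%N & exists z : 'I_n -> 'rV[int]_n,
        forall i, i \in D -> ZZ E (z i) /\ L (mvec U_(i)%MM *+ d - z i)].

(** Take [E] maximal. For i in D outside E, maximality gives a nonzero vector of [L] supported on i
    and E; its i-th coordinate is nonzero by independence, so it expresses a multiple of the i-th
    unit vector through Z^E modulo [L]. *)
Lemma transverse_exists L : lattice D L -> exists E, transverse L E.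
Proof.
move=> latL.
pose p (E : {set 'I_n}) := (E \subset D) && `[< forall w, L w -> ZZ E w -> w = 0 >].
have p0 : p finset.set0.
  rewrite /p finset.sub0set; apply/asboolP => w _ w0.
  by apply/rowP => i; rewrite mxE w0 // finset.in_set0.
have [E /maxsetP[/andP[ED /asboolP indE] maxE] _] := maxset_exists p0.
exists E; split=> //.
have /choice[d /choice[z dzP]] : forall i, exists d, exists z, i \in D ->
    [/\ (0 < d)%N, ZZ E z & L (mvec U_(i)%MM *+ d - z)].
  move=> i; case: (boolP (i \in D)) => [Di|_]; last by exists 0%N, 0.
  case: (boolP (i \in E)) => Ei.
    exists 1%N, (mvec U_(i)%MM) => _; split=> //.
      by apply/NN_mvec; apply: NN_U.
    by rewrite mulr1n subrr; apply: (lattice0 latL).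
  have [w [Lw wE w0]] : exists w, [/\ L w, ZZ (i |: E)%SET w & w != 0].
    apply: contrapT => no; have : p (i |: E)%SET.
      rewrite /p finset.subUset finset.sub1set Di ED /=; apply/asboolP => w Lw wE.
      by apply/eqP; apply: contrapT => w0; apply: no; exists w; split=> //; apply/negP.
    move/maxE => /(_ (finset.subsetUr _ _)) EE; move: Ei.
    by rewrite -EE finset.setU11.
  have wi0 : w 0 i != 0.
    apply: contraNneq w0 => wi0; apply/eqP; apply: indE => // j Ej.
    case: (eqVneq j i) => [->//|neji]; apply: wE.
    by rewrite finset.in_setU1 negb_or neji.
  (* The sign is normalised because the multiple is required to be a positive natural number. *)
  have [v [Lv vE vi0]] : exists v, [/\ L v, ZZ (i |: E)%SET v & 0 < v 0 i].
    case: (ltrgtP 0 (w 0 i)) => [lt0|gt0|eq0]; first by exists w.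
      exists (- w); split; first exact: (lattice_opp latL).
        by move=> j Ej; rewrite mxE wE // oppr0.
      by rewrite mxE oppr_gt0.
    by rewrite -eq0 eqxx in wi0.
  exists (absz (v 0 i)), (mvec U_(i)%MM *+ absz (v 0 i) - v) => _; split.
  - by rewrite absz_gt0 gt_eqF.
  - move=> j Ej; rewrite !mxE mulmxnE mvecE mnm1E.
    case: (eqVneq i j) => [<-|neij].
      by rewrite pmulrn -mulrzr mul1r intz gez0_abs ?subrr // ltW.
    by rewrite mul0rn sub0r vE ?oppr0 // finset.in_setU1 negb_or eq_sym neij.
  - by rewrite subKr.
exists (\prod_(i in D) d i)%N.
  by rewrite prodn_cond_gt0 // => i /(dzP i)[].
exists (fun i => z i *+ \prod_(j in D | j != i) d j)%N => i Di.
have [_ zE Lz] := dzP i Di; split.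
  exact: (lattice_muln (lattice_ZZ E)).
rewrite (bigD1 i) //= mulrnA -mulrnBl.
exact: (lattice_muln latL).
Qed.

(** On Z^D, [wt] is d times the rational projection onto Q^E along the span of [L]; the factor d
    keeps it integral. *)
Lemma transverse_weight L E : lattice D L -> transverse L E ->
  exists2 d, (0 < d)%N & exists wt : 'rV[int]_n -> 'rV[int]_n,
    (forall w z, wt (w + z) = wt w + wt z) /\
    forall w, ZZ D w -> ZZ E (wt w) /\ L (w *+ d - wt w).
Proof.
move=> latL [ED _ [d d0 [z zP]]]; exists d => //.
exists (fun w => \sum_(i in D) z i *~ w 0 i); split=> [w w'|w Dw].
  by rewrite -big_split; apply: eq_bigr => i _; rewrite mxE mulrzDr.
have wE : w = \sum_(i in D) mvec U_(i)%MM *~ w 0 i.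
  apply/rowP => j; rewrite summxE; case: (boolP (j \in D)) => Dj.
    rewrite (bigD1 j) //= big1 ?addr0 => [|i /andP[_ neij]].
      by rewrite -scale_int mxE mvecE mnm1E eqxx mulr1.
    by rewrite -scale_int mxE mvecE mnm1E (negbTE neij) mulr0.
  rewrite Dw // big1 // => i Di; rewrite -scale_int mxE mvecE mnm1E.
  by case: eqP => [ij|_]; [rewrite -ij Di in Dj|rewrite mulr0].
split.
  apply: big_ind => [|x y Ex Ey|i Di]; first exact: (lattice0 (lattice_ZZ E)).
    exact: (lattice_add (lattice_ZZ E)).
  by apply: (lattice_mulz (lattice_ZZ E)); case: (zP i Di).
have -> : w *+ d - \sum_(i in D) z i *~ w 0 i =
    \sum_(i in D) (mvec U_(i)%MM *+ d - z i) *~ w 0 i.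
  rewrite {1}wE -sumrMnl -sumrB; apply: eq_bigr => i _.
  by rewrite mulrzBl !pmulrn mulrzAC.
apply: big_ind => [|x y|i Di]; first exact: (lattice0 latL).
  exact: (lattice_add latL).
by apply: (lattice_mulz latL); case: (zP i Di).
Qed.

Lemma transverse_multiple L E w : lattice D L -> transverse L E -> ZZ D w ->
  exists2 d, (0 < d)%N & exists2 z, ZZ E z & L (w *+ d - z).
Proof.
move=> latL trE Dw; have [d d0 [wt [_ /(_ w Dw)[Ew Lw]]]] := transverse_weight latL trE.
by exists d => //; exists (wt w).
Qed.

End Rank.

(** * Torsion over a subring *)

(** Fraction-free Gaussian elimination on the last column, so that the coefficients stay in [A]. *)
Lemma linear_dependence (R : idomainType) (A : set R) :
    A 1 -> (forall x y, A x -> A y -> A (x - y)) ->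
    (forall x y, A x -> A y -> A (x * y)) ->
  forall N (M : 'I_N.+1 -> 'I_N -> R), (forall i j, A (M i j)) ->
  exists q : 'I_N.+1 -> R,
    [/\ forall i, A (q i), exists i, q i != 0
      & forall j, \sum_i q i * M i j = 0].
Proof.
move=> A1 AB AM; have A0 : A 0 by rewrite -(subrr 1); apply: AB.
have AN x : A x -> A (- x) by rewrite -sub0r; apply: AB.
have AD x y : A x -> A y -> A (x + y).
  by move=> Ax Ay; rewrite -[y]opprK; apply: AB => //; apply: AN.
elim=> [|N IHN] M AMij.
  exists (fun=> 1); split=> //; last by case.
  by exists ord0; apply: oner_neq0.
case: (pselect (exists p, M p ord_max != 0)) => [[p a0]|nop].
  set a := M p ord_max in a0.
  have [i j|q [Aq [i0 qi0] q0]] := IHN (fun i j =>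
      a * M (lift p i) (lift ord_max j) - M (lift p i) ord_max * M p (lift ord_max j)).
    by apply: AB; apply: AM; apply: AMij.
  pose s := \sum_i q i * M (lift p i) ord_max.
  (* The pivot row gets the coefficient -s that cancels the last column; the relation [q] of the
     eliminated rows takes care of the others. *)
  exists (fun i => if unlift p i is Some j then a * q j else - s); split.
  - move=> i; case: unliftP => [j _|_]; first by apply: AM => //; apply: AMij.
    by apply: AN; apply: (big_ind A) => // j _; apply: AM => //; apply: AMij.
  - by exists (lift p i0); rewrite liftK mulf_neq0.
  move=> j; rewrite (bigD1_ord p) //= unlift_none.
  under eq_bigr do rewrite liftK.
  case: (unliftP ord_max j) => [l|] ->; last first.
    apply/eqP; rewrite addrC mulNr subr_eq0 mulrC mulr_sumr; apply/eqP.
    by apply: eq_bigr => i _; rewrite -/a !mulrA.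
  rewrite -[RHS](q0 l) mulNr /s mulr_suml -sumrN -big_split /=.
  by apply: eq_bigr => i _; ring.
have M0 p : M p ord_max = 0.
  by apply/eqP; apply: contrapT => /negP Mp; apply: nop; exists p.
have [i j|q [Aq [i0 qi0] q0]] :=
  IHN (fun i j => M (lift ord_max i) (lift ord_max j)); first exact: AMij.
exists (fun i => if unlift ord_max i is Some j then q j else 0); split.
- by move=> i; case: unliftP.
- by exists (lift ord_max i0); rewrite liftK.
move=> j; rewrite (bigD1_ord ord_max) //= unlift_none mul0r add0r.
under eq_bigr do rewrite liftK.
case: (unliftP ord_max j) => [l ->|->]; first exact: q0.
by rewrite big1 // => i _; rewrite M0 mulr0.
Qed.

(* Divide an algebraic relation for [a] by [a] until its constant term is
   nonzero. *)
Lemma prime_divides_algebraic (R : comNzRingType) (A P : set R) (a : R) :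
    prime_ideal P -> ~ P a -> forall p : {poly R}, (forall i, A p`_i) -> p != 0 ->
    P p.[a] ->
  exists t b, [/\ A b, b != 0 & P (t * a - b)].
Proof.
move=> prP Pa; have [idP _ _] := prP.
elim/poly_ind => [|p c IHp] Ap p0; first by rewrite eqxx in p0.
rewrite hornerMXaddC => Ppa.
have coefS i : p`_i = (p * 'X + c%:P)`_i.+1 by rewrite coefD coefMX coefC addr0.
have coef0' : c = (p * 'X + c%:P)`_0 by rewrite coefD coefMX coefC add0r.
case: (eqVneq c 0) => c0; last first.
  exists (- p.[a]), c; split=> //; first by rewrite coef0'.
  by rewrite mulNr -opprD; apply: ideal_opp.
apply: IHp.
- by move=> i; rewrite coefS.
- by apply: contraNneq p0 => ->; rewrite c0 mul0r addr0.
- by move: Ppa; rewrite c0 addr0; case: prP => _ _ prP' /prP'[].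
Qed.

Section TorsionClosure.
Variables (R : idomainType) (A : set R).
Hypotheses (A1 : A 1) (AM : forall x y, A x -> A y -> A (x * y)).
Implicit Types I J : set R.

Definition torsion_closure I : set R :=
  [set f | exists b, [/\ A b, b != 0 & I (b * f)]].

Lemma torsion_closure_sub I : I `<=` torsion_closure I.
Proof. by move=> f If; exists 1; rewrite oner_eq0 mul1r. Qed.

Lemma torsion_closure_mono I J : I `<=` J -> torsion_closure I `<=` torsion_closure J.
Proof. by move=> IJ f [b [Ab b0 /IJ Jbf]]; exists b. Qed.

Lemma torsion_closureM b I f :
  A b -> b != 0 -> torsion_closure I (b * f) -> torsion_closure I f.
Proof.
move=> Ab b0 [c [Ac c0 Icbf]]; exists (c * b).
by rewrite mulf_neq0 // -mulrA; split=> //; apply: AM.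
Qed.

Lemma torsion_closure_ideal I : is_ideal I -> is_ideal (torsion_closure I).
Proof.
move=> idI; split=> // [|f g [b [Ab b0 If]] [c [Ac c0 Ig]]|a f _ [b [Ab b0 If]]].
- by apply: torsion_closure_sub; apply: ideal0.
- exists (b * c); rewrite mulf_neq0 //; split=> //; first exact: AM.
  rewrite mulrDr; apply: ideal_add => //.
    by rewrite [b * c]mulrC -mulrA; apply: ideal_mull.
  by rewrite -mulrA; apply: ideal_mull.
- by exists b; split=> //; rewrite mulrCA; apply: ideal_mull.
Qed.

Lemma torsion_closure_common (r : nat) (F : 'I_r -> set R) f :
  (forall l, is_ideal (F l)) -> (forall l, torsion_closure (F l) f) ->
  exists b, [/\ A b, b != 0 & forall l, F l (b * f)].
Proof.
move=> idF /choice[b bP]; exists (\prod_l b l); split.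
- by apply: (big_ind A) => // l _; case: (bP l).
- by apply/prodf_neq0 => l _; case: (bP l).
- move=> l; rewrite (bigD1 l) //= [b l * _]mulrC -mulrA; apply: ideal_mull => //.
  by case: (bP l).
Qed.

End TorsionClosure.

(** * The hull of a cellular binomial ideal *)

Section CellularTorsion.
Variables (k : fieldType) (n : nat) (D E : {set 'I_n}) (I : set {mpoly k[n]}).
Variables (L : set 'rV[int]_n) (rho : 'rV[int]_n -> k).
Hypotheses (cellI : cellular D I) (binI : binomial_ideal I).
Hypotheses (chiI : cellular_character D I L rho) (trE : transverse D L E).
Implicit Types (f g b : {mpoly k[n]}) (u v m : 'X_{1..n}).

Let idI : is_ideal I. Proof. by case: cellI. Qed.
Let chi : partial_character D L rho. Proof. by case: chiI. Qed.
Let latL : lattice D L := character_lattice chi.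
Let subED : E \subset D. Proof. by case: trE. Qed.

Notation tc := (torsion_closure (@kN k n E)).

Lemma mpolyX_neq0 u : 'X_[u] != 0 :> {mpoly k[n]}.
Proof. by rewrite -msupp_eq0 msuppX. Qed.

Lemma lattice_ideal_cellular f : kN D f -> I f <-> lattice_ideal D L rho f.
Proof. by case: chiI => _ <- Df; split=> [If|[]]. Qed.

Lemma lattice_ideal_transverse M tau f :
    partial_character D M tau -> (forall w, M w -> ZZ E w -> w = 0) ->
  lattice_ideal D M tau f -> kN E f -> f = 0.
Proof.
move=> chiM indM If Ef; apply: (lattice_ideal_free chiM) If => u v uf vf Muv.
apply: mvec_inj; apply/eqP; rewrite -subr_eq0; apply/eqP; apply: indM => //.
by apply: (lattice_sub (lattice_ZZ E)); apply/NN_mvec; apply: Ef.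
Qed.

Lemma cellular_transverse b : I b -> kN E b -> b = 0.
Proof.
move=> Ib Eb; apply: (lattice_ideal_transverse chi _ _ Eb); first by case: trE.
by apply/lattice_ideal_cellular => //; apply: kN_sub Eb.
Qed.

Lemma tcI_ideal : is_ideal (tc I).
Proof. by apply: torsion_closure_ideal => //; [exact: kN1|exact: kNM]. Qed.

Lemma tcI_sub : I `<=` tc I.
Proof. exact: (torsion_closure_sub (@kN1 k n E)). Qed.

Lemma colon_lattice_sub m M tau :
    partial_character D M tau -> colon I 'X_[m] `&` kN D = lattice_ideal D M tau ->
  L `<=` M.
Proof.
move=> chiM colonE w Lw; suff /(lattice_ideal_sub chiM chi) : 
  lattice_ideal D L rho `<=` lattice_ideal D M tau by move/(_ w Lw) => [].
rewrite -colonE => f If; have Df := lattice_ideal_kN If; split=> //.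
by apply: ideal_mulr => //; apply/(lattice_ideal_cellular Df).
Qed.

(** The part [m] of [u] outside [D] is the witness. The torsion multiplier is a nonzero element of
    k[N^E] in the lattice ideal of I : X^m, so that lattice contains a nonzero vector of Z^E. No
    positive multiple of it is in [L], and the rank goes up. *)
Lemma torsion_witness u : tc I 'X_[u] -> idealD I (M_emb D I) 'X_[u].
Proof.
move=> [b [Eb b0 Ibu]].
pose m := part (~: D)%SET u; have uE : 'X_[u] = 'X_[part D u] * 'X_[m] :> {mpoly k[n]}.
  by rewrite -mpolyXD partC.
have idM : is_ideal (M_emb D I) by apply: ideal_gen_ideal.
case: (pselect (I 'X_[m])) => [Im|nIm].
  by apply: idealDl => //; rewrite uE; apply: ideal_mull.
have [M [tau [chiM colonE]]] := colon_lattice_ideal cellI binI nIm.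
have LM := colon_lattice_sub chiM colonE.
apply: idealDr => //; rewrite uE; apply: (ideal_mull idM).
have wit : witness D I M m by split; [apply: NN_part|exists tau].
suff [w [Mw Ew w0]] : exists w, [/\ M w, ZZ E w & w <> 0].
  move=> J [_]; apply; exists M, m; split=> //.
  split; first by exists m.
  exists L, rho; split=> //.
  apply/(lattice_rank_ltP latL (character_lattice chiM) LM); exists w => // N N0 LwN.
  have [_ indE _] := trE.
  case: w0; apply: (muln_eq0_rV N0); apply: indE => //.
  exact: (lattice_muln (lattice_ZZ E)).
apply: contrapT => now; case/eqP: b0; apply: (lattice_ideal_transverse chiM _ _ Eb).
  by move=> w Mw Ew; apply: contrapT => w0; apply: now; exists w.
rewrite -colonE; split; last exact: kN_sub Eb.
rewrite /colon /=.
apply: (cellular_cancel cellI (@NN_part n D u)).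
by rewrite -mulrA [_ * 'X_[part D u]]mulrC -uE.
Qed.

(** A rank jump gives a vector of [M] without multiples in [L]; moving a multiple of it into Z^E
    modulo [L] yields a nonzero [z], whose binomial is the multiplier in k[N^E]. *)
Lemma embedded_torsion M m : embedded_lattice D I M -> witness D I M m -> tc I 'X_[m].
Proof.
move=> [_ [L' [rho' [[chi' cell'] ltrank]]]] [_ [tau [chiM colonE]]].
(* [embedded_lattice] supplies its own character of [I]; its lattice is determined by the lattice
   ideal. *)
have L'E : L' = L.
  have ILE : lattice_ideal D L' rho' = lattice_ideal D L rho.
    by rewrite -cell'; case: chiI.
  apply/seteqP; split=> w Lw.
    by case: ((lattice_ideal_sub chi chi').1 _ w Lw) => //; rewrite ILE.
  by case: ((lattice_ideal_sub chi' chi).1 _ w Lw) => //; rewrite ILE.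
rewrite {}L'E in ltrank; have latM := character_lattice chiM.
have LM := colon_lattice_sub chiM colonE.
have [w Mw noL] := (lattice_rank_ltP latL latM LM).1 ltrank.
have [d d0 [z Ez Lz]] := transverse_multiple latL trE (lattice_sub_ZZ latM Mw).
have Mz : M z.
  by apply/(lattice_equiv latM (LM _ Lz)); apply: (lattice_muln latM).
have z0 : z <> 0 by move=> z0; apply: (noL d d0); rewrite z0 subr0 in Lz.
have [Ep En] := (NN_posm Ez, NN_negm Ez).
exists ('X_[posm z] - tau z *: 'X_[negm z]); split.
- by apply: kNB; [apply: kNX|apply: kNZ; apply: kNX].
- apply/eqP => /mpolyP/(_ (posm z)); rewrite mcoeff0 mcoeffB mcoeffZ !mcoeffX eqxx.
  case: eqP => [eqz|_]; first by case: z0; rewrite -(posm_negm z) eqz subrr.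
  by rewrite mulr0 subr0 => /eqP; rewrite oner_eq0.
have : lattice_ideal D M tau ('X_[posm z] - tau z *: 'X_[negm z]).
  rewrite -{2}(posm_negm z); apply: lattice_ideal_gen; rewrite ?posm_negm //.
    exact: NN_sub Ep.
  exact: NN_sub En.
by rewrite -colonE => -[].
Qed.

Lemma M_emb_torsion : M_emb D I `<=` tc I.
Proof.
apply: ideal_gen_sub; first exact: tcI_ideal.
by move=> f [M [m [embM witM ->]]]; apply: embedded_torsion embM witM.
Qed.

(* Monomials equivalent to [X^u] after inverting [k[N^E]]. *)
Let C u : set 'X_{1..n} := [set v | exists a a',
  [/\ NN E a, NN E a' & similar I (a + u) (a' + v)%MM]].

Let C_saturated u : saturated_class I (C u).
Proof.
apply: saturated_classP => // v w vw _ [a [a' [Ea Ea' sim]]]; exists a, a'; split=> //.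
by apply: similar_trans sim _ => //; apply: similarMX.
Qed.

Let C_stable u a v : NN E a -> C u (a + v)%MM <-> C u v.
Proof.
move=> Ea; split=> [[c [c' [Ec Ec' sim]]]|[c [c' [Ec Ec' sim]]]].
  by exists c, (c' + a)%MM; split=> //; [apply/NN_add|rewrite -addmA].
exists (a + c)%MM, c'; split=> //; first exact/NN_add.
have -> : (c' + (a + v) = a + (c' + v))%MM by rewrite !addmA [(c' + a)%MM]addmC.
by rewrite -addmA; apply: similarMX.
Qed.

(** Each graded piece has rank at most one over k[N^E]: up to a monomial multiplier, [X^u] generates
    it. *)
Let C_normal u g : (forall v, v \in msupp g -> C u v) ->
  exists a b, [/\ NN E a, kN E b & I ('X_[a] * g - b * 'X_[u])].
Proof.
move=> Cg; pose good h := exists a b, [/\ NN E a, kN E b & I ('X_[a] * h - b * 'X_[u])].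
rewrite -/(good g) [g]mpolyE big_seq; apply: (big_ind good).
- exists 0%MM, 0; split; [exact: NN0|exact: kN0|].
  by rewrite mulr0 mul0r subrr; apply: ideal0.
- move=> x y [a [b [Ea Eb Ix]]] [a' [b' [Ea' Eb' Iy]]].
  exists (a + a')%MM, ('X_[a'] * b + 'X_[a] * b'); split.
  + exact/NN_add.
  + by apply: kND; apply: kNM => //; apply: kNX.
  have -> : 'X_[a + a'] * (x + y) - ('X_[a'] * b + 'X_[a] * b') * 'X_[u] =
     'X_[a'] * ('X_[a] * x - b * 'X_[u]) + 'X_[a] * ('X_[a'] * y - b' * 'X_[u])
     :> {mpoly k[n]} by rewrite mpolyXD; ring.
  by apply: ideal_add => //; apply: ideal_mull.
- move=> v /Cg[a [a' [Ea Ea' /(similar_sym idI)[c c0 Isim]]]].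
  exists a', (g@_v *: (c *: 'X_[a])); split=> //; first by do 2!apply: kNZ; apply: kNX.
  rewrite -scalerAr -!scalerAl -scalerBr -!mpolyXD.
  exact: ideal_scale.
Qed.

(** Classes are stable under k[N^E], so each graded part of [f] is torsion too. It is proportional
    to a monomial of [f], which is not torsion, so the factor vanishes and the part lies in [I]. *)
Lemma torsion_free_part f : tc I f -> (forall v, v \in msupp f -> ~ tc I 'X_[v]) -> I f.
Proof.
have [d] := ubnP (size (msupp f)); elim: d f => // d IHd f szf tf ntf.
case: (eqVneq f 0) => [->|fn0]; first exact: ideal0.
have uf := mlead_supp fn0; set u := mlead f in uf.
have [b [Eb b0 Ibf]] := tf; pose g := mproj (C u) f.
have Cuu : C u u by exists 0%MM, 0%MM; split; [exact: NN0|exact: NN0|exact: similar_refl].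
have Ibg : I (b * g).
  rewrite /g -mprojM; last by move=> a v /Eb Ea; apply: C_stable.
  exact: mproj_ideal binI (C_saturated u) Ibf.
have Ig : I g.
  have [v /mproj_msupp[_ Cv]//|a [b' [Ea Eb' Iag]]] := @C_normal u g.
  suff b'0 : b' = 0.
    move: Iag; rewrite b'0 mul0r subr0 mulrC; apply: (cellular_cancel cellI).
    exact: NN_sub Ea.
  apply/eqP; apply: contrapT => /negP b'0; case: (ntf u uf).
  exists (b * b'); split; [exact: kNM|by rewrite mulf_neq0|].
  have Ibag : I (b * ('X_[a] * g) - b * b' * 'X_[u]).
    by rewrite -mulrA -mulrBr; apply: ideal_mull.
  by apply/(ideal_equiv idI Ibag); rewrite mulrCA; apply: ideal_mull.
rewrite [f](mprojC (C u)) -/g; apply: ideal_add => //; apply: IHd.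
- apply: leq_trans (_ : (size (msupp f) <= d)%N); last by rewrite -ltnS.
  apply: (msupp_ltn _ uf) => [v /mproj_msupp[]//|].
  by apply/negP => /mproj_msupp[].
- rewrite mproj_setC; apply: ideal_sub tcI_ideal _ _ tf _; exact: tcI_sub Ig.
- by move=> v /mproj_msupp[/ntf].
Qed.

(** Split [f] into its torsion monomials, handled by witnesses, and the rest, which is torsion as a
    difference and hence in [I]. *)
Lemma idealD_M_emb : idealD I (M_emb D I) = tc I.
Proof.
apply/seteqP; split; first exact: idealD_sub tcI_ideal tcI_sub M_emb_torsion.
move=> f tf; pose T : set 'X_{1..n} := [set u | tc I 'X_[u]].
have idS : is_ideal (idealD I (M_emb D I)).
  by apply: idealD_ideal => //; apply: ideal_gen_ideal.
have tT : tc I (mproj T f).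
  by apply: ideal_supp tcI_ideal _ => u /mproj_msupp[].
rewrite [f](mprojC T); apply: ideal_add => //.
  by apply: ideal_supp => // u /mproj_msupp[_]; apply: torsion_witness.
apply: idealDl; first exact: ideal_gen_ideal.
apply: torsion_free_part => [|u /mproj_msupp[]//].
by rewrite mproj_setC; exact: ideal_sub tcI_ideal _ _ tf tT.
Qed.

End CellularTorsion.

Section CellularHull.
Variables (k : fieldType) (n : nat) (D E : {set 'I_n}) (I : set {mpoly k[n]}).
Variables (L : set 'rV[int]_n) (rho : 'rV[int]_n -> k).
Hypotheses (cellI : cellular D I) (binI : binomial_ideal I).
Hypotheses (chiI : cellular_character D I L rho) (trE : transverse D L E).
Implicit Types (f g a b c : {mpoly k[n]}) (u v m : 'X_{1..n}) (P : set {mpoly k[n]}).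

Let idI : is_ideal I. Proof. by case: cellI. Qed.

Notation tc := (torsion_closure (@kN k n E)).

Lemma variable_algebraic : exists2 d, (0 < d)%N & forall i, exists b c,
  [/\ kN E b, b != 0, kN E c, I (b * 'X_i ^+ d - c) & i \in D -> c != 0].
Proof.
suff /choice[d dP] : forall i, exists d, (0 < d)%N /\ exists b c,
  [/\ kN E b, b != 0, kN E c, I (b * 'X_i ^+ d - c) & i \in D -> c != 0].
  (* One exponent for all variables: raise each relation b x^d = c to the complementary power. *)
  exists (\prod_i d i)%N; first by rewrite prodn_gt0 // => i; case: (dP i).
  move=> i; have [_ [b [c [Eb b0 Ec Ibc c0]]]] := dP i.
  rewrite (bigD1 i) //=; set q := (\prod_(j | _) _)%N.
  exists (b ^+ q), (c ^+ q); split; try exact: kNXn.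
  - exact: expf_neq0.
  - by rewrite exprM -exprMn subrXX; apply: ideal_mulr.
  - by move/c0; apply: expf_neq0.
move=> i; case: (boolP (i \in D)) => Di; last first.
  have [_ _ _ /(_ i Di)[e Ie]] := cellI.
  exists e.+1; split=> //; exists 1, 0; split; rewrite ?oner_eq0 //; first exact: kN1.
    exact: kN0.
  by rewrite mul1r subr0 exprS; apply: ideal_mull.
have [ED _ [d d0 [z /(_ i Di)[Ez Lz]]]] := trE; exists d; split=> //.
exists 'X_[negm (z i)], (rho (mvec U_(i)%MM *+ d - z i) *: 'X_[posm (z i)]).
have [En Ep] := (NN_negm Ez, NN_posm Ez); have chi : partial_character D L rho by case: chiI.
split; [exact: kNX|exact: mpolyX_neq0|by apply: kNZ; apply: kNX| |]; last first.
  by move=> _; rewrite scaler_eq0 negb_or mpolyX_neq0 (character_neq0 chi).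
rewrite mpolyXn -mpolyXD.
have vecE : mvec (negm (z i) + U_(i) *+ d)%MM - mvec (posm (z i)) =
    mvec U_(i)%MM *+ d - z i.
  by rewrite mvecD mvecMn -{3}(posm_negm (z i)) opprB addrA [_ + mvec (negm _)]addrC.
have : lattice_ideal D L rho ('X_[negm (z i) + U_(i) *+ d]
    - rho (mvec (negm (z i) + U_(i) *+ d)%MM - mvec (posm (z i))) *: 'X_[posm (z i)]).
  apply: lattice_ideal_gen; rewrite ?vecE //; last exact: NN_sub Ep.
  by apply/NN_add; split; [apply: NN_sub En|apply: NN_muln; apply: NN_U].
rewrite vecE; have [_ <-] := chiI.
by case.
Qed.

(** For a variable of [D], the relation b x^d = c with c nonzero makes b x^(d-1) an inverse of x up
    to c. *)
Lemma mnm_invertible u : NN D u ->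
  exists t b, [/\ kN E b, b != 0 & I (t * 'X_[u] - b)].
Proof.
have [d d0 dP] := variable_algebraic; move=> Du; rewrite mpolyXE_id.
pose inv x := exists t b, [/\ kN E b, b != 0 & I (t * x - b)].
have invM x y : inv x -> inv y -> inv (x * y).
  move=> [t [b [Eb b0 Ix]]] [t' [b' [Eb' b0' Iy]]]; exists (t * t'), (b * b').
  split; [exact: kNM|by rewrite mulf_neq0|].
  have -> : t * t' * (x * y) - b * b' = t * x * (t' * y - b') + b' * (t * x - b).
    by ring.
  by apply: ideal_add => //; apply: ideal_mull.
have inv1 : inv 1.
  exists 1, 1; rewrite oner_eq0 mulr1 subrr; split=> //; first exact: kN1.
  exact: ideal0.
apply: (big_ind inv) => // i _.
case: (boolP (i \in D)) => [Di|/Du->]; last by rewrite expr0.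
elim: (u i) => [|e IHe]; first by rewrite expr0.
rewrite exprS; apply: invM => //.
have [b [c [Eb b0 Ec Ibc /(_ Di) c0]]] := dP i.
exists (b * 'X_i ^+ d.-1), c; split=> //.
by rewrite -mulrA -exprSr prednK.
Qed.

(** The generators are the monomials whose exponents all stay below the common exponent of
    [variable_algebraic]; higher powers are rewritten at the cost of a denominator in k[N^E]. *)
Lemma finite_over_transverse : exists (T : finType) (e : T -> {mpoly k[n]}),
  forall a, exists b (c : T -> {mpoly k[n]}),
    [/\ kN E b, b != 0, forall t, kN E (c t) & I (b * a - \sum_t c t * e t)].
Proof.
have [[//|d] _ dP] := variable_algebraic.
pose T := {ffun 'I_n -> 'I_d.+1}.
pose e (t : T) : {mpoly k[n]} := 'X_[[multinom (t i : nat) | i < n]].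
exists T, e.
pose S a := exists b (c : T -> {mpoly k[n]}),
    [/\ kN E b, b != 0, forall t, kN E (c t) & I (b * a - \sum_t c t * e t)].
rewrite -/(forall a, S a).
have Scong x y : I (x - y) -> S x -> S y.
  move=> Ixy [b [c [Eb b0 Ec Ix]]]; exists b, c; split=> //.
  apply: (ideal_trans idI _ Ix); rewrite -mulrBr; apply: ideal_mull => //.
  exact: ideal_subC.
have Scancel b x : kN E b -> b != 0 -> S (b * x) -> S x.
  move=> Eb b0 [b' [c [Eb' b0' Ec Ix]]]; exists (b' * b), c.
  by rewrite mulf_neq0 // -mulrA; split=> //; apply: kNM.
have Sscale b x : kN E b -> S x -> S (b * x).
  move=> Eb [b' [c [Eb' b0' Ec Ix]]]; exists b', (fun t => b * c t); split=> //.
    by move=> t; apply: kNM.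
  under eq_bigr do rewrite -mulrA.
  by rewrite -mulr_sumr mulrCA -mulrBr; apply: ideal_mull.
have S0 : S 0.
  exists 1, (fun=> 0); rewrite oner_eq0 mulr0 sub0r; split=> //; try by move=> *; apply: kN0.
    exact: kN1.
  by apply: ideal_opp => //; apply: ideal_sum => // t _ _; rewrite mul0r; apply: ideal0.
have SD x y : S x -> S y -> S (x + y).
  move=> [b [c [Eb b0 Ec Ix]]] [b' [c' [Eb' b0' Ec' Iy]]].
  exists (b * b'), (fun t => b' * c t + b * c' t); split.
  - exact: kNM.
  - by rewrite mulf_neq0.
  - by move=> t; apply: kND; apply: kNM.
  under eq_bigr do rewrite mulrDl -!mulrA.
  rewrite big_split /= -!mulr_sumr.
  set s := \sum_t _ in Ix *; set s' := \sum_t _ in Iy *.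
  have -> : b * b' * (x + y) - (b' * s + b * s') = b' * (b * x - s) + b * (b' * y - s').
    by ring.
  by apply: ideal_add => //; apply: ideal_mull.
have Se t : S (e t).
  exists 1, (fun t' => (t' == t)%:R); rewrite oner_eq0 mul1r (bigD1 t) //= eqxx mul1r.
  rewrite big1 ?addr0 ?subrr => [|t' /negbTE->]; last by rewrite mul0r.
  split=> //; [exact: kN1|by move=> t'; case: eqP => _; [apply: kN1|apply: kN0]|].
  exact: ideal0.
have SX i t : S ('X_i * e t).
  case: (ltnP (t i).+1 d.+1) => lti.
    have -> : 'X_i * e t = e [ffun j => if j == i then inord (t i).+1 else t j].
      rewrite /e -mpolyXD; congr 'X_[_]; apply/mnmP => j.
      rewrite mnmDE mnm1E !mnmE ffunE eq_sym; case: eqP => [->|_] //.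
      by rewrite inordK.
    exact: Se.
  (* The exponent of variable i reaches d+1, so its relation replaces that power by [c] and resets
     the exponent to 0. *)
  have [b [c [Eb b0 Ec Ibc _]]] := dP i; apply: (Scancel b) => //.
  pose t0 : T := [ffun j => if j == i then ord0 else t j].
  apply: Scong (Sscale c _ Ec (Se t0)).
  have -> : b * ('X_i * e t) = b * 'X_i ^+ d.+1 * e t0.
    rewrite -mulrA /e mpolyXn -!mpolyXD; congr (_ * 'X_[_]); apply/mnmP => j.
    rewrite !mnmDE mulmnE mnm1E !mnmE ffunE eq_sym; case: eqP => [->|_] //.
    by rewrite mul1n addn0 add1n; apply/eqP; rewrite eqn_leq lti ltn_ord.
  by rewrite -mulrBl; apply: ideal_mulr => //; apply: ideal_subC.
have SMX i x : S x -> S ('X_i * x).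
  move=> [b [c [Eb b0 Ec Ix]]]; apply: (Scancel b) => //.
  apply: (Scong ('X_i * \sum_t c t * e t)).
    rewrite mulrCA -mulrBr; apply: ideal_mull => //; exact: ideal_subC.
  rewrite mulr_sumr; apply: (big_ind S) => // t _.
  by rewrite mulrCA; apply: Sscale.
have S1 : S 1.
  rewrite (_ : 1 = e [ffun=> ord0]) //; rewrite /e -mpolyX0; congr 'X_[_].
  by apply/mnmP => j; rewrite mnm0E !mnmE ffunE.
have SMXm u : S 'X_[u].
  suff SM y : S y -> S ((\prod_(i < n) 'X_i ^+ u i) * y).
    by rewrite mpolyXE_id -[X in S X]mulr1; apply: SM.
  move: y; apply: (big_ind (fun x => forall y, S y -> S (x * y))) => [y|x x' Sx Sx' y Sy|i _].
  - by rewrite mul1r.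
  - by rewrite -mulrA; apply: Sx; apply: Sx'.
  elim: (u i) => [|j IHj] y Sy; first by rewrite expr0 mul1r.
  by rewrite exprS -mulrA; apply: SMX; apply: IHj.
move=> a; rewrite [a]mpolyE; apply: (big_ind S) => // u _.
rewrite -mul_mpolyC; apply: Sscale => //.
by rewrite -[_%:MP]mulr1 mul_mpolyC; apply: kNZ; apply: kN1.
Qed.

(** More powers of [a] than generators are linearly dependent over k[N^E] modulo [I]. This makes [a]
    algebraic modulo [P], and an algebraic element outside the prime divides a nonzero constant. *)
Lemma prime_transverse_divides P a :
    prime_ideal P -> I `<=` P -> (forall b, kN E b -> P b -> b = 0) -> ~ P a ->
  exists t b, [/\ kN E b, b != 0 & P (t * a - b)].
Proof.
move=> prP IP P0 Pa; have [idP _ prP'] := prP.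
have [T [e eP]] := finite_over_transverse.
have /choice[b /choice[c bcP]] := fun j : 'I_#|T|.+1 => eP (a ^+ j).
(* [beta] is a common denominator for all the powers and [beta' j] its cofactor; [beta] is outside
   [P], being nonzero in k[N^E]. *)
pose beta := \prod_j b j.
pose beta' j := \prod_(i | i != j) b i.
have EP (p : pred 'I_#|T|.+1) : kN E (\prod_(i | p i) b i).
  by apply: (big_ind (kN E)) => [||i _]; [apply: kN1|apply: kNM|case: (bcP i)].
have [||||q [Eq [i0 qi0] q0]] := @linear_dependence _ (@kN k n E) _ _ _ #|T|
  (fun j l => beta' j * c j (enum_val l)).
- exact: kN1.
- exact: kNB.
- exact: kNM.
- by move=> j l; apply: kNM; [apply: EP|case: (bcP j)].
have Irel : I (\sum_j q j * (beta * a ^+ j)).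
  have -> : \sum_j q j * (beta * a ^+ j) =
      \sum_j q j * beta' j * (b j * a ^+ j - \sum_t c j t * e t).
    have sum0 : \sum_j q j * beta' j * (\sum_t c j t * e t) = 0.
      under eq_bigr do rewrite mulr_sumr.
      rewrite exchange_big big1 //= => t _.
      under eq_bigr do rewrite -mulrA [beta' _ * (_ * _)]mulrA mulrA.
      rewrite -mulr_suml -[t]enum_rankK.
      by rewrite q0 mul0r.
    transitivity (\sum_j q j * (beta * a ^+ j) -
        \sum_j q j * beta' j * (\sum_t c j t * e t)); first by rewrite sum0 subr0.
    rewrite -sumrB; apply: eq_bigr => j _.
    by rewrite mulrBr /beta (bigD1 j) //= -/(beta' j); congr (_ - _); ring.
  by apply: ideal_sum => // j _ _; apply: ideal_mull => //; case: (bcP j).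
have Psum : P (\sum_j q j * a ^+ j).
  move: Irel; under eq_bigr do rewrite mulrCA.
  rewrite -mulr_sumr => /IP/prP'[Pbeta|//].
  have := P0 beta (EP predT) Pbeta => /eqP; rewrite prodf_seq_eq0 => /hasP[j _ /=].
  by case: (bcP j) => _ /negbTE->.
apply: (prime_divides_algebraic prP Pa (p := \poly_(j < #|T|.+1) q (inord j))).
- by move=> i; rewrite coef_poly; case: ifP => _; [apply: Eq|apply: kN0].
- by apply: contraNneq qi0 => /polyP/(_ i0); rewrite coef_poly ltn_ord inord_val coef0 => ->.
- by rewrite horner_poly; under eq_bigr do rewrite inord_val.
Qed.

(** Incomparability of primes: an element of [P'] outside [P] would divide, modulo [P], a nonzero
    element of k[N^E], which would then lie in [P']. *)
Lemma transverse_prime_minimal P P' :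
    prime_ideal P -> prime_ideal P' -> I `<=` P -> P `<=` P' ->
    (forall b, kN E b -> P' b -> b = 0) -> P = P'.
Proof.
move=> prP prP' IP PP' P'0; apply/seteqP; split=> // a P'a.
apply: contrapT => Pa; have [idP' _ _] := prP'.
have [b Eb /PP'|t [b [Eb b0 /PP' P'ab]]] := prime_transverse_divides prP IP _ Pa.
  exact: P'0.
case/eqP: b0; apply: P'0 => //; apply/(ideal_equiv idP' (ideal_subC idP' P'ab)).
exact: ideal_mull.
Qed.

(** An embedded witness is not the monomial 1, since 1 is not torsion. So it involves a variable
    outside [D] and is nilpotent modulo [I]. *)
Lemma torsion_closure_sub_prime P : prime_ideal P -> I `<=` P -> tc I `<=` P.
Proof.
move=> prP IP; rewrite -(idealD_M_emb cellI binI chiI trE); have [idP P1 _] := prP.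
apply: idealD_sub => //; apply: ideal_gen_sub => // _ [M [m [embM witM ->]]].
have [NNm _] := witM; apply: (prime_radical prP IP).
apply: (cellular_nilpotent cellI NNm).
apply/eqP => m0; have := embedded_torsion cellI chiI trE embM witM.
rewrite m0 mpolyX0 => -[b [Eb /eqP b0]]; rewrite mulr1 => Ib; apply: b0.
exact: cellular_transverse chiI trE _ Ib Eb.
Qed.

(* The prime components of [I] that meet [k[N^E]] only in [0] are exactly the
   minimal ones. *)
Lemma Hull_torsion_closure : Hull I = tc I.
Proof.
have [r [F decF]] := minimal_primary_decomposition_exists (@mpoly_acc k n) idI.
have [prF IF distF _] := decF.
have IFj j : I `<=` F j by rewrite IF => f; apply.
have IrF j : I `<=` radical (F j) by move=> f If; apply: radical_sub; apply: IFj.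
have prR j := primary_radical (prF j).
apply/seteqP; split=> [f Hf|f [b [Eb b0 Ibf]] Q [s [G [i [decG mini ->]]]]].
  have /choice[b bP] : forall j, exists b, [/\ kN E b, b != 0 & F j (b * f)].
    (* A component whose radical meets k[N^E] nontrivially absorbs [f] after multiplication by a
       power; any other one is minimal and contains [f] by assumption. *)
    move=> j; case: (pselect (exists b, [/\ kN E b, b != 0 & radical (F j) b])).
      move=> [b [Eb b0 [e Fb]]]; exists (b ^+ e); split; first exact: kNXn.
        exact: expf_neq0.
      by apply: ideal_mulr => //; case: (prF j).
    move=> nob; exists 1; rewrite oner_eq0 mul1r; split=> //; first exact: kN1.
    apply: Hf; exists r, F, j; split=> // i sub.
    apply: transverse_prime_minimal => // b Eb Fb.
    by apply/eqP; apply: contrapT => /negP b0; apply: nob; exists b.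
  exists (\prod_j b j); split.
  - by apply: (big_ind (kN E)) => [||j _]; [apply: kN1|apply: kNM|case: (bP j)].
  - by apply/prodf_neq0 => j _; case: (bP j).
  - rewrite IF => j _; rewrite (bigD1 j) //= [b j * _]mulrC -mulrA.
    by apply: ideal_mull; [case: (prF j)|case: (bP j)].
have [prG IG _ _] := decG; have idG j : is_ideal (G j) by case: (prG j).
have IGi : I `<=` radical (G i).
  by apply: subset_trans (@radical_sub _ _); rewrite IG => h; apply.
apply: (primary_cancel (prG i) (g := b)); last first.
  by rewrite mulrC; move: Ibf; rewrite IG; apply.
(* If b^e were in [G i], then b^e c would be in every component, so [c] would be torsion and lie in
   every prime over [I]. *)
move=> [e Gbe]; have [c Gc nGc] := minimal_component_cofactor decG mini.
apply: nGc; apply: (torsion_closure_sub_prime (primary_radical (prG i)) IGi).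
exists (b ^+ e); split; [exact: kNXn|exact: expf_neq0|].
rewrite IG => j _; case: (eqVneq j i) => [->|neji]; first exact: ideal_mulr.
by apply: ideal_mull => //; apply: Gc.
Qed.

End CellularHull.

Lemma Hull_idealD (k : fieldType) (n : nat) (D : {set 'I_n}) (I : set {mpoly k[n]}) :
  cellular D I -> binomial_ideal I -> Hull I = idealD I (M_emb D I).
Proof.
move=> cellI binI; have [L [rho chiI]] := cellular_character_exists cellI binI.
have [E trE] := transverse_exists (character_lattice (proj1 chiI)).
by rewrite (Hull_torsion_closure cellI binI chiI trE) (idealD_M_emb cellI binI chiI trE).
Qed.

Lemma idealD_gen (R : comNzRingType) (S T : set R) :
  idealD (ideal_gen S) (ideal_gen T) = ideal_gen (S `|` T).
Proof.
have [idS idT] := (ideal_gen_ideal S, ideal_gen_ideal T).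
have idST := ideal_gen_ideal (S `|` T).
apply/seteqP; split.
  apply: idealD_sub => //; apply: ideal_gen_sub => // f Sf J [_]; apply.
    by left.
  by right.
apply: ideal_gen_sub; first exact: idealD_ideal.
move=> f [Sf|Tf]; [apply: idealDl|apply: idealDr] => // J [_]; exact.
Qed.

Lemma binomial_Hull (k : fieldType) (n : nat) (D : {set 'I_n}) (I : set {mpoly k[n]}) :
  cellular D I -> binomial_ideal I -> binomial_ideal (Hull I).
Proof.
move=> cellI binI; rewrite (Hull_idealD cellI binI).
have [S [binS IE]] := binI; rewrite [X in idealD X]IE idealD_gen.
eexists; split; last by [].
move=> f [/binS//|[L [m [_ _ ->]]]].
by rewrite /Defs.binomial msuppX.
Qed.

(** * Characters over an algebraically closed field *)

Section CharacterExtension.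
Variables (k : fieldType) (n : nat).
Hypothesis closed : GRing.closed_field_axiom k.
Implicit Types (M L : set 'rV[int]_n) (w z v : 'rV[int]_n).
Implicit Types (sigma phi psi : 'rV[int]_n -> k).

Definition total_character phi : Prop := partial_character [set: 'I_n]%SET setT phi.

Lemma total_characterP phi : total_character phi <->
  (forall w, phi w != 0) /\ forall w z, phi (w + z) = phi w * phi z.
Proof.
split=> [[_ n0 phiD]|[n0 phiD]]; first by split=> [w|w z]; [apply: n0|apply: phiD].
by split=> //; split=> // w _ i; rewrite finset.in_setT.
Qed.

Lemma total_character_restrict D M phi :
  lattice D M -> total_character phi -> partial_character D M phi.
Proof. by move=> latM /total_characterP[n0 phiD]; split. Qed.

Lemma total_characterM phi psi : total_character phi -> total_character psi ->
  total_character (fun w => phi w * psi w).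
Proof.
move=> /total_characterP[n0 phiD] /total_characterP[m0 psiD].
apply/total_characterP; split=> [w|w z]; first by rewrite mulf_neq0.
by rewrite phiD psiD; ring.
Qed.

Lemma partial_characterT D M sigma :
  partial_character D M sigma -> partial_character [set: 'I_n]%SET M sigma.
Proof.
move=> [[_ M0 MB] n0 sD]; split=> //; split=> // w _ i.
by rewrite finset.in_setT.
Qed.

Lemma latticeT M D : lattice D M -> lattice [set: 'I_n]%SET M.
Proof. by case=> _ M0 MB; split=> // w _ i; rewrite finset.in_setT. Qed.

(** The compatibility on multiples of [v] lying in [M] makes sigma(l) a^d independent of the way l +
    d v is written. *)
Lemma character_adjoin M sigma v (a : k) :
    partial_character [set: 'I_n]%SET M sigma -> a != 0 ->
    (forall d : int, M (v *~ d) -> sigma (v *~ d) = a ^ d) ->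
  exists M' sigma', [/\ partial_character [set: 'I_n]%SET M' sigma', M `<=` M',
    forall w, M w -> sigma' w = sigma w, M' v & sigma' v = a].
Proof.
move=> chi a0 comp; have latM := character_lattice chi.
pose M' : set 'rV[int]_n := [set w | exists l (d : int), M l /\ w = l + v *~ d].
have /choice[sigma' sP] : forall w, exists c, M' w ->
    exists l (d : int), [/\ M l, w = l + v *~ d & c = sigma l * a ^ d].
  move=> w; case: (pselect (M' w)) => [[l [d [Ml wE]]]|nM]; last by exists 0.
  by exists (sigma l * a ^ d) => _; exists l, d.
have sE l (d : int) : M l -> sigma' (l + v *~ d) = sigma l * a ^ d.
  move=> Ml; have [|l' [d' [Ml' eqs ->]]] := sP (l + v *~ d); first by exists l, d.
  have vE : v *~ (d - d') = l' - l.
    rewrite mulrzBr; apply/eqP; rewrite subr_eq addrAC -eqs; apply/eqP.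
    by rewrite [l + _]addrC addrK.
  have Mv : M (v *~ (d - d')) by rewrite vE; apply: (lattice_sub latM).
  have l'E : l' = l + v *~ (d - d') by rewrite vE addrC subrK.
  by rewrite l'E (characterD chi) // comp // -mulrA -expfzDr // subrK.
have M'0 w : M w -> w = w + v *~ 0 by rewrite mulr0z addr0.
have v1 : v = 0 + v *~ 1 by rewrite add0r mulr1z.
exists M', sigma'; split.
- split.
  + split=> [w _ i||_ _ [l [d [Ml ->]]] [l' [d' [Ml' ->]]]].
    * by rewrite finset.in_setT.
    * by exists 0, 0; split; [apply: (lattice0 latM)|rewrite mulr0z addr0].
    * exists (l - l'), (d - d'); split; first exact: (lattice_sub latM).
      by rewrite mulrzBr opprD addrACA.
  + move=> _ [l [d [Ml ->]]]; rewrite sE // mulf_neq0 ?expfz_neq0 //.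
    exact: (character_neq0 chi).
  + move=> _ _ [l [d [Ml ->]]] [l' [d' [Ml' ->]]].
    rewrite addrACA -mulrzDr !sE //; last exact: (lattice_add latM).
    by rewrite (characterD chi) // expfzDr //; ring.
- by move=> w Mw; exists w, 0; rewrite mulr0z addr0.
- by move=> w Mw; rewrite (M'0 w Mw) sE // expr0z mulr1 mulr0z addr0.
- by exists 0, 1; split; [apply: (lattice0 latM)|].
- by rewrite {1}v1 sE ?(character0 chi) ?mul1r ?expr1z //; apply: (lattice0 latM).
Qed.

(* Exponents [d] with [M (v *~ d)] are the multiples of the order of [v]. *)
Lemma character_order M sigma v (a : k) (m : nat) :
    partial_character [set: 'I_n]%SET M sigma -> (0 < m)%N -> M (v *+ m) ->
    (forall d, (0 < d)%N -> M (v *+ d) -> (m <= d)%N) ->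
    a ^+ m = sigma (v *+ m) ->
  forall d : int, M (v *~ d) -> sigma (v *~ d) = a ^ d.
Proof.
move=> chi m0 Mm minm aE d Md; have latM := character_lattice chi.
have dE := divz_eq d m; set q := (d %/ m)%Z in dE.
have rm : (d %% m)%Z < m by rewrite ltz_pmod.
have r0 : 0 <= (d %% m)%Z by rewrite modz_ge0 // eqz_nat -lt0n.
have vE : v *~ d = v *+ m *~ q + v *~ (d %% m)%Z.
  by rewrite {1}dE mulrzDr mulrC mulrzA -pmulrn.
have Mr : M (v *~ (d %% m)%Z).
  rewrite -(addKr (v *+ m *~ q) (v *~ (d %% m)%Z)) -vE addrC.
  by apply: (lattice_sub latM) => //; apply: (lattice_mulz latM).
have r_eq0 : (d %% m)%Z = 0.
  case: (d %% m)%Z r0 rm Mr => // r _; rewrite ltz_nat => ltrm.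
  rewrite -pmulrn => Mr; case: r => // r in ltrm Mr *.
  by have := minm _ (ltn0Sn r) Mr; rewrite leqNgt ltrm.
rewrite vE r_eq0 mulr0z addr0 (characterMz chi) // -aE.
by rewrite dE r_eq0 addr0 mulrC -exprz_exp.
Qed.

Lemma minimal_order M v d : (0 < d)%N -> M (v *+ d) ->
  exists m, [/\ (0 < m)%N, M (v *+ m)
              & forall d', (0 < d')%N -> M (v *+ d') -> (m <= d')%N].
Proof.
move=> d0 Md; have exm : exists m, (0 < m)%N && `[< M (v *+ m) >].
  by exists d; rewrite d0; apply/asboolP.
case: (ex_minnP exm) => m /andP[m0 /asboolP Mm] minm; exists m; split=> // d' d'0 Md'.
by apply: minm; rewrite d'0; apply/asboolP.
Qed.

Lemma closed_root (c : k) m : (0 < m)%N -> exists a, a ^+ m = c.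
Proof.
move=> m0; have [a aE] := closed (fun i => if i == 0%N then c else 0) m0.
exists a; rewrite aE; case: m m0 {aE} => // m _.
rewrite big_ord_recl /= expr0 mulr1 big1 ?addr0 // => i _.
by rewrite mul0r.
Qed.

(** Take a root of 1 + X + ... + X^(m-1); it differs from 1 because at 1 this polynomial takes the
    value m. *)
Lemma closed_unity_root m : (1 < m)%N -> m%:R != 0 :> k ->
  exists2 a : k, a ^+ m = 1 & a != 1.
Proof.
case: m => [|[|m]] // _ m0.
have [a aE] := closed (fun=> -1) (ltn0Sn m).
have sum0 : \sum_(i < m.+2) a ^+ i = 0.
  rewrite big_ord_recr /= aE -mulr_sumr mulN1r.
  exact: subrr.
exists a; first by apply/eqP; rewrite -subr_eq0 subrX1 sum0 mulr0.
apply: contraNneq m0 => a1; rewrite -sum0 a1.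
by under eq_bigr do rewrite expr1n; rewrite big_const_ord iter_addr_0.
Qed.

Lemma character_adjoin_exists M sigma v :
    partial_character [set: 'I_n]%SET M sigma ->
  exists M' sigma', [/\ partial_character [set: 'I_n]%SET M' sigma', M `<=` M',
    forall w, M w -> sigma' w = sigma w & M' v].
Proof.
move=> chi; have latM := character_lattice chi.
suff [a a0 comp] : exists2 a, a != 0 &
    forall d : int, M (v *~ d) -> sigma (v *~ d) = a ^ d.
  by have [M' [sigma' [? ? ? ? _]]] := character_adjoin chi a0 comp; exists M', sigma'.
case: (pselect (exists2 d, (0 < d)%N & M (v *+ d))) => [[d d0 Md]|nod].
  have [m [m0 Mm minm]] := minimal_order d0 Md.
  have [a aE] := closed_root (sigma (v *+ m)) m0.
  exists a; last exact: character_order chi m0 Mm minm aE.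
  apply: contraNneq (character_neq0 chi Mm) => a0.
  by rewrite -aE a0 expr0n eqn0Ngt m0.
(* Here [v] has infinite order modulo [M], so compatibility concerns only d = 0 and the value 1 is
   admissible. *)
exists 1; first exact: oner_neq0.
move=> d Md; rewrite exp1rz.
suff -> : d = 0 by rewrite mulr0z (character0 chi).
apply/eqP; apply: contrapT => /negP d0; apply: nod; case: d d0 Md => d d0 Md.
  by exists d; rewrite // lt0n.
exists d.+1 => //; rewrite -[_ *+ _]opprK; apply: (lattice_opp latM).
by move: Md; rewrite NegzE mulrNz.
Qed.

Lemma character_extension D M sigma : partial_character D M sigma ->
  exists2 phi, total_character phi & forall w, M w -> phi w = sigma w.
Proof.
move=> /partial_characterT chi.
have ext (s : seq 'I_n) : exists M' sigma',
    [/\ partial_character [set: 'I_n]%SET M' sigma', M `<=` M',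
    forall w, M w -> sigma' w = sigma w & forall i, i \in s -> M' (mvec U_(i)%MM)].
  elim: s => [|i s [M' [sigma' [chi' MM' eqs Ms]]]]; first by exists M, sigma; split=> // w.
  have [M'' [sigma'' [chi'' MM'' eqs'' Mi]]] :=
    character_adjoin_exists (mvec U_(i)%MM) chi'.
  exists M'', sigma''; split=> //.
  - exact: subset_trans MM''.
  - by move=> w Mw; rewrite eqs'' ?eqs //; apply: MM'.
  - by move=> j; rewrite inE => /predU1P[->//|/Ms/MM''].
have [M' [phi [chi' _ eqs Ms]]] := ext (enum 'I_n).
have latM' := character_lattice chi'.
have M'T w : M' w.
  have -> : w = \sum_i mvec U_(i)%MM *~ w 0 i.
    apply/rowP => j; rewrite summxE (bigD1 j) //= big1 => [|i neij].
      by rewrite addr0 -scale_int mxE mvecE mnm1E eqxx mulr1.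
    by rewrite -scale_int mxE mvecE mnm1E (negbTE neij) mulr0.
  apply: (lattice_sum latM') => i; apply: (lattice_mulz latM'); apply: Ms.
  by rewrite mem_enum.
exists phi => //; apply/total_characterP; split=> [w|w z].
  exact: (character_neq0 chi').
exact: (characterD chi').
Qed.

(** The order of [v] modulo [M] divides [d], hence is nonzero in [k]; send [M] to 1 and [v] to a
    nontrivial root of unity of that order, then extend. *)
Lemma character_separation D M v d :
    lattice D M -> ~ M v -> (0 < d)%N -> d%:R != 0 :> k -> M (v *+ d) ->
  exists phi, [/\ total_character phi, forall w, M w -> phi w = 1 & phi v != 1].
Proof.
move=> /latticeT latM nMv d0 dk0 Md; have [m [m0 Mm minm]] := minimal_order d0 Md.
have chi : partial_character [set: 'I_n]%SET M (fun=> 1 : k).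
  by split=> // *; rewrite ?oner_eq0 ?mulr1.
have dvd : (m %| d)%N.
  apply/dvdnP; exists (d %/ m)%N; rewrite {1}(divn_eq d m).
  case: (posnP (d %% m)) => [->|r0]; first by rewrite addn0.
  have /(minm _ r0) : M (v *+ (d %% m)).
    rewrite -(addKr (v *+ (d %/ m * m)) (v *+ (d %% m))) -mulrnDr -divn_eq addrC.
    apply: (lattice_sub latM) => //.
    by rewrite mulnC mulrnA; apply: (lattice_muln latM).
  by rewrite leqNgt ltn_mod m0.
have m1 : (1 < m)%N.
  by case: m m0 Mm {minm dvd} => [|[|m]] // _; rewrite mulr1n.
have mk0 : m%:R != 0 :> k.
  by apply: contraNneq dk0 => mk0; case/dvdnP: dvd => q ->; rewrite natrM mk0 mulr0.
have [a aE a1] := closed_unity_root m1 mk0.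
have a0 : a != 0.
  by apply: contra_eq_neq aE => ->; rewrite expr0n eqn0Ngt m0 eq_sym oner_neq0.
have comp := character_order chi m0 Mm minm aE.
have [M' [sigma' [chi' MM' eqs M'v sv]]] := character_adjoin chi a0 comp.
have [phi tot eqphi] := character_extension chi'.
exists phi; split=> // [w Mw|]; first by rewrite eqphi ?eqs //; apply: MM'.
by rewrite eqphi // sv.
Qed.

(* Killing, one monomial at a time, those of [f] congruent to [w] modulo [M] but
   not modulo [L]. *)
Lemma lattice_ideal_bigcap D L M rho (g : nat) (rho_ : 'I_g -> 'rV[int]_n -> k) f :
    partial_character D L rho -> lattice D M -> L `<=` M ->
    (forall w, M w -> exists d, [/\ (0 < d)%N, d%:R != 0 :> k & L (w *+ d)]) ->
    character_extensions D L rho M rho_ ->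
    kN D f -> (forall l, lattice_ideal D M (rho_ l) f) ->
  lattice_ideal D L rho f.
Proof.
move=> chi latM LM torsM [ext _ allext] Df If; have latL := character_lattice chi.
have [phi0 tot0 eq0] := character_extension chi.
apply/(lattice_idealP chi); split=> // w.
pose W u := mvec u - w.
pose trivial psi := total_character psi /\ forall z, L z -> psi z = 1.
(* Twisting [phi0] by a character trivial on [L] again extends [rho], so it agrees on [M] with some
   [rho_ l], whose coset sum at [w] vanishes. *)
have sum0 psi : trivial psi ->
    \sum_(u <- msupp f | `[< M (W u) >]) f@_u * (phi0 (W u) * psi (W u)) = 0.
  move=> [totpsi psi1]; have totM := total_characterM tot0 totpsi.
  have [l eql] := allext _ (total_character_restrict latM totM)
    (fun z Lz => etrans (congr2 *%R (eq0 z Lz) (psi1 z Lz)) (mulr1 _)).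
  have [chil _] := ext l; transitivity (coset_sum M (rho_ l) w f).
    rewrite /coset_sum /mlin [LHS]big_mkcond; apply: eq_bigr => u _.
    by case: asboolP => Mu; [rewrite (eql _ Mu)|rewrite scaler0].
  by rewrite (lattice_ideal_coset_sum chil).
have trivM psi psi' : trivial psi -> trivial psi' -> trivial (fun z => psi z * psi' z).
  move=> [t1 p1] [t2 p2]; split; first exact: total_characterM.
  by move=> z Lz; rewrite p1 ?p2 ?mulr1.
have triv1 : trivial (fun=> 1).
  by split=> //; apply/total_characterP; split=> *; rewrite ?oner_eq0 ?mulr1.
have /choice[psi psiP] : forall u, exists psi, M (W u) /\ ~ L (W u) ->
    trivial psi /\ psi (W u) != 1.
  move=> u; case: (pselect (M (W u) /\ ~ L (W u))) => [[Mu nLu]|no].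
    have [d [d0 dk0 Ld]] := torsM _ Mu.
    by have [psi [? ? ?]] := character_separation latL nLu d0 dk0 Ld; exists psi.
  by exists (fun=> 1).
(* Expanded, this is a combination of trivial characters, so the weighted sum still vanishes. It is
   0 at each u in s, and for s = [bad] it equals the nonzero constant [K] wherever [W u] is in
   [L]. *)
pose kill s u := \prod_(v <- s) (psi v (W u) - psi v (W v)).
have sum_kill s : {in s, forall u, M (W u) /\ ~ L (W u)} -> forall psi', trivial psi' ->
    \sum_(u <- msupp f | `[< M (W u) >]) f@_u * (phi0 (W u) * psi' (W u)) * kill s u = 0.
  elim: s => [|v s IHs] bad psi' triv'.
    by rewrite -[RHS](sum0 _ triv'); apply: eq_bigr => u _; rewrite /kill big_nil mulr1.
  have bads : {in s, forall u, M (W u) /\ ~ L (W u)}.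
    by move=> u us; apply: bad; rewrite inE us orbT.
  have [trivv _] := psiP v (bad v (mem_head v s)).
  have IHv := IHs bads _ (trivM _ _ triv' trivv).
  have IH := IHs bads _ triv'.
  transitivity
    (\sum_(u <- msupp f | `[< M (W u) >])
       f@_u * (phi0 (W u) * (psi' (W u) * psi v (W u))) * kill s u
     - psi v (W v) * \sum_(u <- msupp f | `[< M (W u) >])
         f@_u * (phi0 (W u) * psi' (W u)) * kill s u); last by rewrite IHv IH mulr0 subr0.
  rewrite mulr_sumr -sumrB; apply: eq_bigr => u _.
  by rewrite /kill big_cons; ring.
pose bad := [seq u <- msupp f | `[< M (W u) >] && ~~ `[< L (W u) >]].
have badP : {in bad, forall u, M (W u) /\ ~ L (W u)}.
  by move=> u; rewrite mem_filter => /andP[/andP[/asboolP Mu /asboolPn nLu] _].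
pose K := \prod_(v <- bad) (1 - psi v (W v)).
have K0 : K != 0.
  rewrite /K prodf_seq_neq0; apply/allP => v vb /=; rewrite subr_eq0 eq_sym.
  by case: (psiP v (badP v vb)).
apply: (mulfI K0); rewrite mulr0 -[RHS](sum_kill bad badP _ triv1).
rewrite /coset_sum /mlin mulr_sumr [RHS]big_mkcond; apply: eq_big_seq => u uf.
case: asboolP => Lu.
  rewrite asboolT; last exact: LM.
  rewrite mulr1 eq0 // mulrC; congr (_ * _); apply: eq_big_seq => v vb.
  by have [[_ psi1] _] := psiP v (badP v vb); rewrite (psi1 (W u)).
rewrite scaler0 mulr0; case: asboolP => // Mu.
suff -> : kill bad u = 0 by rewrite mulr0.
apply/eqP; rewrite prodf_seq_eq0; apply/hasP; exists u; last by rewrite subrr eqxx.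
by rewrite mem_filter uf andbT; apply/andP; split; [apply/asboolP|apply/asboolPn].
Qed.

End CharacterExtension.

(** * The coprime saturation *)

Section CoprimeSaturation.
Variables (n : nat) (D : {set 'I_n}).
Implicit Types (L M : set 'rV[int]_n) (w : 'rV[int]_n).

Lemma lattice_Sat L : lattice D L -> lattice D (Sat D L).
Proof.
move=> latL; split=> [w /(SatP _ latL)[]//||w z].
  apply/(SatP _ latL); split; first exact: (lattice0 (lattice_ZZ D)).
  by exists 1%N => //; rewrite mul0rn; apply: (lattice0 latL).
move=> /(SatP _ latL)[Dw [N N0 Lw]] /(SatP _ latL)[Dz [N' N'0 Lz]].
apply/(SatP _ latL); split; first exact: (lattice_sub (lattice_ZZ D)).
exists (N * N')%N; first by rewrite muln_gt0 N0.
rewrite mulrnBl; apply: (lattice_sub latL).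
  by rewrite mulrnA; apply: (lattice_muln latL).
by rewrite mulnC mulrnA; apply: (lattice_muln latL).
Qed.

Lemma Sat_sub L : lattice D L -> L `<=` Sat D L.
Proof.
move=> latL w Lw; apply/(SatP _ latL); split; first exact: (lattice_sub_ZZ latL).
by exists 1%N.
Qed.

(* Translation by [w] permutes the classes; compare the sums of all classes. *)
Lemma lattice_index_muln L M g w :
  lattice D L -> lattice D M -> lattice_index M L g -> M w -> L (w *+ g).
Proof.
move=> latL latM [t [Mt uniqt]] Mw.
have /choice[pi piP] : forall i, exists j, L (t i + w - t j).
  by move=> i; have [|j [Lj _]] := uniqt (t i + w); [apply: (lattice_add latM)|exists j].
have inj_pi : injective pi.
  move=> i i' eqpi; have [j [_ uniqj]] := uniqt (t i) (Mt i).
  rewrite -(uniqj i) ?subrr; last exact: (lattice0 latL).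
  apply: uniqj; have := lattice_sub latL (piP i) (piP i').
  by rewrite eqpi opprB addrA subrK [t i' + w]addrC addrKA.
have -> : w *+ g = \sum_i (t i + w - t (pi i)).
  rewrite sumrB big_split /= sumr_const card_ord [X in _ = _ - X](_ : _ = \sum_i t i).
    by rewrite addrAC subrr add0r.
  by rewrite [RHS](reindex_inj inj_pi).
exact: (lattice_sum latL).
Qed.

(** Adjoining [w] multiplies the index by the order h of [w] modulo [M], a divisor of [m];
    representatives are t_i + j w with j < h. Against the maximality of [Satp] this forces [w] into
    it. *)
Lemma coprime_extension_adjoin p L M w m : prime p -> lattice D L ->
  coprime_extension D p L M -> ZZ D w -> (0 < m)%N -> coprime m p -> L (w *+ m) ->
  exists2 M', coprime_extension D p L M' & M' w.
Proof.
move=> pr_p latL [latM LM MS [g [t [Mt uniqt]] copg]] Dw m0 copm Lm.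
have [h [h0 Mh minh]] := minimal_order m0 (LM _ Lm).
have hm : (h %| m)%N.
  apply/dvdnP; exists (m %/ h)%N; rewrite {1}(divn_eq m h).
  case: (posnP (m %% h)) => [->|r0]; first by rewrite addn0.
  have /(minh _ r0) : M (w *+ (m %% h)).
    rewrite -(addKr (w *+ (m %/ h * h)) (w *+ (m %% h))) -mulrnDr -divn_eq addrC.
    apply: (lattice_sub latM); first exact: LM.
    by rewrite mulnC mulrnA; apply: (lattice_muln latM).
  by rewrite leqNgt ltn_mod h0.
pose M' : set 'rV[int]_n := [set z | exists y (d : int), M y /\ z = y + w *~ d].
have latM' : lattice D M'.
  split=> [_ [y [d [My ->]]]||_ _ [y [d [My ->]]] [y' [d' [My' ->]]]].
  - apply: (lattice_add (lattice_ZZ D)); first exact: (lattice_sub_ZZ latM).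
    exact: (lattice_mulz (lattice_ZZ D)).
  - by exists 0, 0; rewrite mulr0z addr0; split=> //; apply: (lattice0 latM).
  - exists (y - y'), (d - d'); split; first exact: (lattice_sub latM).
    by rewrite mulrzBr opprD addrACA.
have MM' : M `<=` M' by move=> y My; exists y, 0; rewrite mulr0z addr0.
exists M'; last by exists 0, 1; rewrite add0r; split=> //; apply: (lattice0 latM).
split=> //; first exact: subset_trans MM'.
  have latS := lattice_Sat latL.
  move=> _ [y [d [My ->]]]; apply: (lattice_add latS); first exact: MS.
  apply: (lattice_mulz latS); apply/(SatP _ latL); split=> //.
  by exists m.
exists #|{: 'I_g * 'I_h}|; last first.
  by rewrite card_prod !card_ord coprimeMl copg (coprime_dvdl hm).
exists (fun x : 'I_#|{: 'I_g * 'I_h}| =>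
  t (enum_val x).1 + w *+ nat_of_ord (enum_val x).2); split=> [x|z].
  by exists (t (enum_val x).1), (nat_of_ord (enum_val x).2)%:Z; rewrite -pmulrn.
move=> [y [d [My zE]]].
have r0 : 0 <= (d %% h)%Z by rewrite modz_ge0 // eqz_nat -lt0n.
have rh : (d %% h)%Z < h by rewrite ltz_pmod.
have [j jE] : exists j : 'I_h, (d %% h)%Z = j :> int.
  case: (d %% h)%Z r0 rh => // r _; rewrite ltz_nat => ltr.
  by exists (Ordinal ltr).
have wd : w *~ d = w *+ h *~ (d %/ h)%Z + w *+ j.
  by rewrite {1}(divz_eq d h) mulrzDr mulrC mulrzA -pmulrn jE -pmulrn.
(* Euclidean division of d by h: the multiple of h w is absorbed into [M]. *)
pose y' := y + w *+ h *~ (d %/ h)%Z.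
have My' : M y' by apply: (lattice_add latM) => //; apply: (lattice_mulz latM).
have zE' : z = y' + w *+ j by rewrite zE wd addrA.
have [i [Li uniqi]] := uniqt y' My'.
exists (enum_rank (i, j)); split=> [|x Lx].
  by rewrite enum_rankK /= zE' opprD addrACA subrr addr0.
apply: enum_val_inj; rewrite enum_rankK; case: (enum_val x) Lx => i' j' /=.
rewrite zE' opprD addrACA => Lx.
have Mw : M (w *+ j - w *+ j').
  rewrite -(addKr (y' - t i') (_ - _)) addrC; apply: (lattice_sub latM); first exact: LM.
  by apply: (lattice_sub latM).
have jj' : j = j'.
  apply: ord_inj; apply/eqP; rewrite eqn_leq.
  have small (a b : 'I_h) : M (w *+ a - w *+ b) -> (a <= b)%N.
    move=> Mab; rewrite leqNgt; apply/negP => ltba.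
    have : (h <= a - b)%N.
      by apply: minh; [rewrite subn_gt0|rewrite mulrnBr // ltnW].
    by rewrite leqNgt (leq_ltn_trans (leq_subr _ _)).
  by rewrite !small //; apply: (lattice_subC latM).
by rewrite jj' in Lx *; rewrite subrr addr0 in Lx; rewrite (uniqi _ Lx).
Qed.

End CoprimeSaturation.

Section Satp.
Variables (k : fieldType) (n : nat) (D : {set 'I_n}) (p : nat).
Variables (L M : set 'rV[int]_n).
Hypotheses (char_p : has_characteristic k p) (latL : lattice D L).
Hypothesis satM : is_Satp D p L M.

Lemma Satp_lattice : [/\ lattice D M, L `<=` M & M `<=` Sat D L].
Proof.
move: satM; rewrite /is_Satp; case: eqP => [_ ->|_ [[latM LM MS _] _]]; last by [].
by split; [apply: lattice_Sat|apply: Sat_sub|].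
Qed.

Lemma Satp_torsion w : M w -> exists d, [/\ (0 < d)%N, d%:R != 0 :> k & L (w *+ d)].
Proof.
move: satM char_p; rewrite /is_Satp /has_characteristic; case: eqP => _.
  move=> -> /pcharf0P char0 /(SatP _ latL)[_ [N N0 LN]].
  by exists N; rewrite char0 -lt0n.
move=> [[latM LM MS [g idxg copg]] _] pk Mw; exists g.
have p_pr := pcharf_prime pk.
have g0 : (0 < g)%N.
  rewrite lt0n; apply: contraTneq copg => ->; rewrite /coprime gcd0n.
  by case: (p) p_pr => [|[]].
rewrite -(dvdn_pcharf pk) -prime_coprime // coprime_sym; split=> //.
exact: (lattice_index_muln latL latM idxg Mw).
Qed.

(** If N w is in [L], take for q the p-part of N: a multiple of q w prime to p is in [L], so
    maximality puts q w in [M], and the q-th power map is a Frobenius power. In characteristic 0, q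
    = 1. *)
Lemma Satp_radical w : Sat D L w -> exists q, [/\ (0 < q)%N, M (w *+ q)
  & forall x y : {mpoly k[n]}, (x - y) ^+ q = x ^+ q - y ^+ q].
Proof.
move: satM char_p; rewrite /is_Satp /has_characteristic; case: eqP => _.
  by move=> -> _ Sw; exists 1%N.
move=> [[latM LM MS idx] maxM] pk /(SatP _ latL)[Dw [N N0 LN]].
have p_pr := pcharf_prime pk; pose q := (p ^ logn p N)%N.
have q0 : (0 < q)%N by rewrite expn_gt0 prime_gt0.
exists q; split=> // [|x y].
  have Lm : L (w *+ q *+ N`_p^') by rewrite -mulrnA /q -p_part partnC.
  have cop : coprime N`_p^' p.
    by rewrite coprime_sym prime_coprime // -p'natE ?part_pnat.
  have Dwq : ZZ D (w *+ q) by apply: (lattice_muln (lattice_ZZ D)).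
  have ext : coprime_extension D p L M by split.
  have [M' extM' M'w] :=
    coprime_extension_adjoin p_pr latL ext Dwq (part_gt0 _ _) cop Lm.
  exact: maxM extM' _ M'w.
have pR : p \in [pchar {mpoly k[n]}] by rewrite (rmorph_pchar (mpolyC n (R := k))).
have pq : [pchar {mpoly k[n]}].-nat q.
  by rewrite pnatX pnatE // pR.
by rewrite exprDn_pchar // exprNn_pchar.
Qed.

End Satp.

(** * The prime of a character *)

Section CharacterPrime.
Variables (k : fieldType) (n : nat) (D E : {set 'I_n}) (L : set 'rV[int]_n).
Variables (phi : 'rV[int]_n -> k) (d : nat) (wt : 'rV[int]_n -> 'rV[int]_n).
Hypotheses (latL : lattice D L) (trE : transverse D L E) (tot : total_character phi).
Hypotheses (d0 : (0 < d)%N) (wtD : forall w z, wt (w + z) = wt w + wt z).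
Hypothesis wtP : forall w, ZZ D w -> ZZ E (wt w) /\ L (w *+ d - wt w).
Implicit Types (f g : {mpoly k[n]}) (u v : 'X_{1..n}) (w c : 'rV[int]_n).

Let phi_n0 w : phi w != 0.
Proof. by case: (total_characterP phi).1. Qed.

Let phiD w z : phi (w + z) = phi w * phi z.
Proof. by case: ((total_characterP phi).1 tot) => _; apply. Qed.

Let wt0 : wt 0 = 0.
Proof. by apply: (addrI (wt 0)); rewrite -wtD !addr0. Qed.

Let wtN w : wt (- w) = - wt w.
Proof. by apply: (addrI (wt w)); rewrite -wtD !subrr. Qed.

Lemma weight_eq0P w : ZZ D w -> wt w = 0 <-> Sat D L w.
Proof.
move=> Dw; have [Ew Lw] := wtP Dw; split=> [w0|/(SatP _ latL)[_ [N N0 LN]]].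
  by apply/(SatP _ latL); split=> //; exists d; rewrite // -[_ *+ _]subr0 -w0.
have [_ indE _] := trE; apply: (muln_eq0_rV N0); apply: indE.
  rewrite -(subKr (w *+ d *+ N) (wt w *+ N)) -mulrnBl; apply: (lattice_sub latL).
    by rewrite mulrnAC; apply: (lattice_muln latL).
  exact: (lattice_muln latL).
exact: (lattice_muln (lattice_ZZ E)).
Qed.

(** The coefficient at t^c of the image of [f] under the map sending X^u to phi(u) t^(wt u) for u in
    N^D and to 0 otherwise. On Z^D the kernel of [wt] is Sat(L), so [wt] embeds Z^D / Sat(L) in
    Z^E. *)
Definition weight_sum c f : k :=
  mlin (fun u => (if `[< NN D u >] && (wt (mvec u) == c)
                  then phi (mvec u) else 0) : k^o) f.

Lemma weight_sumB c f g : weight_sum c (f - g) = weight_sum c f - weight_sum c g.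
Proof. by rewrite /weight_sum linearB. Qed.

Lemma weight_sumD c f g : weight_sum c (f + g) = weight_sum c f + weight_sum c g.
Proof. by rewrite /weight_sum linearD. Qed.

Lemma weight_sumZ c a f : weight_sum c (a *: f) = a * weight_sum c f.
Proof. by rewrite /weight_sum linearZ. Qed.

Lemma weight_sumX c u : weight_sum c 'X_[u] =
  if `[< NN D u >] && (wt (mvec u) == c) then phi (mvec u) else 0.
Proof. by rewrite /weight_sum mlinX. Qed.

Lemma weight_sumMX c u f : weight_sum c ('X_[u] * f) =
  (if `[< NN D u >] then phi (mvec u) else 0) * weight_sum (c - wt (mvec u)) f.
Proof.
rewrite /weight_sum mlinMX /mlin mulr_sumr; apply: eq_bigr => v _.
rewrite mvecD wtD phiD.
have -> : `[< NN D (u + v)%MM >] = `[< NN D u >] && `[< NN D v >].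
  by rewrite -asbool_and; apply: asbool_equiv_eq; apply: NN_add.
have -> : (wt (mvec u) + wt (mvec v) == c) = (wt (mvec v) == c - wt (mvec u)).
  by rewrite [RHS]eq_sym subr_eq addrC eq_sym.
case: asboolP => _ /=; last by rewrite mul0r scaler0.
by case: ifP => _; rewrite ?scaler0 ?mulr0 // -[LHS]mulrCA.
Qed.

Definition character_prime : set {mpoly k[n]} := [set f | forall c, weight_sum c f = 0].

Lemma character_prime_ideal : is_ideal character_prime.
Proof.
split=> // [c|f g Pf Pg c|a f _ Pf c].
- by rewrite /weight_sum linear0.
- by rewrite weight_sumD Pf Pg addr0.
rewrite [a]mpolyE mulr_suml.
apply: (big_ind (fun x => weight_sum c x = 0)) => [|x y x0 y0|u _].
- by rewrite /weight_sum linear0.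
- by rewrite weight_sumD x0 y0 addr0.
- by rewrite -scalerAl weight_sumZ weight_sumMX Pf !mulr0.
Qed.

Lemma character_primeX0 u : ~ NN D u -> character_prime 'X_[u].
Proof. by move=> nDu c; rewrite weight_sumX asboolF. Qed.

Lemma character_primeX u : NN D u -> ~ character_prime 'X_[u].
Proof.
move=> Du /(_ (wt (mvec u))); rewrite weight_sumX asboolT // eqxx => /eqP.
by rewrite (negbTE (phi_n0 _)).
Qed.

(* Polynomials whose exponents are the weights shifted by [N]; [N] makes all the
   exponents occurring in [f] nonnegative. *)
Let shift (N : nat) w : 'X_{1..n} := [multinom absz (w 0 i + N%:Z)%R | i < n].
Let nonneg N w := forall i, 0 <= w 0 i + N%:Z.

Let shiftD N N' w w' : nonneg N w -> nonneg N' w' ->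
  shift (N + N')%N (w + w') = (shift N w + shift N' w')%MM.
Proof.
move=> nw nw'; apply/mnmP => i; rewrite mnmDE !mnmE mxE PoszD addrACA.
by have := nw i; have := nw' i; case: (w 0 i + N) => // a; case: (w' 0 i + N') => // b.
Qed.

Let shift_inj N w w' : nonneg N w -> nonneg N w' -> shift N w = shift N w' -> w = w'.
Proof.
move=> nw nw' /mnmP eqs; apply/rowP => i; have := eqs i; rewrite !mnmE.
have [ni ni'] := (nw i, nw' i) => /(congr1 Posz).
by rewrite !gez0_abs // => /addIr.
Qed.

Let F N f : {mpoly k[n]} :=
  mlin (fun u => if `[< NN D u >] then phi (mvec u) *: 'X_[shift N (wt (mvec u))] else 0) f.

Let good N f := forall u, u \in msupp f -> nonneg N (wt (mvec u)).

Let good_exists f : exists N, good N f.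
Proof.
exists (\sum_(u <- msupp f) \sum_i absz (wt (mvec u) 0%R i))%N => u uf i.
have le1 : (absz (wt (mvec u) 0%R i) <=
    \sum_(u <- msupp f) \sum_i absz (wt (mvec u) 0%R i))%N.
  rewrite (bigD1_seq u) ?msupp_uniq //= (bigD1 i) //=.
  by rewrite -addnA leq_addr.
by move: le1; clear d0; lia.
Qed.

Let F_mul N N' f g : good N f -> good N' g -> F (N + N')%N (f * g) = F N f * F N' g.
Proof.
move=> gf gg; rewrite /F mlinM /mlin mulr_suml; apply: eq_big_seq => u uf.
rewrite -scalerAl mulr_sumr; congr (_ *: _); apply: eq_big_seq => v vg.
rewrite -scalerAr; congr (_ *: _).
have -> : `[< NN D (u + v)%MM >] = `[< NN D u >] && `[< NN D v >].
  by rewrite -asbool_and; apply: asbool_equiv_eq; apply: NN_add.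
case: asboolP => _ /=; last by rewrite mul0r.
case: asboolP => _ /=; last by rewrite mulr0.
rewrite mvecD wtD phiD shiftD; [|exact: gf|exact: gg].
by rewrite mpolyXD -scalerAl -scalerAr scalerA.
Qed.

Let F_coeff N f u : good N f -> u \in msupp f ->
  (F N f)@_(shift N (wt (mvec u))) = weight_sum (wt (mvec u)) f.
Proof.
move=> gf uf; rewrite /F /weight_sum /mlin raddf_sum; apply: eq_big_seq => v vf /=.
rewrite mcoeffZ; congr (_ * _); case: asboolP => _ /=; last by rewrite mcoeff0.
rewrite mcoeffZ mcoeffX; case: (eqVneq (wt (mvec v)) (wt (mvec u))) => [->|neq].
  by rewrite eqxx mulr1.
case: eqP => [/shift_inj eqs|_]; last by rewrite mulr0.
by case/eqP: neq; apply: eqs; apply: gf.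
Qed.

Let weight_sum_supp c f : weight_sum c f != 0 ->
  exists2 u, u \in msupp f & wt (mvec u) = c.
Proof.
move=> sum0; apply: contrapT => no; case/eqP: sum0.
rewrite /weight_sum /mlin big_seq big1 // => u uf.
case: ifP => [/andP[_ /eqP wu]|_]; last by rewrite scaler0.
by case: no; exists u.
Qed.

Let F_eq0 N f : good N f -> F N f = 0 <-> character_prime f.
Proof.
move=> gf; split=> [F0 c|Pf].
  apply/eqP; apply: contrapT => /negP nz; have [u uf uc] := weight_sum_supp nz.
  by case/eqP: nz; rewrite -uc -(F_coeff gf uf) F0 mcoeff0.
apply/mpolyP => m; rewrite mcoeff0.
case: (pselect (exists2 u, u \in msupp f & shift N (wt (mvec u)) = m)) => [[u uf <-]|no].
  by rewrite F_coeff.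
rewrite /F /mlin raddf_sum big_seq big1 // => u uf /=; rewrite mcoeffZ.
case: asboolP => _; last by rewrite mcoeff0 mulr0.
rewrite mcoeffZ mcoeffX; case: eqP => [um|_]; last by rewrite !mulr0.
by case: no; exists u.
Qed.

(** After shifting away negative exponents, [F] turns products into products in a polynomial ring,
    which is a domain. *)
Lemma character_prime_prime : prime_ideal character_prime.
Proof.
split; first exact: character_prime_ideal.
  by rewrite -mpolyX0; apply: character_primeX; apply: NN0.
move=> f g; have [[N gf] [N' gg]] := (good_exists f, good_exists g).
have gfg : good (N + N')%N (f * g).
  move=> w /msuppM_le/allpairsP[[u v] /= [uf vg ->]] i.
  rewrite mvecD wtD mxE PoszD addrACA addr_ge0 //; [exact: gf|exact: gg].
rewrite -(F_eq0 gfg) -(F_eq0 gf) -(F_eq0 gg) F_mul // => /eqP.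
by rewrite mulf_eq0 => /orP[]/eqP; [left|right].
Qed.

(** Distinct exponents in N^E have distinct weights, since Sat(L) meets Z^E only in 0; each weight
    sum of [b] is thus a single term. *)
Lemma character_prime_transverse b : kN E b -> character_prime b -> b = 0.
Proof.
move=> Eb Pb; apply/eqP; apply: contrapT => /negP b0.
have [ED indE _] := trE; have ub := mlead_supp b0; set u := mlead b in ub.
have := Pb (wt (mvec u)); rewrite /weight_sum /mlin (bigD1_seq u) ?msupp_uniq //=.
have Du : NN D u by apply: (NN_sub ED); apply: Eb.
rewrite asboolT // eqxx /= big_seq_cond big1 ?addr0 => [/eqP|v /andP[vb neuv]].
  by rewrite mulf_eq0 (negbTE (phi_n0 _)) orbF mleadc_eq0 (negbTE b0).
case: ifP => [/andP[_ /eqP eqw]|_]; last by rewrite scaler0.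
have Euv : ZZ E (mvec v - mvec u).
  by apply: (lattice_sub (lattice_ZZ E)); apply/NN_mvec; apply: Eb.
have Duv := ZZ_sub ED Euv.
have : Sat D L (mvec v - mvec u) by apply/(weight_eq0P Duv); rewrite wtD wtN eqw subrr.
move/(SatP _ latL) => [_ [N N0 LN]].
have /(muln_eq0_rV N0)/eqP := indE _ LN (lattice_muln (lattice_ZZ E) N Euv).
by rewrite subr_eq0 => /eqP/mvec_inj vu; rewrite vu eqxx in neuv.
Qed.

Lemma character_prime_sub M sigma : partial_character D M sigma -> M `<=` Sat D L ->
  (forall w, M w -> phi w = sigma w) -> lattice_ideal D M sigma `<=` character_prime.
Proof.
move=> chiM MS eqs; have idP := character_prime_ideal.
suff : lattice_ideal D M sigma `<=` character_prime `&` kN D by move=> sub f /sub[].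
apply: lattice_ideal_ind => [|u v Du Dv Muv].
  split=> [f []//||f g [Pf Df] [Pg Dg]|a f Da [Pf Df]].
  - by split; [apply: (ideal0 idP)|apply: kN0].
  - by split; [apply: (ideal_add idP)|apply: kND].
  - by split; [apply: (ideal_mull idP)|apply: kNM].
split; last by apply: kNB; [apply: kNX|apply: kNZ; apply: kNX].
have Duv : ZZ D (mvec u - mvec v).
  by apply: (lattice_sub (lattice_ZZ D)); apply/NN_mvec.
have wuv : wt (mvec u) = wt (mvec v).
  have := (weight_eq0P Duv).2 (MS _ Muv).
  by rewrite wtD wtN => /eqP; rewrite subr_eq0 => /eqP.
move=> c; rewrite weight_sumB weight_sumZ !weight_sumX !asboolT // wuv.
case: eqP => _ /=; last by rewrite mulr0 subrr.
by rewrite -eqs // -phiD subrK subrr.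
Qed.

(** On k[N^D] the coset sum at [w] for Sat(L) is phi(-w) times the weight sum at [wt w]. *)
Lemma character_prime_Sat f : kN D f -> character_prime f ->
  lattice_ideal D (Sat D L) phi f.
Proof.
move=> Df Pf; have latS := lattice_Sat latL.
apply/(lattice_idealP (total_character_restrict latS tot)); split=> // w.
case: (pselect (ZZ D w)) => Dw.
  transitivity (phi (- w) * weight_sum (wt w) f); last by rewrite Pf mulr0.
  rewrite /coset_sum /weight_sum /mlin mulr_sumr; apply: eq_big_seq => u uf.
  have Duw : ZZ D (mvec u - w).
    by apply: (lattice_sub (lattice_ZZ D)) => //; apply/NN_mvec; apply: Df.
  rewrite (asboolT (Df u uf)) /= -subr_eq0 -wtN -wtD.
  have -> : `[< Sat D L (mvec u - w) >] = (wt (mvec u - w) == 0).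
    by apply/asboolP/eqP => /(weight_eq0P Duw).
  case: eqP => _; last by rewrite scaler0 mulr0.
  by rewrite phiD -[RHS]mulrCA; congr (_ * _); rewrite mulrC.
rewrite /coset_sum /mlin big_seq big1 // => u uf.
rewrite asboolF ?scaler0 // => /(SatP _ latL)[Duw _]; case: Dw.
rewrite -(subKr (mvec u) w); apply: (lattice_sub (lattice_ZZ D)) => //.
by apply/NN_mvec; apply: Df.
Qed.

End CharacterPrime.

(** * The primary components of the hull *)

Section PrimaryComponent.
Variables (k : fieldType) (n : nat) (D E : {set 'I_n}) (I : set {mpoly k[n]}).
Variables (L M : set 'rV[int]_n) (rho sigma phi : 'rV[int]_n -> k).
Variables (d : nat) (wt : 'rV[int]_n -> 'rV[int]_n).
Hypotheses (cellI : cellular D I) (binI : binomial_ideal I).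
Hypotheses (chiI : cellular_character D I L rho) (trE : transverse D L E).
Hypotheses (d0 : (0 < d)%N) (wtD : forall w z, wt (w + z) = wt w + wt z).
Hypothesis wtP : forall w, ZZ D w -> ZZ E (wt w) /\ L (w *+ d - wt w).
Hypotheses (LM : L `<=` M) (MS : M `<=` Sat D L).
Hypothesis chiM : partial_character D M sigma.
Hypothesis eq_rho : forall w, L w -> sigma w = rho w.
Hypotheses (tot : total_character phi) (eq_phi : forall w, M w -> phi w = sigma w).
Hypothesis radM : forall w, Sat D L w -> exists q, [/\ (0 < q)%N, M (w *+ q)
  & forall x y : {mpoly k[n]}, (x - y) ^+ q = x ^+ q - y ^+ q].
Implicit Types (f g b : {mpoly k[n]}) (u v : 'X_{1..n}).

Let idI : is_ideal I. Proof. by case: cellI. Qed.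
Let chi : partial_character D L rho. Proof. by case: chiI. Qed.
Let latL : lattice D L := character_lattice chi.

Notation tc := (torsion_closure (@kN k n E)).

Let J : set {mpoly k[n]} := idealD I (lattice_ideal_ext D M sigma).
Let P : set {mpoly k[n]} := character_prime D phi wt.

Let prP : prime_ideal P. Proof. exact: (character_prime_prime D tot wtD). Qed.
Let idP : is_ideal P. Proof. by case: prP. Qed.

Let idJ : is_ideal J.
Proof. by apply: idealD_ideal => //; apply: ideal_gen_ideal. Qed.

Let IJ : I `<=` J. Proof. by apply: idealDl; apply: ideal_gen_ideal. Qed.

Lemma lattice_ideal_component : lattice_ideal D M sigma `<=` J.
Proof. by move=> f If; apply: idealDr => // K [_]; apply. Qed.

Let not_kN_radical u : ~ NN D u -> radical I 'X_[u].
Proof.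
move=> nDu; rewrite -[u](partC D) mpolyXD.
apply: (ideal_mull (radical_ideal idI)); apply: (cellular_nilpotent cellI (@NN_part _ _ _)).
apply/eqP => part0; apply: nDu; rewrite -[u](partC D) part0 addm0.
exact: NN_part.
Qed.

Let proj_radical f : radical I (f - mproj (NN D) f).
Proof.
rewrite -mproj_setC; apply: (ideal_supp (radical_ideal idI)) => u /mproj_msupp[_].
exact: not_kN_radical.
Qed.

Let proj_prime f : P (f - mproj (NN D) f).
Proof.
rewrite -mproj_setC; apply: (ideal_supp idP) => u /mproj_msupp[_].
exact: character_primeX0.
Qed.

(** An element of [I] agrees with its projection to k[N^D] modulo both [P] and the radical of [I]; a
    power of that projection lies in I(rho), inside I(sigma). *)
Lemma component_sub_prime : J `<=` P.
Proof.
have latP : lattice_ideal D M sigma `<=` P.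
  by apply: (character_prime_sub latL trE tot d0 wtD wtP chiM).
apply: idealD_sub => //; last by apply: ideal_gen_sub.
move=> f If; apply/(ideal_equiv idP (proj_prime f)).
have [e Ie] : radical I (mproj (NN D) f).
  apply/(ideal_equiv (radical_ideal idI) (proj_radical f)).
  exact: radical_sub.
apply: (prime_expr prP (e := e)); apply: latP.
apply: ((lattice_ideal_sub chiM chi).2 _).
  by move=> w Lw; rewrite eq_rho //; split=> //; apply: LM.
by apply/(lattice_ideal_cellular chiI) => //; apply: kNXn; apply: kN_mproj.
Qed.

(** The q-th power of a binomial generator on Sat(L) is a generator of the lattice ideal of [sigma],
    by the Frobenius property of q. *)
Lemma prime_sub_radical : P `<=` radical J.
Proof.
have idR := radical_ideal idJ.
move=> f Pf; apply/(ideal_equiv idR (g := mproj (NN D) f)).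
  by have [e Ie] := proj_radical f; exists e; apply: IJ.
have Pf0 : P (mproj (NN D) f) by apply/(ideal_equiv idP (proj_prime f)).
have := character_prime_Sat latL trE tot d0 wtD wtP (@kN_mproj _ _ D f) Pf0.
suff sub : lattice_ideal D (Sat D L) phi `<=` radical J `&` kN D by move/sub => [].
apply: lattice_ideal_ind => [|u v Du Dv Suv].
  split=> [g []//||g h [Jg Dg] [Jh Dh]|a g Da [Jg Dg]].
  - by split; [apply: (ideal0 idR)|apply: kN0].
  - by split; [apply: (ideal_add idR)|apply: kND].
  - by split; [apply: (ideal_mull idR)|apply: kNM].
split; last by apply: kNB; [apply: kNX|apply: kNZ; apply: kNX].
have [q [q0 Mq frob]] := radM Suv; exists q.
rewrite frob exprZn !mpolyXn; apply: lattice_ideal_component.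
have vecE : mvec (u *+ q)%MM - mvec (v *+ q)%MM = (mvec u - mvec v) *+ q.
  by rewrite !mvecMn mulrnBl.
have -> : phi (mvec u - mvec v) ^+ q = sigma (mvec (u *+ q)%MM - mvec (v *+ q)%MM).
  by rewrite vecE -eq_phi // (characterMn tot).
by apply: lattice_ideal_gen; [apply: NN_muln|apply: NN_muln|rewrite vecE].
Qed.

Let P0 b : kN E b -> P b -> b = 0.
Proof. exact: (character_prime_transverse latL trE tot d0 wtD wtP). Qed.

Lemma component_closure_sub_prime : tc J `<=` P.
Proof.
move=> f [b [Eb /eqP b0 /component_sub_prime Pbf]]; have [_ _ prP'] := prP.
by case: (prP' _ _ Pbf) => // /(P0 Eb).
Qed.

Lemma component_primary : is_primary (tc J).
Proof.
have idQ : is_ideal (tc J).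
  by apply: torsion_closure_ideal => //; [exact: kN1|exact: kNM].
have [_ P1 _] := prP; split=> [//|/component_closure_sub_prime //|f g Qfg].
case: (pselect (P g)) => [/prime_sub_radical[e Jg]|nPg]; [right|left].
  by exists e; apply: torsion_closure_sub => //; apply: kN1.
have IP : I `<=` P := subset_trans IJ component_sub_prime.
have [t [b [Eb b0 Ptg]]] := prime_transverse_divides cellI chiI trE prP IP P0 nPg.
have [e Je] := prime_sub_radical Ptg.
apply: (@torsion_closureM _ (@kN k n E) (@kNM k n E) (b ^+ e) J).
- exact: kNXn.
- exact: expf_neq0.
(* Since (t g - b)^e is in [J], modulo [J] the power b^e is a multiple of [g], by factoring a
   difference of e-th powers. Hence b^e f is torsion. *)
have -> : b ^+ e = t * g * \sum_(i < e) b ^+ (e.-1 - i) * (- (t * g - b)) ^+ i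
                 + (- (t * g - b)) ^+ e.
  rewrite -[X in X * _](_ : b - - (t * g - b) = _); last first.
    by rewrite opprK addrCA subrr addr0.
  by rewrite -subrXX subrK.
rewrite mulrDl; apply: ideal_add => //; last first.
  rewrite exprNn; apply: torsion_closure_sub; first exact: kN1.
  by rewrite -mulrA mulrCA; apply: ideal_mulr.
by rewrite -!mulrA [g * _]mulrCA; do 2!apply: ideal_mull => //; rewrite mulrC.
Qed.

(** Subtracting the binomial with the right value would leave a nonzero multiple of a monomial of
    k[N^D] in the prime. *)
Lemma component_binomial_not_prime w c : M w -> c != sigma w ->
  ~ P ('X_[posm w] - c *: 'X_[negm w]).
Proof.
move=> Mw neq Pw; have Dw := lattice_sub_ZZ (character_lattice chiM) Mw.
have [Dp Dn] := (NN_posm Dw, NN_negm Dw).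
have Ps : P ('X_[posm w] - sigma w *: 'X_[negm w]).
  apply: component_sub_prime; apply: lattice_ideal_component.
  by rewrite -{2}(posm_negm w); apply: lattice_ideal_gen; rewrite ?posm_negm.
apply: (character_primeX (wt := wt) tot Dn).
apply: (ideal_scaleK idP (c := sigma w - c)); first by rewrite subr_eq0 eq_sym.
have := ideal_sub idP Pw Ps.
by rewrite opprB addrC addrA subrK -scalerBl.
Qed.

End PrimaryComponent.

Section Decomposition.
Variables (k : fieldType) (n : nat) (D E : {set 'I_n}) (I : set {mpoly k[n]}).
Variables (L M : set 'rV[int]_n) (rho : 'rV[int]_n -> k).
Variables (g : nat) (rho_ : 'I_g -> 'rV[int]_n -> k).
Hypothesis closed : GRing.closed_field_axiom k.
Hypotheses (cellI : cellular D I) (binI : binomial_ideal I).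
Hypotheses (chiI : cellular_character D I L rho) (trE : transverse D L E).
Hypotheses (latM : lattice D M) (LM : L `<=` M) (MS : M `<=` Sat D L).
Hypothesis torsM : forall w, M w ->
  exists d, [/\ (0 < d)%N, d%:R != 0 :> k & L (w *+ d)].
Hypothesis radM : forall w, Sat D L w -> exists q, [/\ (0 < q)%N, M (w *+ q)
  & forall x y : {mpoly k[n]}, (x - y) ^+ q = x ^+ q - y ^+ q].
Hypothesis ext : character_extensions D L rho M rho_.
Implicit Types (f h b U W : {mpoly k[n]}) (u v : 'X_{1..n}) (l j : 'I_g).

Let idI : is_ideal I. Proof. by case: cellI. Qed.
Let chi : partial_character D L rho. Proof. by case: chiI. Qed.
Let latL : lattice D L := character_lattice chi.

Notation tc := (torsion_closure (@kN k n E)).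

Let chi_ l : partial_character D M (rho_ l).
Proof. by case: ext => /(_ l)[]. Qed.

Let eq_ l w : L w -> rho_ l w = rho w.
Proof. by case: ext => /(_ l)[_ eql] _ _; apply: eql. Qed.

Let J l : set {mpoly k[n]} := idealD I (lattice_ideal_ext D M (rho_ l)).

Let idJ l : is_ideal (J l).
Proof. by apply: idealD_ideal => //; apply: ideal_gen_ideal. Qed.

Let IJ l : I `<=` J l. Proof. by apply: idealDl; apply: ideal_gen_ideal. Qed.

Let idtcJ l : is_ideal (tc (J l)).
Proof. by apply: torsion_closure_ideal => //; [exact: kN1|exact: kNM]. Qed.

Lemma bigcap_lattice_ideal f : kN D f -> (forall l, lattice_ideal D M (rho_ l) f) -> I f.
Proof.
move=> Df If; apply/(lattice_ideal_cellular chiI Df).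
exact: (lattice_ideal_bigcap closed chi latM LM torsM ext Df If).
Qed.

(* Chinese remaindering: modulo a monomial in the variables of [D], the ideal of
   [rho_ l] is comaximal with the intersection of the others. *)
Lemma comaximal l : exists u U W, [/\ NN D u, lattice_ideal D M (rho_ l) U, kN D W,
  forall j, j != l -> lattice_ideal D M (rho_ j) W & 'X_[u] = U + W].
Proof.
have cut j : j != l -> exists u U W, [/\ NN D u, lattice_ideal D M (rho_ l) U,
    lattice_ideal D M (rho_ j) W & 'X_[u] = U + W].
  move=> nejl; have [_ distinct _] := ext; have [w Mw neq] := distinct j l nejl.
  have Dw := lattice_sub_ZZ latM Mw.
  have gen i : lattice_ideal D M (rho_ i) ('X_[posm w] - rho_ i w *: 'X_[negm w]).
    rewrite -{2}(posm_negm w); apply: lattice_ideal_gen; rewrite ?posm_negm //.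
      exact: NN_posm.
    exact: NN_negm.
  pose c := (rho_ j w - rho_ l w)^-1.
  exists (negm w), (c *: ('X_[posm w] - rho_ l w *: 'X_[negm w])),
    (- c *: ('X_[posm w] - rho_ j w *: 'X_[negm w])); split.
  - exact: NN_negm.
  - exact: lattice_idealZ.
  - exact: lattice_idealZ.
  rewrite scaleNr -scalerBr opprB [X in c *: X]addrC addrA subrK -scalerBl scalerA.
  by rewrite mulVf ?scale1r // subr_eq0.
suff crt (s : seq 'I_g) : exists u U W, [/\ NN D u, lattice_ideal D M (rho_ l) U, kN D W,
    forall j, j \in s -> j != l -> lattice_ideal D M (rho_ j) W & 'X_[u] = U + W].
  have [u [U [W [Du IU DW IW uE]]]] := crt (enum 'I_g).
  by exists u, U, W; split=> // j; apply: IW; rewrite mem_enum.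
elim: s => [|j s [u [U [W [Du IU DW IW uE]]]]].
  exists 0%MM, 0, 1; split=> //; rewrite ?mpolyX0 ?add0r //.
  - exact: NN0.
  - exact: lattice_ideal0.
  - exact: kN1.
case: (eqVneq j l) => [->|nejl].
  exists u, U, W; split=> // i; rewrite inE => /predU1P[->|]; first by rewrite eqxx.
  exact: IW.
have [u' [U' [W' [Du' IU' IW' uE']]]] := cut j nejl.
have [DU' DW'] := (lattice_ideal_kN IU', lattice_ideal_kN IW').
(* Expand (U + W)(U' + W'): every term except W W' has a factor in the ideal of [rho_ l]. *)
exists (u + u')%MM, ((U' + W') * U + W * U'), (W' * W); split.
- exact/NN_add.
- by apply: lattice_idealD; apply: lattice_idealM => //; apply: kND.
- exact: kNM.
- move=> i; rewrite inE => /predU1P[-> _|si nil].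
    by rewrite mulrC; apply: lattice_idealM.
  by apply: lattice_idealM => //; apply: IW.
- by rewrite mpolyXD uE uE'; ring.
Qed.

(** [W] times the ideal of [rho_ l] lies in all the lattice ideals, hence in I(rho). *)
Lemma cofactor_component l W h : kN D W ->
    (forall j, j != l -> lattice_ideal D M (rho_ j) W) -> J l h -> I (W * h).
Proof.
move=> DW IW Jh; rewrite mulrC; move: h Jh.
have idC := colon_ideal W idI.
apply: (idealD_sub (Q := colon I W)) => // [f If|]; first exact: ideal_mulr.
apply: ideal_gen_sub => // f If; have Df := lattice_ideal_kN If.
apply: bigcap_lattice_ideal => [|j]; first exact: kNM.
case: (eqVneq j l) => [->|nejl]; last by apply: lattice_idealM => //; apply: IW.
by rewrite mulrC; apply: lattice_idealM.
Qed.

Lemma bigcap_component : \bigcap_l tc (J l) = tc I.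
Proof.
apply/seteqP; split=> [f Jf|f tf l _]; last by apply: torsion_closure_mono tf.
have [|b [Eb b0 Jbf]] := torsion_closure_common (@kN1 k n E) (@kNM k n E) idJ (f := f).
  by move=> l; apply: Jf.
exists b; split=> //; set h := b * f in Jbf *.
have /choice[u /choice[U /choice[W cm]]] := comaximal.
(* As W_l h is in [I], multiplying [h] by the monomial of index l amounts to multiplying by U_l
   modulo [I]; the product of all U_l is in [I]. *)
have [v Dv Iv] : exists2 v, NN D v & I ('X_[v] * h - (\prod_l U l) * h).
  elim: (index_enum _) => [|l s [v Dv Iv]].
    exists 0%MM; first exact: NN0.
    by rewrite big_nil mpolyX0 subrr; apply: ideal0.
  have [Du IU DW IW uE] := cm l.
  exists (u l + v)%MM; first exact/NN_add.
  have -> : 'X_[u l + v] * h - \prod_(i <- l :: s) U i * h =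
      U l * ('X_[v] * h - \prod_(i <- s) U i * h) + 'X_[v] * (W l * h).
    by rewrite mpolyXD uE big_cons; ring.
  apply: ideal_add => //; apply: ideal_mull => //.
  exact: (cofactor_component DW IW).
have IU : I (\prod_l U l).
  apply: bigcap_lattice_ideal => [|l].
    by apply: kN_prod => l; case: (cm l) => _ /lattice_ideal_kN.
  rewrite (bigD1 l) //= mulrC; have [_ IUl _ _ _] := cm l.
  by apply: lattice_idealM => //; apply: kN_prod => j; case: (cm j) => _ /lattice_ideal_kN.
apply: (cellular_cancel cellI Dv); rewrite mulrC.
apply/(ideal_equiv idI Iv); exact: ideal_mulr.
Qed.

(* With [X^u = U + W] as in [comaximal], [U f] is in the ideal of [rho_ l] and
   [W f] in the torsion closure of [I]; restricting to the monomials that are not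
   torsion modulo [I] puts [X^u f] in [J l]. *)
Lemma componentE l : idealD (saturation (J l) (\prod_(i in D) 'X_i)) (M_emb D I) = tc (J l).
Proof.
have x1E : \prod_(i in D) 'X_i = 'X_[\sum_(i in D) U_(i)] :> {mpoly k[n]}.
  by rewrite mprodXE.
set x1 := (\sum_(i in D) U_(i))%MM in x1E.
have Dx1 : NN D x1.
  move=> i Di; rewrite /x1 mnm_sumE big1 // => j Dj; rewrite mnm1E.
  by case: eqP => // ji; rewrite ji (negbTE Di) in Dj.
have x1_gt0 i : i \in D -> (0 < x1 i)%N.
  by move=> Di; rewrite /x1 mnm_sumE (bigD1 i) //= mnm1E eqxx.
have closure_cancel u f : NN D u -> J l (f * 'X_[u]) -> tc (J l) f.
  move=> Du Jf; have [t [b [Eb b0 Itb]]] := mnm_invertible cellI chiI trE Du.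
  exists b; split=> //.
  apply/(ideal_equiv (idJ l) (g := t * 'X_[u] * f)).
    rewrite -mulrBl; apply: ideal_mulr => //; apply: IJ; exact: ideal_subC.
  by rewrite -mulrA; apply: ideal_mull => //; rewrite mulrC.
apply/seteqP; split.
  apply: idealD_sub => // [f [e]|].
    by rewrite x1E mpolyXn; apply: closure_cancel; apply: NN_muln.
  apply: subset_trans (M_emb_torsion cellI chiI trE) _.
  exact: torsion_closure_mono.
move=> f [b [Eb b0 Jbf]]; have [u [U [W [Du IU DW IW uE]]]] := comaximal l.
have tW : tc I (W * f).
  by exists b; split=> //; rewrite mulrCA; apply: (cofactor_component DW IW Jbf).
pose T : set 'X_{1..n} := [set v | tc I 'X_[v]].
have idT : is_ideal (tc I) := tcI_ideal E cellI.
have T_stable a v : kN D a -> forall w, w \in msupp a -> (~` T) (w + v)%MM <-> (~` T) v.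
  move=> Da w /Da Dw; split; apply: contra_not.
    by rewrite /T /= mpolyXD; apply: (ideal_mull idT).
  move=> [c [Ec c0 Ic]]; exists c; split=> //; apply: (cellular_cancel cellI Dw).
  by rewrite -mulrA [_ * 'X_[w]]mulrC -mpolyXD.
have tT x : tc I (mproj T x).
  by apply: (ideal_supp idT) => v /mproj_msupp[].
pose h := mproj (~` T) f.
have IWh : I (W * h).
  rewrite /h -mprojM; last by move=> w v wW; apply: T_stable DW _ wW.
  apply: (torsion_free_part cellI binI trE) => [|v /mproj_msupp[]//].
  by rewrite mproj_setC; apply: (ideal_sub idT).
have Jh : J l ('X_[u] * h).
  rewrite uE mulrDl addrC; exists (W * h), (U * h); split=> //.
  by apply: (ideal_mulr (ideal_gen_ideal _)) => K [_]; apply.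
rewrite [f](mprojC T) addrC -/h.
have [i [m [Ii Mm ->]]] : idealD I (M_emb D I) (mproj T f).
  by rewrite (idealD_M_emb cellI binI chiI trE).
exists (h + i), m; split=> //; last by rewrite addrA.
(* The total degree of [u] bounds each of its exponents, so this power of the product of the
   variables is divisible by [X^u]. *)
exists (mdeg u); rewrite x1E mpolyXn.
have le_u : (u <= x1 *+ mdeg u)%MM.
  apply/mnm_lepP => j; rewrite mulmnE; case: (boolP (j \in D)) => Dj; last by rewrite Du.
  apply: leq_trans (_ : u j <= mdeg u)%N _; last by rewrite leq_pmull ?x1_gt0.
  by rewrite mdegE (bigD1 j) //= leq_addr.
rewrite mulrDl; apply: ideal_add => //; last by apply: ideal_mulr => //; apply: IJ.
by rewrite -(submK le_u) mpolyXD mulrC -mulrA; apply: ideal_mull.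
Qed.

Lemma component_decomposition :
  minimal_primary_decomposition (tc I) (fun l => tc (J l)).
Proof.
have [d d0 [wt [wtD wtP]]] := transverse_weight latL trE.
have /choice[phi phiP] : forall l, exists phi, total_character phi /\
    forall w, M w -> phi w = rho_ l w.
  by move=> l; have [phi ? ?] := character_extension closed (chi_ l); exists phi.
pose P l := character_prime D (phi l) wt.
have prP l : prime_ideal (P l).
  by case: (phiP l) => tot _; apply: (character_prime_prime D tot wtD).
have subP l : tc (J l) `<=` P l.
  have [tot eqphi] := phiP l.
  exact: (component_closure_sub_prime cellI chiI trE d0 wtD wtP LM MS
    (chi_ l) (eq_ l) tot eqphi).
have prQ l : is_primary (tc (J l)).
  have [tot eqphi] := phiP l.
  exact: (component_primary cellI chiI trE d0 wtD wtP LM MS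
    (chi_ l) (eq_ l) tot eqphi radM).
(* The prime of index l contains no other component; this gives both the distinct radicals and the
   irredundancy. *)
have avoid l j : j != l -> exists2 s, tc (J j) s & ~ P l s.
  move=> nejl; have [_ distinct _] := ext; have [w Mw neq] := distinct j l nejl.
  have Dw := lattice_sub_ZZ latM Mw.
  exists ('X_[posm w] - rho_ j w *: 'X_[negm w]).
    apply: torsion_closure_sub; first exact: kN1.
    apply: lattice_ideal_component => //.
    rewrite -{2}(posm_negm w); apply: lattice_ideal_gen; rewrite ?posm_negm //.
      exact: NN_posm.
    exact: NN_negm.
  have [tot eqphi] := phiP l.
  exact: (component_binomial_not_prime cellI chiI trE d0 wtD wtP LM MS
    (chi_ l) (eq_ l) tot eqphi).
split=> // [|i j neij eqr|l sub].
- by rewrite bigcap_component.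
- have neji : j != i by rewrite eq_sym.
  have [s Qs nPs] := avoid i j neji; apply: nPs.
  by apply: (prime_radical (prP i) (@subP i)); rewrite eqr; apply: radical_sub.
- have [s Qs nPs] := prime_avoid_product (D := fun j => tc (J j)) (p := fun j => j != l)
    (prP l) (fun j => idtcJ j) (fun j => avoid l j).
  by apply: nPs; apply: subP; apply: sub => j; apply: Qs.
Qed.

End Decomposition.

Theorem theorem2p10 (k : fieldType) (n : nat) (D : {set 'I_n})
    (I : set {mpoly k[n]}) (cellI : cellular D I) (binI : binomial_ideal I) :
  [/\ Hull I = idealD I (M_emb D I),
      binomial_ideal (Hull I)
    & GRing.closed_field_axiom k ->
      forall (p : nat) (L Satp : set 'rV[int]_n) (rho : 'rV[int]_n -> k)
             (g : nat) (rho_ : 'I_g -> 'rV[int]_n -> k),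
        has_characteristic k p ->
        cellular_character D I L rho ->
        is_Satp D p L Satp ->
        lattice_index Satp L g ->
        character_extensions D L rho Satp rho_ ->
        Hull I = idealD I (M_emb D I) /\
        minimal_primary_decomposition (Hull I)
          (fun l : 'I_g =>
             idealD (saturation (idealD I (lattice_ideal_ext D Satp (rho_ l)))
                                (\prod_(i in D) 'X_i))
                    (M_emb D I))].
Proof.
split; [exact: Hull_idealD|exact: binomial_Hull cellI binI|].
move=> closed p L M rho g rho_ char_p chiI satM _ ext.
split; first exact: Hull_idealD.
have latL := character_lattice (proj1 chiI).
have [E trE] := transverse_exists latL.
have [latM LM MS] := Satp_lattice latL satM.
have torsM := Satp_torsion char_p latL satM.
have radM := Satp_radical char_p latL satM.
rewrite (Hull_torsion_closure cellI binI chiI trE).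
under [fun l => _]funext => l.
  rewrite (componentE closed cellI binI chiI trE latM LM torsM ext l); over.
exact: (component_decomposition closed cellI chiI trE latM LM MS torsM radM ext).
Qed.
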